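(* Let $n\ge1$, $\lambda\vdash n$, $\rho=[1^{n-2}2^1]$, $r_\lambda=|\lambda|-\ell(\lambda)$, and for an integer $r\ge 0$ let $$a^r_\lambda(\alpha)=\sum_{\beta\vdash n}\frac{1}{h_\beta(\alpha)h'_\beta(\alpha)}\,\theta^\beta_\lambda(\alpha)\left(\theta^\beta_{\rho}(\alpha)\right)^r .$$ For every $r\ge r_\lambda$ there are integers $g^i_{\lambda,r}$, $0\le i\le r-r_\lambda$, such that $$a^r_\lambda(\alpha)=\frac{1}{n!}\sum_{i=0}^{r-r_\lambda}g^i_{\lambda,r}\,\alpha^{i-\ell(\lambda)},$$ and these integers satisfy $g^i_{\lambda,r}=(-1)^{r-r_\lambda}g^{r-r_\lambda-i}_{\lambda,r}$ for all $0\le i\le r-r_\lambda$.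
   Context: Partitions: $\lambda\vdash n$ has $\ell(\lambda)$ parts and size $|\lambda|=n$; $[1^{m_1}2^{m_2}\dots]$ denotes the partition with $m_i$ parts equal to $i$. For a box $s$ of the Young diagram of $\lambda$, $a(s)$ and $l(s)$ are the numbers of boxes strictly to the east and strictly to the south of $s$. $h_\lambda(\alpha)=\prod_{s\in\lambda}(\alpha a(s)+l(s)+1)$, $h'_\lambda(\alpha)=\prod_{s\in\lambda}(\alpha(1+a(s))+l(s))$, $z_\lambda=\prod_i i^{m_i(\lambda)}m_i(\lambda)!$. The Jack symmetric functions $J^\alpha_\lambda$ are orthogonal for $\langle p_\lambda,p_\mu\rangle_\alpha=\alpha^{\ell(\lambda)}z_\lambda\delta_{\lambda\mu}$ ($p$ = power sums) and satisfy $J^\alpha_\lambda=h_\lambda(\alpha)m_\lambda+\sum_{\mu<\lambda}u^\alpha_{\lambda\mu}m_\mu$ ($m$ = monomial symmetric functions, $<$ = dominance order). Jack characters $\theta^\lambda_\mu(\alpha)$ are defined by $J^\alpha_\lambda=\sum_{\mu\vdash n}\theta^\lambda_\mu(\alpha)p_\mu$. *)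

(* Defs.v *)
From HB Require Import structures.
From mathcomp Require Import all_boot all_order all_algebra.
From mathcomp Require Import mpoly.

Set Implicit Arguments.
Unset Strict Implicit.
Unset Printing Implicit Defensive.

Import Order.TTheory GRing.Theory Num.Theory.
Local Open Scope ring_scope.

(** ** Integer partitions *)

(* A partition of n has at most n parts, all at most n; it is stored as the
   weakly decreasing n-tuple of its parts padded with zeros. *)
Record intpart (n : nat) := IntPart {
  intpart_val :> n.-tuple 'I_n.+1;
  intpart_valP : sorted geq [seq val i | i <- intpart_val]
                 && (sumn [seq val i | i <- intpart_val] == n)
}.
HB.instance Definition _ n := [isSub for @intpart_val n].
HB.instance Definition _ n := [Finite of intpart n by <:].

Section Partitions.
Variable n : nat.
Implicit Types la mu : intpart n.

(* Rows are numbered from 0; part la i = 0 for i >= n. *)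
Definition part la (i : nat) : nat := nth 0%N [seq val x | x <- la] i.

Definition parts la : seq nat :=
  [seq x <- [seq val y | y <- la] | (0 < x)%N].

Definition ell la : nat := size (parts la).

Definition mult la (i : nat) : nat := count_mem i (parts la).

Definition zee la : nat :=
  \prod_(1 <= i < n.+1) (i ^ mult la i * (mult la i)`!)%N.

Definition dom_le mu la : bool :=
  [forall k : 'I_n.+1,
    (\sum_(i < k) part mu i <= \sum_(i < k) part la i)%N].

Definition dom_lt mu la : bool := (mu != la) && dom_le mu la.

(* The box (i, j) is in the diagram of la iff j < part la i. *)
Definition arm la (i j : nat) : nat := (part la i - j.+1)%N.

Definition leg la (i j : nat) : nat :=
  #|[set k : 'I_n | (i < k)%N && (j < part la k)%N]|.

End Partitions.

(** ** The coefficient field Q(alpha) *)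

Definition Qalpha := {fraction {poly rat}}.

Definition alpha : Qalpha := tofrac ('X : {poly rat}).

Section HookProducts.
Variable n : nat.
Implicit Types la : intpart n.

Definition hook la : Qalpha :=
  \prod_(i < n) \prod_(j < part la i)
    (alpha * (arm la i j)%:R + (leg la i j)%:R + 1).

Definition hook' la : Qalpha :=
  \prod_(i < n) \prod_(j < part la i)
    (alpha * (1 + (arm la i j)%:R) + (leg la i j)%:R).

End HookProducts.

(** ** Symmetric functions *)

(* f : symfun n stands for \sum_mu f mu *: p_mu, a homogeneous symmetric
   function of degree n over Q(alpha), given by its coordinates on the basis of
   power sums.  Its restriction to the variables x_1, ..., x_N is [restr N f];
   an identity between symmetric functions is an identity between these
   restrictions for every N. *)
Definition symfun (n : nat) := {ffun intpart n -> Qalpha}.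

Section SymmetricFunctions.
Variable n : nat.
Implicit Types (la mu : intpart n) (f g : symfun n).

Definition powersum (N k : nat) : {mpoly Qalpha[N]} := \sum_(i < N) 'X_i ^+ k.

Definition powersum_part (N : nat) mu : {mpoly Qalpha[N]} :=
  \prod_(k <- parts mu) powersum N k.

(* The sum of all distinct monomials in x_1, ..., x_N whose nonzero exponents
   are, up to order, the parts of mu. *)
Definition monomial_part (N : nat) mu : {mpoly Qalpha[N]} :=
  \sum_(m : 'X_{1..N < n.+1}
        | perm_eq [seq k <- (m : 'X_{1..N}) | (0 < k)%N] (parts mu))
    'X_[m : 'X_{1..N}].

Definition restr (N : nat) f : {mpoly Qalpha[N]} :=
  \sum_mu f mu *: powersum_part N mu.

(* The bilinear form with <p_la, p_mu> = alpha ^ ell(la) z_la delta_(la, mu). *)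
Definition sprod f g : Qalpha :=
  \sum_mu f mu * g mu * (alpha ^+ ell mu * (zee mu)%:R).

End SymmetricFunctions.

(** ** Jack symmetric functions *)

(* Symmetric functions of distinct degrees are orthogonal, so only pairs of
   the same degree have to be considered.  The coefficients u do not depend on
   the number N of variables. *)
Definition is_jack (J : forall n, intpart n -> symfun n) : Prop :=
  (forall n (la mu : intpart n), la != mu -> sprod (J n la) (J n mu) = 0) /\
  (forall n (la : intpart n), exists u : intpart n -> Qalpha, forall N,
     restr N (J n la) =
       hook la *: monomial_part N la
       + \sum_(mu | dom_lt mu la) u mu *: monomial_part N mu).

Definition jack_char (J : forall n, intpart n -> symfun n)
    (n : nat) (la mu : intpart n) : Qalpha := J n la mu.

(* The coefficient in J_la of the power sum indexed by the partition whose
   parts are listed in s; it is 0 if s is not a partition of n. *)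
Definition jack_char_seq (J : forall n, intpart n -> symfun n)
    (n : nat) (la : intpart n) (s : seq nat) : Qalpha :=
  if [pick mu : intpart n | parts mu == s] is Some mu
  then jack_char J la mu else 0.

(* The parts of [1^(n-2) 2^1], for n >= 2.  For n = 1 this is [:: 2], which is
   not a partition of 1, so the corresponding character vanishes. *)
Definition rho (n : nat) : seq nat := 2%N :: nseq (n - 2) 1%N.

Definition acoef (J : forall n, intpart n -> symfun n)
    (n : nat) (la : intpart n) (r : nat) : Qalpha :=
  \sum_(be : intpart n)
    (hook be * hook' be)^-1 * jack_char J be la
    * jack_char_seq J be (rho n) ^+ r.

Definition rank n (la : intpart n) : nat := (n - ell la)%N.

(* Main.v *)
(** On Q(alpha)[p_1, ..., p_n] let D be the Laplace--Beltrami operator.  It is self-adjoint for the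
    Jack scalar product and triangular on monomials, so the Jack functions are its eigenvectors;
    the eigenvalue of J_beta equals theta^beta_rho, because the coefficient of p_1^n in D f is that
    of p_1^(n-2) p_2 in f, and J_beta has coefficient 1 at p_1^n.  This normalization, and
    <J_beta, J_beta> = h_beta h'_beta, come from the evaluation of J_beta at p_k = X, which is
    proved through column and row removal, the support of the Pieri rule for d/dp_1 and the Cauchy
    kernel.  Hence p_1^n = alpha^n n! \sum_beta J_beta / (h_beta h'_beta), and a^r_lambda is
    (alpha^n n!)^-1 times the coefficient of p_lambda in D^r p_1^n.  On p_mu, D is a sum of joins
    of two parts with factor alpha, cuts of a part, and multiplications by (alpha - 1), all with
    integer multiplicities; joins raise the rank by one and cuts lower it by one.  By induction on
    r the coefficient of p_mu in D^r p_1^n is alpha^(rank mu) times an integer polynomial of degree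
    at most r - rank mu that is palindromic up to the sign (-1)^(r - rank mu). *)

Require Import Defs.
From HB Require Import structures.
From mathcomp Require Import all_boot all_order all_algebra.
From mathcomp Require Import mpoly ssrcomplements.
From mathcomp Require Import zify ring.
Set Implicit Arguments.
Unset Strict Implicit.
Unset Printing Implicit Defensive.
Import Order.TTheory GRing.Theory Num.Theory.
Local Open Scope ring_scope.

(** * Sequences of naturals *)

(** The eigenvalue does not determine the partition: [4,1,1] and [3,3] share theirs for every alpha.
    Column and row removal therefore rest on a finer statement: eigenfunctions with the same
    eigenvalue coincide once their coefficients of small [minsum] coincide. It is proved for
    arbitrary functions on exponent sequences, with no symmetry assumed, so that deleting a row or a
    column is a mere substitution in the argument and yields an eigenfunction again. The evaluation
    at p_k = X comes from the commutator of d/dp_1 with D: on eigenfunctions it acts by differences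
    of eigenvalues, which the Pieri support turns into contents of added boxes. Column removal then
    gives the normalization. The norms come from the Cauchy kernel at X = - a M, where it is the
    product of the (1 - x_i)^M and where partitions wider than M have evaluation zero. The operator
    is doubled, so that sums over ordered pairs need no halves; the half returns only for
    integrality. Of alpha, only the independence of 1 and alpha over the integers is used. *)

Lemma geq_trans : transitive geq.
Proof. by move=> y x z xy yz; apply: leq_trans yz xy. Qed.

Lemma sorted_geqE x s : sorted geq (x :: s) = all (fun y => y <= x)%N s && sorted geq s.
Proof. by rewrite /= path_sortedE //; apply: geq_trans. Qed.

Definition pos (s : seq nat) : seq nat := [seq x <- s | (0 < x)%N].

Definition is_part (t : seq nat) : bool := sorted geq t && all (fun x => 0 < x)%N t.

(** Set up for unsorted sequences with zeros, since exponent vectors are such; it depends only on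
    the multiset of positive entries and stands in for the dominance order. *)
Definition minsum (s : seq nat) : nat := \sum_(x <- s) \sum_(y <- s) minn x y.

Lemma minsum_perm s t : perm_eq s t -> minsum s = minsum t.
Proof.
move=> st; rewrite /minsum (perm_big _ st) /=; apply: eq_bigr => x _.
by rewrite (perm_big _ st).
Qed.

Lemma minsum_cons x s :
  minsum (x :: s) = (x + (\sum_(y <- s) minn x y).*2 + minsum s)%N.
Proof.
rewrite /minsum big_cons big_cons minnn; under [X in (_ + X)%N]eq_bigr => y _ do
  rewrite big_cons.
rewrite big_split /= -addnn.
under [X in (_ + (X + _))%N]eq_bigr => y _ do rewrite minnC.
lia.
Qed.

Lemma minsum_pos s : minsum (pos s) = minsum s.
Proof.
elim: s => // x s IH; rewrite /pos /=; case: ltnP => hx; rewrite !minsum_cons.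
  rewrite -IH; congr (_ + _ + _)%N; congr (_.*2); rewrite big_filter big_mkcond.
  by apply: eq_bigr => y _; case: ltnP => //; rewrite leqn0 => /eqP->; rewrite minn0.
by move: hx; rewrite leqn0 => /eqP->; rewrite IH big1 // => i _; rewrite min0n.
Qed.

Lemma sumn_pos s : sumn (pos s) = sumn s.
Proof. by elim: s => // x s IH; rewrite /pos /=; case: ltnP => /= hx; rewrite [sumn _]IH //; lia. Qed.

(** The remainder [r] is independent of [a] and [b], so [s] and all its modifications at the two
    positions are compared over the same multiset. *)
Lemma set_nth2_perm (s : seq nat) i j :
  (i < size s)%N -> (j < size s)%N -> i != j ->
  exists r, forall a b, perm_eq (set_nth 0%N (set_nth 0%N s i a) j b) [:: a, b & r].
Proof.
have one : forall (s : seq nat) i, (i < size s)%N ->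
  exists r, forall a, perm_eq (set_nth 0%N s i a) (a :: r).
  elim=> // x {}s IH [|{}i] /= hi; first by exists s.
  have [r hr] := IH i hi; exists (x :: r) => a.
  have := hr a; rewrite -(perm_cons x) => h; apply: perm_trans h _.
  by rewrite (perm_catCA [:: x] [:: a]).
elim: s i j => // x s IH [|i] [|j] //=; rewrite ?ltnS => hi hj ij.
- by have [r hr] := one s j hj; exists r => a b; rewrite perm_cons.
- have [r hr] := one s i hi; exists r => a b.
  have := hr a; rewrite -(perm_cons b) => h; apply: perm_trans h _.
  by rewrite (perm_catCA [:: b] [:: a]).
have [r hr] := IH i j hi hj ij; exists (x :: r) => a b.
have := hr a b; rewrite -(perm_cons x) => h; apply: perm_trans h _.
by rewrite (perm_catCA [:: x] [:: a; b]).
Qed.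

(* Moves k units from the entry at position j to the entry at position i. *)
Definition spread s i j k :=
  set_nth 0%N (set_nth 0%N s i (nth 0 s i + k)%N) j (nth 0 s j - k)%N.

Lemma set_nth_nth (s : seq nat) i : (i < size s)%N -> set_nth 0%N s i (nth 0%N s i) = s.
Proof. by elim: s i => // x s IH [|i] //= hi; rewrite IH. Qed.

Lemma spread_perm s i j : (i < size s)%N -> (j < size s)%N -> i != j ->
  exists2 r, perm_eq s [:: nth 0%N s i, nth 0%N s j & r] &
   forall k, perm_eq (spread s i j k) [:: (nth 0%N s i + k)%N, (nth 0%N s j - k)%N & r].
Proof.
move=> hi hj ij; have [r hr] := set_nth2_perm hi hj ij; exists r; last by move=> k; apply: hr.
by have := hr (nth 0 s i)%N (nth 0 s j)%N; rewrite (set_nth_nth hi) (set_nth_nth hj).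
Qed.

(** By concavity of x -> min(x, y), the terms pairing the two entries u >= v with the others cannot
    grow when u and v move apart, while the cross term 2 min(u, v) = 2v drops by 2k. *)
Lemma minsum_spread s i j k : (i < size s)%N -> (j < size s)%N -> i != j ->
  (nth 0 s j <= nth 0 s i)%N -> (0 < k <= nth 0 s j)%N ->
  (minsum (spread s i j k) < minsum s)%N.
Proof.
move=> hi hj ij; have [r hs hr] := spread_perm hi hj ij.
rewrite (minsum_perm hs) (minsum_perm (hr k)).
move: (nth _ _ _) (nth _ _ _) => u v vu hk.
rewrite !minsum_cons !big_cons.
have : (\sum_(y <- r) minn (u + k) y + \sum_(y <- r) minn (v - k) y <=
        \sum_(y <- r) minn u y + \sum_(y <- r) minn v y)%N.
  by rewrite -!big_split; apply: leq_sum => y _ /=; lia.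
lia.
Qed.

Lemma sumn_spread s i j k : (i < size s)%N -> (j < size s)%N -> i != j ->
  (k <= nth 0 s j)%N -> sumn (spread s i j k) = sumn s.
Proof.
move=> hi hj ij hk; have [r hs hr] := spread_perm hi hj ij.
rewrite (perm_sumn hs) (perm_sumn (hr k)) /=; lia.
Qed.

Lemma size_spread s i j k : (i < size s)%N -> (j < size s)%N ->
  size (spread s i j k) = size s.
Proof. by move=> hi hj; rewrite !size_set_nth; lia. Qed.

(** * The Laplace--Beltrami operator on monomial coefficients *)

(** Linear independence of 1 and [a] over the integers. It entails characteristic zero, and it
    suffices because eigenvalues and hook factors are integer combinations of 1 and [a]. *)
Definition generic (K : fieldType) (a : K) : Prop :=
  forall x y : int, x%:~R + y%:~R * a = 0 -> x = 0 /\ y = 0.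

Lemma generic_char0 (K : fieldType) (a : K) : generic a -> forall n, n.+1%:R != 0 :> K.
Proof.
move=> ga n; apply/eqP => h; have [] := ga n.+1%:Z 0; last by [].
by rewrite mul0r addr0 -[n.+1%:Z%:~R]/(n.+1%:R).
Qed.

Section LaplaceBeltrami.
Variables (K : fieldType) (a : K).
Hypothesis ga : generic a.
Implicit Types (h : seq nat -> K) (s t : seq nat).

(* For s a partition, minsum s = 2 n(s) + |s| with n(s) = \sum_i i s_i, so this is twice the
   Laplace--Beltrami eigenvalue a n(s') - n(s). *)
Definition e2 s : K :=
  a * (\sum_(x <- s) x ^ 2)%N%:R - (minsum s)%:R - (a - 1) * (sumn s)%:R.

(** These are the off-diagonal terms of the divided difference of x_i^2 d/dx_i - x_j^2 d/dx_j by x_i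
    - x_j. The truncated subtraction is faithful only for s_j <= s_i, which [pairterm]
    guarantees. *)
Definition spr h s i j : K :=
  \sum_(k < nth 0%N s j)
     (nth 0 s i - nth 0 s j + k.+1.*2)%N%:R * h (spread s i j k.+1).

(** The divided difference is symmetric in i and j, so the larger entry may always be the one
    raised; every term then has [minsum] strictly below that of [s]. *)
Definition pairterm h s i j : K :=
  if i == j then 0 else
  if (nth 0 s j <= nth 0 s i)%N then spr h s i j else spr h s j i.

(* If h s is the coefficient of x^s in a symmetric polynomial, then LB h s is the coefficient
   of x^s in its image under twice the Laplace--Beltrami operator. *)
Definition LB h s : K :=
  e2 s * h s + \sum_(i < size s) \sum_(j < size s) pairterm h s i j.

(** With equal sums the last term of [e2] cancels, and genericity separates the coefficient of [a]
    from the integer part. *)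
Lemma e2_minsum s t : sumn s = sumn t -> e2 s = e2 t -> minsum s = minsum t.
Proof.
move=> hst; rewrite /e2 hst; set p := (\sum_(x <- s) _)%N; set q := (\sum_(x <- t) _)%N => h.
have [|] := ga (x := (minsum t)%:Z - (minsum s)%:Z) (y := p%:Z - q%:Z); last lia.
apply/eqP; move/eqP: h; rewrite -!addrA -subr_eq0 !rmorphB /= -!pmulrn.
by apply: etrans; congr (_ == _); ring.
Qed.

Lemma e2_perm s t : perm_eq s t -> e2 s = e2 t.
Proof.
by move=> st; rewrite /e2 (minsum_perm st) (perm_sumn st) (perm_big _ st).
Qed.

Lemma e2_pos s : e2 (pos s) = e2 s.
Proof.
rewrite /e2 minsum_pos sumn_pos; congr (_ * _%:R - _ - _).
by rewrite big_filter big_mkcond /=; apply: eq_bigr => -[].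
Qed.

Lemma pairterm_eq0 h s i j : i != j ->
  (forall k, (nth 0 s j <= nth 0 s i)%N -> (0 < k <= nth 0 s j)%N -> h (spread s i j k) = 0) ->
  (forall k, (nth 0 s i <= nth 0 s j)%N -> (0 < k <= nth 0 s i)%N -> h (spread s j i k) = 0) ->
  pairterm h s i j = 0.
Proof.
move=> /negPf ij h1 h2; rewrite /pairterm ij.
case: leqP => hij; rewrite /spr big1 // => k _.
  by rewrite h1 ?mulr0 //=.
by rewrite h2 ?mulr0 ?(ltnW hij) /=.
Qed.

Lemma LB_diag h s :
  (forall i j k, (i < size s)%N -> (j < size s)%N -> i != j ->
     (nth 0 s j <= nth 0 s i)%N -> (0 < k <= nth 0 s j)%N -> h (spread s i j k) = 0) ->
  LB h s = e2 s * h s.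
Proof.
move=> hz; rewrite /LB big1 ?addr0 // => i _; rewrite big1 // => j _.
have [->|ij] := eqVneq (i : nat) j; first by rewrite /pairterm eqxx.
by apply: pairterm_eq0 => // k; apply: hz; rewrite // eq_sym.
Qed.

Lemma LB_top h s :
  (forall s', size s' = size s -> sumn s' = sumn s ->
     (minsum s' < minsum s)%N -> h s' = 0) ->
  LB h s = e2 s * h s.
Proof.
move=> hz; apply: LB_diag => i j k hi hj ij hij /andP[k0 hk].
by rewrite hz ?size_spread ?sumn_spread ?minsum_spread // k0.
Qed.

Definition eigen N h t := forall s, size s = N -> sumn s = sumn t ->
  LB h s = e2 t * h s.

(* Leading-term argument: an extremal point of the support of h would have the
   eigenvalue e2 t. *)
Lemma eigen_eq0 N h t : eigen N h t ->
  (forall s, size s = N -> sumn s = sumn t -> h s != 0 -> (minsum t < minsum s)%N) ->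
  forall s, size s = N -> sumn s = sumn t -> h s = 0.
Proof.
move=> hE hs s; have [m] := ubnP (minsum s); elim: m s => // m IH s hm sN st.
apply: contraTeq isT => h0; have := hE s sN st; rewrite LB_top; last first.
  by move=> s' s's s'n lt; apply: IH; rewrite ?s's ?s'n //; apply: leq_trans lt _.
move/(mulIf h0)/(e2_minsum st) => e.
by have := hs s sN st h0; rewrite e ltnn.
Qed.

Lemma LB_lin (c d : K) h1 h2 s :
  LB (fun s => c * h1 s + d * h2 s) s = c * LB h1 s + d * LB h2 s.
Proof.
have sprl i j : spr (fun s => c * h1 s + d * h2 s) s i j = c * spr h1 s i j + d * spr h2 s i j.
  rewrite /spr !mulr_sumr -big_split; apply: eq_bigr => k _ /=; ring.
rewrite /LB.
have -> : \sum_(i < size s) \sum_(j < size s) pairterm (fun s => c * h1 s + d * h2 s) s i j =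
  c * (\sum_(i < size s) \sum_(j < size s) pairterm h1 s i j) +
  d * (\sum_(i < size s) \sum_(j < size s) pairterm h2 s i j).
  rewrite !mulr_sumr -big_split; apply: eq_bigr => i _ /=; rewrite !mulr_sumr -big_split.
  apply: eq_bigr => j _ /=; rewrite /pairterm.
  by case: eqP; [rewrite !mulr0 addr0 | case: leqP; rewrite sprl].
ring.
Qed.

Lemma eigen_uniq N h1 h2 t : eigen N h1 t -> eigen N h2 t ->
  (forall s, size s = N -> sumn s = sumn t -> (minsum s <= minsum t)%N -> h1 s = h2 s) ->
  forall s, size s = N -> sumn s = sumn t -> h1 s = h2 s.
Proof.
move=> e1 e2' hl s sN st; apply/eqP; rewrite -subr_eq0; apply/eqP.
have := @eigen_eq0 N (fun s => 1 * h1 s + (-1) * h2 s) t.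
have -> : h1 s - h2 s = 1 * h1 s + -1 * h2 s by ring.
apply=> // {sN st s} s sN st; first by rewrite LB_lin e1 // e2' //; ring.
by apply: contraNltn => le; rewrite hl //; apply/eqP; ring.
Qed.

Lemma minsum_cons_max M s : all (fun x => x <= M)%N s ->
  minsum (M :: s) = (M + (sumn s).*2 + minsum s)%N.
Proof.
move=> hs; rewrite minsum_cons; congr (_ + _.*2 + _)%N; rewrite sumnE.
by apply: eq_big_seq => y /(allP hs) hy; apply/minn_idPr.
Qed.

Lemma minsum_mapS s : minsum (map S s) = (minsum s + size s ^ 2)%N.
Proof.
elim: s => [|x s IH]; first by rewrite /minsum !big_nil.
rewrite /= !minsum_cons IH big_map.
have -> : (\sum_(j <- s) minn x.+1 j.+1 = \sum_(y <- s) minn x y + size s)%N.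
  rewrite -sum1_size -big_split; apply: eq_bigr => y _ /=; lia.
lia.
Qed.

(** A move involving the first row raises an entry that is at least M, and [h] vanishes beyond M;
    only moves among the other rows remain. The eigenvalue shift depends on M and on the sum alone.
    If [s] itself has an entry above M, every move keeps one and both sides are zero. *)
Lemma eigen_row N h t M : eigen N.+1 h (M :: t) -> all (fun x => x <= M)%N t ->
  (forall s, size s = N.+1 -> has (fun x => M < x)%N s -> h s = 0) ->
  eigen N (fun s => h (M :: s)) t.
Proof.
move=> hE tM hM s sN st.
case hs: (has (fun x => M < x)%N s).
  have h0 : h (M :: s) = 0 by rewrite hM //= ?sN // hs orbT.
  rewrite h0 mulr0 LB_diag ?h0 ?mulr0 //.
  move=> i j k hi hj ij hij hk; have [r h1 h2] := spread_perm hi hj ij.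
  apply: hM; first by rewrite /= size_spread // sN.
  rewrite -[has _ _]/((M < M)%N || has (fun x => M < x)%N (spread s i j k)); apply/orP; right.
  move: hs; rewrite (perm_has _ h1) (perm_has _ (h2 k)) /= => /or3P[] hh; apply/or3P.
  - by apply: Or31; lia.
  - by apply: Or31; lia.
  by apply: Or33.
have sM : all (fun x => x <= M)%N s.
  by apply/allP => x xs; rewrite leqNgt; apply: contraFN hs => ?; apply/hasP; exists x.
have := hE (M :: s) _ _; rewrite /= sN st => /(_ erefl erefl).
have sp0 i j k : i != j -> (i < (size s).+1)%N -> (j < (size s).+1)%N ->
    (i == 0)%N || (j == 0)%N -> (nth 0 (M :: s) j <= nth 0 (M :: s) i)%N -> (0 < k)%N ->
    h (spread (M :: s) i j k) = 0.
  move=> ij hi hj ij0 hij k0; have [r _ h2] := @spread_perm (M :: s) i j hi hj ij.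
  rewrite hM ?size_spread //= ?sN // (perm_has _ (h2 k)) /=; apply/orP; left.
  by case/orP: ij0 hij => /eqP -> /=; lia.
rewrite {1}/LB /= big_ord_recl big1 ?add0r; last first.
  move=> j _; have [<-|ij] := eqVneq 0%N j; first by rewrite /pairterm eqxx.
  apply: pairterm_eq0 => // k hle /andP[k0 _]; apply: sp0 => //; try by rewrite eq_sym.
  by rewrite orbT.
under eq_bigr => i _.
  rewrite big_ord_recl; have -> : pairterm h (M :: s) (lift ord0 i) (ord0 : 'I_(size s).+1) = 0.
    by apply: pairterm_eq0 => // k hle /andP[k0 _]; apply: sp0 => //=; exact: (ltn_ord i).
  rewrite add0r; under eq_bigr => j _ do
    rewrite (_ : pairterm h _ _ _ = pairterm (fun s => h (M :: s)) s i j) //.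
  over.
have he : e2 (M :: s) - e2 s = e2 (M :: t) - e2 t.
  by rewrite /e2 !big_cons !minsum_cons_max //= st !natrD; ring.
rewrite /LB; move: he; set S := \sum_(i < _) _ => he e.
have -> : S = (e2 (M :: t) - e2 (M :: s)) * h (M :: s) by rewrite mulrBl -e; ring.
have -> : e2 (M :: t) = e2 (M :: s) - e2 s + e2 t by rewrite he; ring.
ring.
Qed.

Lemma map_spreadS s i j k : (i < size s)%N -> (j < size s)%N -> i != j ->
  (k <= nth 0 s j)%N -> spread (map S s) i j k = map S (spread s i j k).
Proof.
move=> hi hj ij hk; apply: (@eq_from_nth _ 0%N).
  by rewrite size_map !size_spread ?size_map.
move=> u; rewrite size_spread ?size_map // => hu.
rewrite (nth_map 0%N) ?size_spread // /spread !nth_set_nth /= !nth_set_nth /=.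
rewrite !(nth_map 0%N) //.
by case: eqP => _; [lia | case: eqP].
Qed.

Lemma e2_mapS s : e2 (map S s) - e2 s =
  a * ((sumn s).*2 + size s)%:R - (size s ^ 2)%N%:R - (a - 1) * (size s)%:R.
Proof.
rewrite /e2 minsum_mapS.
have -> : sumn (map S s) = (sumn s + size s)%N by elim: s => //= x s ->; lia.
have -> : (\sum_(x <- map S s) x ^ 2 = \sum_(x <- s) x ^ 2 + (sumn s).*2 + size s)%N.
  elim: s => [|x s IH]; first by rewrite !big_nil.
  rewrite /= !big_cons IH; lia.
rewrite !natrD; ring.
Qed.

(** Moves commute with adding 1 to every entry, and by [e2_mapS] the eigenvalue shift depends only
    on the sum and the number of entries. *)
Lemma eigen_col N h t : size t = N -> eigen N h (map S t) ->
  (forall s, size s = N -> 0%N \in s -> h s = 0) ->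
  eigen N (fun s => h (map S s)) t.
Proof.
move=> tN hE h0 s sN st.
have := hE (map S s) _ _; rewrite size_map => /(_ sN).
have sS r : sumn (map S r) = (sumn r + size r)%N by elim: r => //= x r ->; lia.
rewrite !sS st sN tN => /(_ erefl).
have he : e2 (map S s) - e2 s = e2 (map S t) - e2 t by rewrite !e2_mapS st sN tN.
rewrite /LB size_map.
under eq_bigr => i _.
  under eq_bigr => j _.
    rewrite (_ : pairterm _ _ _ _ = pairterm (fun s => h (map S s)) s i j).
    over.
    have sp u v : (u < size s)%N -> (v < size s)%N -> u != v ->
        spr h (map S s) u v = spr (fun s => h (map S s)) s u v.
      (* Entry [v] is one larger than in [s], so there is one more move; it empties that entry, and
         [h] vanishes there. *)
      move=> hu hv uv; rewrite /spr (nth_map 0%N) // big_ord_recr /= [X in _ + _ * X]h0; first last.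
      - apply/(nthP 0%N); exists v; rewrite ?size_spread ?size_map //.
        by rewrite /spread nth_set_nth /= eqxx (nth_map 0%N) // subnn.
      - by rewrite size_spread ?size_map.
      rewrite mulr0 addr0; apply: eq_bigr => k _.
      by rewrite map_spreadS // (nth_map 0%N).
    rewrite /pairterm !(nth_map 0%N) ?ltn_ord // ltnS; case: eqP => // /eqP ij.
    by case: leqP => _; rewrite sp // eq_sym.
  over.
move: he; set S := \sum_(i < _) _ => he e.
have -> : S = (e2 (map succn t) - e2 (map succn s)) * h (map succn s) by rewrite mulrBl -e; ring.
have -> : e2 (map succn t) = e2 (map succn s) - e2 s + e2 t by rewrite he; ring.
ring.
Qed.
End LaplaceBeltrami.

(** * Hook products and content products *)

Lemma sumn_incr t i : sumn (incr_nth t i) = (sumn t).+1.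
Proof.
elim: t i => [|x t IH] [|i] //=; last by rewrite IH addnS.
by rewrite -/(ncons i 0%N [:: 1%N]); elim: i.
Qed.

Section Hooks.
Variables (K : fieldType) (a : K).
Hypothesis ga : generic a.
Implicit Types (X : K) (s t : seq nat).

(* The product over the boxes of t of X + a a'(box) - l'(box), with a' and l' the co-arm and
   co-leg lengths. *)
Fixpoint cprod X t : K :=
  if t is x :: t' then (\prod_(j < x) (X + a * j%:R)) * cprod (X - 1) t' else 1.

Fixpoint hookp t : K :=
  if t is x :: t' then
    (\prod_(j < x) (a * (x - j.+1)%N%:R + (count (fun y => j < y)%N t')%:R + 1)) * hookp t'
  else 1.

Definition hookrow' x t : K :=
  \prod_(j < x) (a * (1 + (x - j.+1)%N%:R) + (count (fun y => j < y)%N t)%:R).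

Fixpoint hookp' t : K := if t is x :: t' then hookrow' x t' * hookp' t' else 1.

(* The factors of the boxes of the first column in hookp. *)
Fixpoint hookcol t : K :=
  if t is x :: t' then (a * x.-1%:R + (size t').+1%:R) * hookcol t' else 1.

Lemma lin_neq0 (x y : int) : (x != 0) || (y != 0) -> x%:~R + a * y%:~R != 0.
Proof. by apply: contraTneq; rewrite mulrC => /ga[-> ->]. Qed.

Lemma hookp_neq0 t : hookp t != 0.
Proof.
elim: t => [|x t IH] /=; first exact: oner_neq0.
rewrite mulf_neq0 // prodf_seq_neq0; apply/allP => j _ /=.
set c := count _ _; rewrite -addrA natr1 addrC.
by apply: (@lin_neq0 c.+1%:Z (x - j.+1)%N%:Z).
Qed.

Lemma hookrow'_neq0 x t : hookrow' x t != 0.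
Proof.
rewrite prodf_seq_neq0; apply/allP => j _ /=.
set c := count _ _; rewrite nat1r addrC.
by apply: (@lin_neq0 c%:Z (x - j.+1).+1%:Z); rewrite orbT.
Qed.

Lemma hookp'_neq0 t : hookp' t != 0.
Proof. by elim: t => [|x t IH] /=; rewrite ?oner_neq0 // mulf_neq0 ?hookrow'_neq0. Qed.

(** Co-legs stay below N, so each factor has a positive integer part. *)
Lemma cprod_size_neq0 N t : (size t <= N)%N -> cprod N%:R t != 0.
Proof.
elim: t N => [|x t IH] [|N] //= hN; rewrite ?oner_neq0 // mulf_neq0 //.
  rewrite prodf_seq_neq0; apply/allP => j _ /=.
  exact: (@lin_neq0 N.+1%:Z j%:Z).
by rewrite -natr1 addrK IH.
Qed.

(** Co-arms stay below M, so each factor has a negative coefficient of [a]. The shift [i] serves the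
    induction over rows. *)
Lemma cprod_width_neq0 M i t : all (fun x => x <= M)%N t -> cprod (- (a * M%:R) - i%:R) t != 0.
Proof.
elim: t i => [|x t IH] i /=; first by rewrite oner_neq0.
case/andP=> xM hM; rewrite mulf_neq0 //.
  rewrite prodf_seq_neq0; apply/allP => j _ /=.
  have -> : - (a * M%:R) - i%:R + a * j%:R = (- i%:Z)%:~R + a * (j%:Z - M%:Z)%:~R.
    by rewrite rmorphB rmorphN /= -!pmulrn; ring.
  by apply: lin_neq0; have := ltn_ord j; lia.
have -> : - (a * M%:R) - i%:R - 1 = - (a * M%:R) - i.+1%:R by rewrite -natr1; ring.
exact: IH.
Qed.

(** The box of co-arm M in the first row kills the product; this discards partitions wider than M in
    the computation of the norms. *)
Lemma cprod_width_eq0 M x t : (M < x)%N -> cprod (- (a * M%:R)) (x :: t) = 0.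
Proof.
by move=> Mx; rewrite /= (bigD1 (Ordinal Mx)) //= addNr !mul0r.
Qed.

Lemma cprod_incr X t i : cprod X (incr_nth t i) = (X + a * (nth 0 t i)%:R - i%:R) * cprod X t.
Proof.
elim: t i X => [|x t IH] [|i] X /=.
- by rewrite big_ord_recl big_ord0 /=; ring.
- rewrite big_ord0 mul1r mulr0 addr0 mulr1 -/(ncons i 0%N [:: 1%N]).
  elim: i X => [|i IHi] X /=; rewrite ?big_ord_recl big_ord0 /=; first by ring.
  by rewrite mul1r IHi -[i.+2%:R]natr1; ring.
- by rewrite big_ord_recr /=; ring.
by rewrite IH -natr1; ring.
Qed.

Lemma minsum_incr t i : sorted geq t -> sorted geq (incr_nth t i) ->
  minsum (incr_nth t i) = (minsum t + i.*2.+1)%N.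
Proof.
elim: t i => [|x t IH] [|i].
- by move=> _ _; rewrite [incr_nth _ _]/= minsum_cons /minsum !big_nil.
- by move=> _; rewrite /= -/(ncons i 0%N [:: 1%N]) => h; exfalso; elim: i h => //= i IHi /IHi.
- rewrite /= !path_sortedE; try exact: geq_trans.
  move=> /andP[h1 _] /andP[h2 _]; rewrite (minsum_cons_max h1) (minsum_cons_max h2); lia.
rewrite [incr_nth _ _]/= !sorted_geqE => /andP[h1 h2] /andP[h3 h4].
rewrite (minsum_cons_max h1) (minsum_cons_max h3) (IH _ h2 h4) sumn_incr; lia.
Qed.

Lemma sqsum_incr t i : (\sum_(x <- incr_nth t i) x ^ 2 =
  \sum_(x <- t) x ^ 2 + (nth 0 t i).*2.+1)%N.
Proof.
elim: t i => [|x t IH] [|i] /=; rewrite ?big_cons ?big_nil //.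
- rewrite -/(ncons i 0%N [:: 1%N]); elim: i => [|i IHi] /=; rewrite !big_cons ?big_nil //.
- lia.
rewrite IH; lia.
Qed.

(** The increment is twice the content of the new box, the same content that enters the new factor
    in [cprod_incr]; on this coincidence the evaluation formula rests. *)
Lemma e2_incr t i : sorted geq t -> sorted geq (incr_nth t i) ->
  e2 a (incr_nth t i) = e2 a t + (a * (nth 0%N t i)%:R - i%:R) *+ 2.
Proof.
move=> h1 h2; rewrite /e2 (minsum_incr h1 h2) sqsum_incr sumn_incr.
move: (\sum_(x <- t) _)%N (minsum t) (sumn t) (nth 0 t i)%N => p q w x.
rewrite -[x.*2.+1]addn1 -[i.*2.+1]addn1 -[w.+1]addn1 -!muln2 !natrD !natrM; ring.
Qed.

(** Sort the boxes by columns: if c entries of [t] exceed j, column j of [M :: t] has co-legs 0,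
    ..., c, and [t] accounts for 0, ..., c - 1. The bottom box of each column is left over. *)
Lemma cprod_row X M t : sorted geq (M :: t) ->
  (\prod_(j < M) (X + a * j%:R)) * cprod (X - 1) t =
  cprod X t * \prod_(j < M) (X + a * j%:R - (count (fun y => j < y)%N t)%:R).
Proof.
elim: t X M => [|x t IH] X M.
  by move=> _ /=; rewrite mul1r mulr1; apply: eq_bigr => j _; rewrite subr0.
rewrite sorted_geqE => /andP[/= /andP[xM _] hxt].
have := IH (X - 1) x hxt => {}IH; rewrite IH.
have -> : \prod_(j < M) (X + a * j%:R - ((j < x)%N + count (fun y => j < y)%N t)%:R) =
   (\prod_(j < x) (X - 1 + a * j%:R - (count (fun y => j < y)%N t)%:R)) *
   \prod_(x <= j < M) (X + a * j%:R).
  rewrite -(big_mkord xpredT (fun j => X + a * j%:R - ((j < x)%N + count (fun y => j < y)%N t)%:R)).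
  rewrite (big_cat_nat (n := x)) //=; congr (_ * _).
    by rewrite big_mkord; apply: eq_bigr => j _; rewrite ltn_ord natrD /=; ring.
  apply: eq_big_nat => j /andP[hj _]; rewrite ltnNge hj /=.
  rewrite (_ : count _ _ = 0%N) ?subr0 //; apply/eqP; rewrite -leqn0 leqNgt -has_count.
  apply/hasPn => y yt; rewrite -leqNgt.
  have : all (fun y => y <= x)%N t && sorted geq t by rewrite -sorted_geqE.
  by case/andP=> /allP/(_ y yt) hy _; apply: leq_trans hj.
rewrite -(big_mkord xpredT (fun j => X + a * j%:R)) (big_cat_nat (n := x)) //= big_mkord.
ring.
Qed.

(** At X = - a M, the factor of the bottom box of column j is minus the h'-factor of the box of the
    first row in that column. *)
Lemma cprod_width_cons M t : sorted geq (M :: t) ->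
  cprod (- (a * M%:R)) (M :: t) = (-1) ^+ M * hookrow' M t * cprod (- (a * M%:R)) t.
Proof.
move=> h; rewrite /= cprod_row // mulrC; congr (_ * _).
have -> : (-1) ^+ M = \prod_(j < M) (-1 : K) by rewrite prodr_const card_ord.
rewrite -big_split; apply: eq_bigr => j _ /=.
have -> : M%:R = (j : nat)%:R + 1 + (M - j.+1)%N%:R :> K by rewrite natr1 -natrD subnKC.
ring.
Qed.

Lemma hookp_col t : all (fun x => 0 < x)%N t ->
  hookp t = hookp (map predn t) * hookcol t.
Proof.
elim: t => [|x t IH] /=; first by rewrite mulr1.
case/andP => x0 ht; rewrite IH //; case: x x0 => // x _ /=.
rewrite big_ord_recl /= subn1 /=.
have -> : count (fun y => 0 < y)%N t = size t by apply/eqP; rewrite -all_count.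
rewrite -addrA natr1.
have -> : \prod_(j < x) (a * (x - j.+1)%N%:R + (count (fun y => j < y)%N (map predn t))%:R + 1) =
   \prod_(j < x) (a * (x.+1 - j.+2)%N%:R + (count (fun y => j.+1 < y)%N t)%:R + 1) :> K.
  apply: eq_bigr => j _; rewrite subSS count_map; congr (_ + _%:R + _).
  by apply: eq_count => -[].
ring.
Qed.

(** At X = [size t], the factor of the last box of a row equals the h-factor of the first box of
    that row: same arm a (x - 1), and the integer part counts the rows from there down. *)
Lemma cprod_col t : all (fun x => 0 < x)%N t ->
  cprod (size t)%:R t = cprod (size t)%:R (map predn t) * hookcol t.
Proof.
elim: t => [|x t IH] /=; first by rewrite mulr1.
case/andP => x0 ht; rewrite -[(size t).+1%:R]natr1 !addrK IH //; case: x x0 => // x _ /=.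
rewrite big_ord_recr /=; ring.
Qed.

Lemma hookp_pos s : hookp (pos s) = hookp s.
Proof.
elim: s => //= x s IH; case: ltnP => x0 /=; rewrite IH.
  congr (_ * _); apply: eq_bigr => j _; rewrite count_filter.
  by congr (_ + _%:R + _); apply: eq_count => y /=; case: (ltnP j y) => //= h; rewrite (leq_ltn_trans _ h).
by move: x0; rewrite leqn0 => /eqP->; rewrite big_ord0 mul1r.
Qed.

(** Sortedness matters here: a zero before a positive entry would shift the co-legs of the rows
    below it. *)
Lemma cprod_pos X s : sorted geq s -> cprod X (pos s) = cprod X s.
Proof.
elim: s X => // x s IH X; rewrite sorted_geqE => /andP[h1 h2] /=.
case: ltnP => x0 /=; first by rewrite IH.
move: x0; rewrite leqn0 => /eqP x0; rewrite x0 big_ord0 mul1r IH //.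
have z Y : cprod Y s = 1; last by rewrite !z.
rewrite x0 in h1; elim: s Y h1 {IH h2} => //= y s IH Y; rewrite leqn0 => /andP[/eqP-> h].
by rewrite big_ord0 mul1r IH.
Qed.

End Hooks.

(** * The Laplace--Beltrami operator in power sums *)

Section Coeff.
Variables (K : fieldType) (N : nat).
Implicit Types (h q : {mpoly K[N]}) (m : 'X_{1..N}) (i j : 'I_N).

Lemma mcoeff_XM i h m : ('X_i * h)@_m = if (0 < m i)%N then h@_(m - U_(i)) else 0.
Proof.
case: posnP => [m0|m0].
  apply/eqP; rewrite mcoeff_eq0; apply/negP => /msuppM_le/allpairsP[[u v] /= [+ _ hm]].
  by rewrite msuppX inE => /eqP hu; move: m0; rewrite hm hu mnmDE mnm1E eqxx.
have hm : (U_(i) <= m)%MM by rewrite lep1mP -lt0n.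
have e : m = (U_(i) + (m - U_(i)))%MM by rewrite addmC submK.
by rewrite [in LHS]e mulrC mcoeffMX.
Qed.

Lemma mcoeff_XMD i h m : ('X_i * h)@_(m + U_(i)) = h@_m.
Proof. by rewrite mulrC addmC mcoeffMX. Qed.

Lemma mcoeff_Xderiv i h m : ('X_i * h^`M(i))@_m = (m i)%:R * h@_m.
Proof.
rewrite mcoeff_XM; case: posnP => [->|mi]; first by rewrite mul0r.
rewrite mcoeff_deriv submK ?lep1mP -?lt0n // mulr_natl; congr (_ *+ _).
by rewrite mnmBE mnm1E eqxx subn1 prednK.
Qed.

Definition shift m i j k : 'X_{1..N} := (m + U_(i) *+ k - U_(j) *+ k)%MM.

Lemma shiftE m i j k u : i != j ->
  shift m i j k u = if u == i then (m i + k)%N else if u == j then (m j - k)%N else m u.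
Proof.
move=> ij; rewrite /shift mnmBE mnmDE !mulmnE !mnm1E.
rewrite ![_ == u]eq_sym; case: (u =P i) => [->|_]; first by rewrite (negPf ij); lia.
case: (u =P j) => [->|_]; lia.
Qed.

(** Comparing coefficients at m + e_i gives q at m in terms of q at m + e_i - e_j; the recursion
    ends when the exponent of x_j reaches 0. *)
Lemma mcoeff_divdiff h q i j m : i != j ->
  ('X_i - 'X_j) * q = 'X_i * ('X_i * h^`M(i)) - 'X_j * ('X_j * h^`M(j)) ->
  q@_m = (m i)%:R * h@_m +
    \sum_(k < m j) ((m i)%:R - (m j)%:R + (k.+1.*2)%:R) * h@_(shift m i j k.+1).
Proof.
move=> ij e; have [v] := ubnP (m j); elim: v m => // v IH m hv.
have := congr1 (mcoeff (m + U_(i))) e.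
rewrite mulrBl !mcoeffB !mcoeff_XMD mcoeff_Xderiv (mcoeff_XM j q) (mcoeff_XM j ('X_j * _)).
rewrite mnmDE mnm1E (negPf ij) addn0.
case: (posnP (m j)) => [->|mj]; first by rewrite big_ord0 !subr0 addr0.
have -> : (m + U_(i) - U_(j))%MM = shift m i j 1 by rewrite /shift !mulm1n.
rewrite mcoeff_Xderiv !shiftE // eqxx [j == i]eq_sym (negPf ij) => /(canRL (subrK _)) ->.
rewrite IH; last by rewrite shiftE // eqxx [j == i]eq_sym (negPf ij); lia.
rewrite !shiftE // !eqxx [j == i]eq_sym (negPf ij).
have recl (G : nat -> K) w : (0 < w)%N -> \sum_(k < w) G k = G 0%N + \sum_(k < w - 1) G k.+1.
  by case: w => // w _; rewrite big_ord_recl subn1.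
pose G k : K := ((m i)%:R - (m j)%:R + (k.+1.*2)%:R) * h@_(shift m i j k.+1).
rewrite (_ : \sum_(k < m j) _ = G 0%N + \sum_(k < m j - 1) G k.+1); last exact: recl.
rewrite /G.
have -> : \sum_(k < m j - 1) ((m i + 1)%:R - (m j - 1)%N%:R + (k.+1.*2)%:R) *
            h@_(shift (shift m i j 1) i j k.+1) =
          \sum_(k < m j - 1) ((m i)%:R - (m j)%:R + (k.+2.*2)%:R) *
            h@_(shift m i j k.+2) :> K.
  apply: eq_bigr => k _; congr (_ * h@_ _).
    by rewrite natrB // natrD [in RHS]doubleS -[(_.*2).+2]addn2 natrD; ring.
  by apply/mnmP => u; rewrite !shiftE // !eqxx [j == i]eq_sym (negPf ij);
    case: (u =P i) => _; [lia | case: (u =P j) => _; lia].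
rewrite natrB // natrD -[(1.*2)%N]/2%N; move: (\sum_(k < _) _) => S; ring.
Qed.

End Coeff.

(** * Power sums as independent variables: scalar product and operator *)

Section PowerSumRing.
Variables (K : fieldType) (n' : nat).
Local Notation n := n'.+1.
Local Notation R := {mpoly K[n]}.
Implicit Types (f g : R) (i j : 'I_n) (k d : nat).

(* 'X_i stands for the power sum p_(i+1); pp k is p_k and dd k the derivation with respect to
   p_k, both 0 for k outside 1, ..., n. *)
Definition pp k : R := \sum_(i < n | i.+1 == k) 'X_i.
Definition dd k f : R := \sum_(i < n | i.+1 == k) f^`M(i).

Lemma pp_ord i : pp i.+1 = 'X_i.
Proof. by rewrite /pp (eq_bigl (pred1 i)) ?big_pred1_eq // => j; rewrite eqSS. Qed.

Lemma dd_ord i f : dd i.+1 f = f^`M(i).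
Proof. by rewrite /dd (eq_bigl (pred1 i)) ?big_pred1_eq // => j; rewrite eqSS. Qed.

Lemma pp_out k : (n < k)%N -> pp k = 0.
Proof. by move=> nk; rewrite /pp big_pred0 // => i; have := ltn_ord i; lia. Qed.

Lemma dd_out k f : (n < k)%N -> dd k f = 0.
Proof. by move=> nk; rewrite /dd big_pred0 // => i; have := ltn_ord i; lia. Qed.

Lemma dd_is_linear k : linear (dd k).
Proof.
move=> c f g; rewrite /dd scaler_sumr -big_split; apply: eq_bigr => i _.
by rewrite linearP.
Qed.
HB.instance Definition _ k := GRing.isLinear.Build K R R _ (dd k) (dd_is_linear k).

Lemma mpoly_ind_alg (P : R -> Prop) :
  (forall c, P c%:MP) -> (forall i, P 'X_i) ->
  (forall f g, P f -> P g -> P (f + g)) -> (forall f g, P f -> P g -> P (f * g)) ->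
  forall f, P f.
Proof.
move=> hC hX hD hM f; elim/mpolyind: f => [|c m p _ _ hp]; first by rewrite -mpolyC0.
apply: hD hp; rewrite -mul_mpolyC; apply: (hM) => //; rewrite mpolyXE_id.
apply: big_ind => [|//|i _]; rewrite -?mpolyC1 //.
by elim: (m i) => [|k IH]; rewrite ?expr0 ?exprS -?mpolyC1 //; apply: hM.
Qed.

Definition hom d f := forall m, f@_m != 0 -> mnmwgt m = d.

Lemma hom0 d : hom d 0.
Proof. by move=> m; rewrite mcoeff0 eqxx. Qed.

Lemma homD d f g : hom d f -> hom d g -> hom d (f + g).
Proof.
move=> hf hg m; rewrite mcoeffD; have [->|/hf //] := eqVneq f@_m 0.
by rewrite add0r => /hg.
Qed.

Lemma homZ d c f : hom d f -> hom d (c *: f).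
Proof. by move=> hf m; rewrite mcoeffZ mulf_eq0 negb_or => /andP[_ /hf]. Qed.

Lemma hom_sum d (I : Type) (r : seq I) (P : pred I) (F : I -> R) :
  (forall x, P x -> hom d (F x)) -> hom d (\sum_(x <- r | P x) F x).
Proof. by move=> hF; apply: big_ind => //; [apply: hom0 | apply: homD]. Qed.

Lemma homM d e f g : hom d f -> hom e g -> hom (d + e) (f * g).
Proof.
move=> hf hg m; rewrite -mcoeff_msupp => /msuppM_le/allpairsP[[u v] /=].
by rewrite !mcoeff_msupp => -[/hf <- /hg <- ->]; rewrite mnmwgtD.
Qed.

Lemma homXm m : hom (mnmwgt m) 'X_[m].
Proof. by move=> k; rewrite mcoeffX; case: (m =P k) => [->|_] //; rewrite eqxx. Qed.

Lemma homX i : hom i.+1 'X_i.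
Proof. by rewrite -mnmwgt1; apply: homXm. Qed.

Lemma homMX d i f : hom d f -> hom (i.+1 + d) ('X_i * f).
Proof. by apply: homM; apply: homX. Qed.

Lemma hom_deriv d i f : hom d f -> hom (d - i.+1) f^`M(i).
Proof.
move=> hf m; rewrite mcoeff_deriv => h.
have /hf <- : f@_(m + U_(i)) != 0 by apply: contraNneq h => ->; rewrite mul0rn.
by rewrite mnmwgtD mnmwgt1 addnK.
Qed.

Arguments hom_deriv [d] i [f].

Lemma hom_deriv0 d i f : hom d f -> (d < i.+1)%N -> f^`M(i) = 0.
Proof.
move=> hf hd; apply/mpolyP => m; rewrite mcoeff0 mcoeff_deriv.
have [->|/hf] := eqVneq f@_(m + U_(i)) 0; first by rewrite mul0rn.
rewrite mnmwgtD mnmwgt1; lia.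
Qed.

Arguments homMX [d] i [f].

Lemma euler d f : hom d f -> \sum_(i < n) i.+1%:R *: ('X_i * f^`M(i)) = d%:R *: f.
Proof.
move=> hf; apply/mpolyP => m; rewrite raddf_sum mcoeffZ /=.
under eq_bigr => i _ do rewrite mcoeffZ mcoeff_Xderiv.
have [->|/hf <-] := eqVneq f@_m 0.
  by rewrite mulr0 big1 // => i _; rewrite !mulr0.
rewrite /mnmwgt natr_sum mulr_suml; apply: eq_bigr => i _.
by rewrite natrM; ring.
Qed.

Section Form.
Variable a : K.

Definition zz (m : 'X_{1..n}) : K := \prod_(i < n) ((i.+1%:R * a) ^+ m i * ((m i)`!)%:R).

Definition form f g : K := \sum_(m <- msupp f) f@_m * g@_m * zz m.

Lemma formwE d f g : (msize f <= d)%N ->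
  form f g = \sum_(m : 'X_{1..n < d}) f@_m * g@_m * zz m.
Proof.
move=> le_fd; pose I : subFinType _ := 'X_{1..n < d}.
rewrite /form (big_mksub I) /=; first last.
- by move=> x /msize_mdeg_lt/leq_trans/(_ le_fd).
- by rewrite msupp_uniq.
by rewrite big_rmcond //= => j /memN_msupp_eq0 ->; rewrite !mul0r.
Qed.

Lemma formC f g : form f g = form g f.
Proof.
rewrite (@formwE (maxn (msize f) (msize g))) ?leq_maxl //.
rewrite (@formwE (maxn (msize f) (msize g))) ?leq_maxr //.
by apply: eq_bigr => m _; rewrite [X in X * _]mulrC.
Qed.

Lemma form_is_linear f : scalar (form f).
Proof.
move=> c g h; rewrite /form mulr_sumr -big_split; apply: eq_bigr => m _ /=.
by rewrite mcoeffD mcoeffZ; ring.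
Qed.

HB.instance Definition _ f := GRing.isLinear.Build K R K _ (form f) (form_is_linear f).

Lemma formZr c f g : form f (c *: g) = c * form f g.
Proof. exact: linearZ. Qed.
Lemma formZl c f g : form (c *: f) g = c * form f g.
Proof. by rewrite formC formZr formC. Qed.
Lemma formDr f g h : form f (g + h) = form f g + form f h.
Proof. exact: linearD. Qed.
Lemma formDl f g h : form (f + g) h = form f h + form g h.
Proof. by rewrite formC formDr formC [form h g]formC. Qed.
Lemma form_sumr f (I : Type) (r : seq I) (P : pred I) (F : I -> R) :
  form f (\sum_(x <- r | P x) F x) = \sum_(x <- r | P x) form f (F x).
Proof. exact: linear_sum. Qed.
Lemma form_suml f (I : Type) (r : seq I) (P : pred I) (F : I -> R) :
  form (\sum_(x <- r | P x) F x) f = \sum_(x <- r | P x) form (F x) f.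
Proof. by rewrite formC form_sumr; apply: eq_bigr => x _; rewrite formC. Qed.

Lemma form_Xm m g : form 'X_[m] g = g@_m * zz m.
Proof. by rewrite /form msuppX big_seq1 mcoeffX eqxx mul1r. Qed.

Lemma zzS m i : zz (U_(i) + m) = i.+1%:R * a * (m i).+1%:R * zz m.
Proof.
rewrite /zz (bigD1 i) //= [in RHS](bigD1 i) //=.
rewrite (eq_bigr (fun j : 'I_n => ((j.+1%:R * a) ^+ m j * ((m j)`!)%:R))).
  rewrite mnmDE mnm1E eqxx add1n exprS factS natrM; ring.
by move=> j; rewrite eq_sym mnmDE mnm1E => /negPf->.
Qed.

Lemma form_XMl i f g : form ('X_i * f) g = i.+1%:R * a * form f g^`M(i).
Proof.
elim/mpolyind: f => [|c m p _ _ IH]; first by rewrite mulr0 /form msupp0 !big_nil mulr0.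
rewrite mulrDr !formDl IH mulrDr; congr (_ + _).
rewrite -scalerAr -mpolyXD !formZl !form_Xm mcoeff_deriv zzS addmC -mulr_natr; ring.
Qed.

Lemma form_ppMl k f g : form (pp k * f) g = k%:R * a * form f (dd k g).
Proof.
rewrite /pp /dd mulr_suml form_suml form_sumr mulr_sumr; apply: eq_bigr => i /eqP <-.
exact: form_XMl.
Qed.

(** Ordered pairs of parts are counted, hence the doubling. [pp] and [dd] vanish at indices above n,
    which loses nothing in degree at most n. *)
Definition fuse f : R := \sum_(i < n) \sum_(j < n) (a * (i.+1 * j.+1)%:R) *: (pp (i + j).+2 * f^`M(i)^`M(j)).
Definition cut f : R := \sum_(i < n) \sum_(j < n) ((i + j).+2)%:R *: ('X_i * 'X_j * dd (i + j).+2 f).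
Definition stay f : R := \sum_(i < n) ((a - 1) * (i.+1 * i)%:R) *: ('X_i * f^`M(i)).

(* Twice the Laplace--Beltrami operator in the power sums p_(i+1) = 'X_i. *)
Definition D2 f : R := fuse f + cut f + stay f.

Lemma fuse_is_linear : linear fuse.
Proof.
move=> c f g; rewrite /fuse scaler_sumr -big_split; apply: eq_bigr => i _ /=.
rewrite scaler_sumr -big_split; apply: eq_bigr => j _ /=.
by rewrite !linearP /= mulrDr -scalerAr scalerDr !scalerA [c * _]mulrC.
Qed.
HB.instance Definition _ := GRing.isLinear.Build K R R _ fuse fuse_is_linear.

Lemma cut_is_linear : linear cut.
Proof.
move=> c f g; rewrite /cut scaler_sumr -big_split; apply: eq_bigr => i _ /=.
rewrite scaler_sumr -big_split; apply: eq_bigr => j _ /=.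
by rewrite !linearP /= mulrDr -scalerAr scalerDr !scalerA [c * _]mulrC.
Qed.
HB.instance Definition _ := GRing.isLinear.Build K R R _ cut cut_is_linear.

Lemma stay_is_linear : linear stay.
Proof.
move=> c f g; rewrite /stay scaler_sumr -big_split; apply: eq_bigr => i _ /=.
by rewrite !linearP /= mulrDr -scalerAr scalerDr !scalerA [c * _]mulrC.
Qed.
HB.instance Definition _ := GRing.isLinear.Build K R R _ stay stay_is_linear.

Lemma D2_is_linear : linear D2.
Proof.
move=> c f g; rewrite /D2 !linearP /= (addrACA (c *: fuse f)) (addrACA (_ + _)).
by rewrite !scalerDr.
Qed.
HB.instance Definition _ := GRing.isLinear.Build K R R _ D2 D2_is_linear.

(** Multiplication by p_k is adjoint to k a d/dp_k, so joining two parts is adjoint to cutting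
    one. *)
Lemma form_fuse f g : form (fuse f) g = form f (cut g).
Proof.
rewrite /fuse /cut form_suml form_sumr; apply: eq_bigr => i _.
rewrite form_suml form_sumr; apply: eq_bigr => j _.
rewrite formZl form_ppMl formZr -(mulrA 'X_i) [form f _]formC !form_XMl.
rewrite [form (dd _ _) _]formC natrM; ring.
Qed.

Lemma form_stay f g : form (stay f) g = form f (stay g).
Proof.
rewrite /stay form_suml form_sumr; apply: eq_bigr => i _.
rewrite formZl formZr form_XMl [form f ('X_i * _)]formC form_XMl.
by rewrite [form g^`M(i) _]formC.
Qed.

Lemma D2_selfadj f g : form (D2 f) g = form f (D2 g).
Proof.
rewrite /D2 !formDl !formDr form_fuse form_stay [form (cut f) g]formC -(form_fuse g f).
by rewrite [form (fuse g) f]formC; ring.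
Qed.

Lemma hom_fuse d f : hom d f -> hom d (fuse f).
Proof.
move=> hf; apply: hom_sum => i _; apply: hom_sum => j _; apply: homZ.
have [lt|le] := ltnP n (i + j).+2; first by rewrite pp_out // mul0r; apply: hom0.
have -> : pp (i + j).+2 = 'X_(Ordinal le) by rewrite -pp_ord.
have [le'|lt] := leqP (i + j).+2 d.
  by have := homMX (Ordinal le) (hom_deriv j (hom_deriv i hf)); congr (hom _ _) => /=; lia.
have [lti|lei] := ltnP d i.+1; first by rewrite (hom_deriv0 hf) // linear0 mulr0; apply: hom0.
by rewrite (hom_deriv0 (hom_deriv i hf)) ?mulr0; [apply: hom0 | lia].
Qed.

Lemma hom_cut d f : hom d f -> hom d (cut f).
Proof.
move=> hf; apply: hom_sum => i _; apply: hom_sum => j _; apply: homZ.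
have [lt|le] := ltnP n (i + j).+2; first by rewrite dd_out // mulr0; apply: hom0.
have -> : dd (i + j).+2 f = f^`M(Ordinal le) by rewrite -dd_ord.
have [le'|lt] := leqP (i + j).+2 d; last by rewrite (hom_deriv0 hf) // mulr0; apply: hom0.
rewrite -mulrA.
by have := homMX i (homMX j (hom_deriv (Ordinal le) hf)); congr (hom _ _) => /=; lia.
Qed.

Lemma hom_stay d f : hom d f -> hom d (stay f).
Proof.
move=> hf; apply: hom_sum => i _; apply: homZ.
have [le'|lt] := leqP i.+1 d; last by rewrite (hom_deriv0 hf) // mulr0; apply: hom0.
by have := homMX i (hom_deriv i hf); congr (hom _ _); lia.
Qed.

Lemma hom_D2 d f : hom d f -> hom d (D2 f).
Proof. by move=> hf; apply: homD (hom_stay hf); apply: homD; [apply: hom_fuse | apply: hom_cut]. Qed.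

Definition lower f : R := \sum_(j < n) j.+2%:R *: ('X_j * dd j.+2 f).

Lemma deriv_X i j : ('X_i : R)^`M(j) = (i == j)%:R.
Proof.
rewrite mderivX mnm1E; case: eqP => [->|_]; last by rewrite scale0r.
rewrite scale1r (_ : (_ - _)%MM = 0%MM) ?mpolyX0 //.
by apply/mnmP => k; rewrite mnmBE subnn mnm0E.
Qed.

Lemma deriv_pp k i : (pp k)^`M(i) = (i.+1 == k)%:R.
Proof.
rewrite /pp linear_sum /=; under eq_bigr do rewrite deriv_X.
case: eqP => [<-|ik].
  by rewrite (eq_bigl (pred1 i)) ?big_pred1_eq ?eqxx // => j; rewrite eqSS.
by rewrite big1 // => j /eqP jk; case: eqP => // ji; case: ik; rewrite -ji.
Qed.

Lemma deriv_dd k i f : (dd k f)^`M(i) = dd k f^`M(i).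
Proof. by rewrite /dd linear_sum; apply: eq_bigr => j _; rewrite /= mderiv_comm. Qed.

(** Only [cut] multiplies by p_1 effectively: [fuse] creates indices at least 2, and [stay] has
    coefficient 0 at p_1. The 2 comes from the two factors of a cut. *)
Lemma deriv_D2 f : (D2 f)^`M(ord0) = D2 f^`M(ord0) + lower f *+ 2.
Proof.
have hfuse : (fuse f)^`M(ord0) = fuse f^`M(ord0).
  rewrite /fuse linear_sum; apply: eq_bigr => i _; rewrite /= linear_sum; apply: eq_bigr => j _ /=.
  rewrite linearZ /= mderivM deriv_pp mul0r add0r; congr (_ *: (_ * _)).
  by rewrite [in LHS]mderiv_comm; congr mderiv; rewrite mderiv_comm.
have hstay : (stay f)^`M(ord0) = stay f^`M(ord0).
  rewrite /stay linear_sum; apply: eq_bigr => i _; rewrite /= linearZ /= mderivM deriv_X.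
  case: eqP => [->|_]; first by rewrite muln0 mulr0 !scale0r.
  by rewrite mul0r add0r mderiv_comm.
have hcut : (cut f)^`M(ord0) = cut f^`M(ord0) + lower f *+ 2.
  rewrite /cut linear_sum /=.
  under eq_bigr => i _.
    rewrite linear_sum /=; under eq_bigr => j _.
      rewrite linearZ /= mderivM mderivM !deriv_X deriv_dd mulrDl !scalerDr; over.
    rewrite !big_split /=; over.
  rewrite !big_split /= [LHS]addrC; congr (_ + _); rewrite mulr2n; congr (_ + _).
    rewrite (bigD1 ord0) //= [X in _ + X]big1 ?addr0; last first.
      by move=> i /negPf->; rewrite big1 // => j _; rewrite !mul0r scaler0.
    by apply: eq_bigr => j _; rewrite mul1r add0n.
  apply: eq_bigr => i _; rewrite (bigD1 ord0) //= [X in _ + X]big1 ?addr0; last first.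
    by move=> j /negPf->; rewrite mulr0 mul0r scaler0.
  by rewrite mulr1 addn0.
rewrite /D2 !mderivD hfuse hstay hcut addrA; exact: addrAC.
Qed.

Lemma meval_sum v (I : Type) (r : seq I) (P : pred I) (F : I -> R) :
  (\sum_(x <- r | P x) F x).@[v] = \sum_(x <- r | P x) (F x).@[v].
Proof. exact: raddf_sum. Qed.

(** When all p_k equal X, the shift of index from p_(j+2) to p_(j+1) in [lower] is invisible, and
    Euler's relation results. *)
Lemma eval_euler d f (X : K) : hom d f ->
  meval (fun=> X) (X *: f^`M(ord0) + lower f) = d%:R * meval (fun=> X) f.
Proof.
move=> hf; rewrite -mevalZ -(euler hf) /lower mevalD [in X in _ + X]meval_sum mevalZ [in RHS]big_ord_recl.
rewrite mevalD [in RHS]meval_sum mevalZ mevalM mevalXU -[(@ord0 n').+1%:R]/(1 : K) mul1r; congr (_ + _).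
rewrite big_ord_recr /= dd_out // mulr0 scaler0 meval0 addr0.
apply: eq_bigr => i _; rewrite !mevalZ !mevalM !mevalXU.
by rewrite -(dd_ord (lift ord0 i)).
Qed.

Definition tau : R -> K := meval (fun i => (i == ord0)%:R).

Lemma tau_euler d f : hom d f -> tau f^`M(ord0) = d%:R * tau f.
Proof.
move=> hf; rewrite /tau -mevalZ -(euler hf) big_ord_recl mevalD
  [in X in _ = _ + X]meval_sum [X in _ = _ + X]big1 => [|i _].
  by rewrite addr0 mevalZ -[(@ord0 n').+1%:R]/(1 : K) mevalM mevalXU !mul1r.
by rewrite mevalZ mevalM mevalXU mul0r mulr0.
Qed.

(** At p_1 = 1 and all other p_k = 0, only the cut of p_2 into p_1 p_1 survives. This links the
    eigenvalue with the character at rho. *)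
Lemma tau_D2 f : tau (D2 f) = tau (dd 2 f) *+ 2.
Proof.
rewrite /D2 /tau !mevalD.
have -> : (fuse f).@[fun i => (i == ord0)%:R] = 0.
  rewrite /fuse raddf_sum big1 //= => i _; rewrite raddf_sum big1 //= => j _.
  rewrite mevalZ mevalM (_ : (pp _).@[_] = 0) ?mul0r ?mulr0 //.
  rewrite raddf_sum big1 //= => u hu; rewrite mevalXU; case: eqP => // u0.
  by move: hu; rewrite u0.
have -> : (stay f).@[fun i => (i == ord0)%:R] = 0.
  rewrite /stay raddf_sum big1 //= => i _.
  rewrite mevalZ mevalM mevalXU; case: (i =P ord0) => [->|_]; last by rewrite mul0r mulr0.
  by rewrite (_ : (_ * _)%N = 0%N) ?mulr0 ?mul0r // muln0.
rewrite add0r addr0 /cut raddf_sum /= big_ord_recl [X in _ + X]big1 ?addr0; last first.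
  by move=> i _; rewrite raddf_sum big1 // => j _ /=; rewrite mevalZ !mevalM mevalXU !mul0r mulr0.
rewrite raddf_sum /= big_ord_recl [X in _ + X]big1 ?addr0; last first.
  by move=> i _; rewrite mevalZ !mevalM !mevalXU /= mulr0 mul0r mulr0.
rewrite mevalZ !mevalM mevalXU eqxx !mul1r; exact: mulr_natl.
Qed.

End Form.
End PowerSumRing.

(** * Restriction to finitely many variables *)

Section Restriction.
Variables (K : fieldType) (n' : nat).
Local Notation n := n'.+1.
Local Notation R := {mpoly K[n]}.
Implicit Types (f g : R).

Definition psum N k : {mpoly K[N]} := \sum_(i < N) 'X_i ^+ k.

Definition res N f : {mpoly K[N]} := f \mPo [tuple psum N i.+1 | i < n].

HB.instance Definition _ N := GRing.LRMorphism.copy (res N)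
  (comp_mpoly [tuple psum N i.+1 | i < n]).

Lemma resD N f g : res N (f + g) = res N f + res N g.
Proof. exact: (raddfD (res N)). Qed.

Lemma resZ N c f : res N (c *: f) = c *: res N f.
Proof. exact: comp_mpolyZ. Qed.

Lemma res0 N : res N 0 = 0.
Proof. exact: (raddf0 (res N)). Qed.

Lemma resX N i : res N 'X_i = psum N i.+1.
Proof. by rewrite /res comp_mpolyXU -tnth_nth tnth_mktuple. Qed.

Lemma deriv_Xn N (i j : 'I_N) k :
  ('X_j ^+ k.+1 : {mpoly K[N]})^`M(i) = (i == j)%:R *: (k.+1%:R *: 'X_i ^+ k).
Proof.
rewrite !mpolyXn mderivX mulmnE mnm1E [j == i]eq_sym; case: eqP => [->|_].
  rewrite mul1n scale1r; congr (_ *: 'X_[_]).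
  by apply/mnmP => u; rewrite mnmBE !mulmnE; lia.
by rewrite mul0n !scale0r.
Qed.

Lemma deriv_psum N (i : 'I_N) k : (psum N k.+1)^`M(i) = k.+1%:R *: 'X_i ^+ k.
Proof.
rewrite /psum linear_sum (bigD1 i) //= big1 ?addr0 => [|j ij].
  by rewrite deriv_Xn eqxx scale1r.
by rewrite deriv_Xn eq_sym (negPf ij) scale0r.
Qed.

Lemma chain_rule N (i : 'I_N) f :
  (res N f)^`M(i) = \sum_(k < n) k.+1%:R *: ('X_i ^+ k * res N f^`M(k)).
Proof.
elim/mpoly_ind_alg: f => [c|j|f g hf hg|f g hf hg].
- rewrite /res comp_mpolyC mderivC big1 // => k _.
  by rewrite mderivC comp_mpoly0 mulr0 scaler0.
- rewrite resX deriv_psum (bigD1 j) //= big1 ?addr0 => [|k kj].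
    by rewrite deriv_X eqxx rmorph1 mulr1.
  by rewrite deriv_X eq_sym (negPf kj) rmorph0 mulr0 scaler0.
- rewrite rmorphD mderivD hf hg -big_split; apply: eq_bigr => k _.
  by rewrite /= mderivD rmorphD mulrDr scalerDr.
rewrite rmorphM mderivM hf hg mulr_suml mulr_sumr -big_split; apply: eq_bigr => k _.
rewrite /= mderivM rmorphD !rmorphM /= mulrDr scalerDr -scalerAl -scalerAr.
by congr (_ *: _ + _ *: _); ring.
Qed.

Lemma euler_res N f :
  \sum_(i < N) 'X_i * (res N f)^`M(i) = res N (\sum_(k < n) k.+1%:R *: ('X_k * f^`M(k))).
Proof.
rewrite raddf_sum /=; under eq_bigr => i _ do rewrite chain_rule mulr_sumr.
rewrite exchange_big; apply: eq_bigr => k _ /=; rewrite linearZ rmorphM /= resX.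
rewrite mulr_suml scaler_sumr; apply: eq_bigr => i _.
by rewrite -scalerAr mulrA exprS.
Qed.

Definition wpsum N (c : nat -> K) f : {mpoly K[N]} :=
  \sum_(k < n) c k *: (psum N k.+1 * res N f^`M(k)).

Lemma deriv2_res N f :
  \sum_(i < N) 'X_i * ('X_i * (res N f)^`M(i)^`M(i)) =
  wpsum N (fun k => (k.+1 * k)%:R) f +
  \sum_(k < n) \sum_(l < n) (k.+1 * l.+1)%:R *: (psum N (k + l).+2 * res N f^`M(k)^`M(l)).
Proof.
pose T1 (i : 'I_N) := \sum_(k < n) (k.+1 * k)%:R *: ('X_i ^+ k.+1 * res N f^`M(k)).
pose T2 (i : 'I_N) := \sum_(k < n) \sum_(l < n)
  (k.+1 * l.+1)%:R *: ('X_i ^+ (k + l).+2 * res N f^`M(k)^`M(l)).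
rewrite (eq_bigr (fun i => T1 i + T2 i)) => [|i _]; last first.
  rewrite chain_rule linear_sum !mulr_sumr -big_split; apply: eq_bigr => k _ /=.
  rewrite linearZ /= mderivM -!scalerAr !mulrDr scalerDr chain_rule; congr (_ + _).
    case: (k : nat) => [|u]; first by rewrite muln0 expr0 -mpolyC1 mderivC mul0r !mulr0 scaler0 scale0r.
    rewrite deriv_Xn eqxx scale1r natrM -scalerA -scalerAl -!scalerAr; congr (_ *: (_ *: _)).
    by rewrite !exprS !mulrA.
  rewrite !mulr_sumr scaler_sumr; apply: eq_bigr => l _.
  rewrite -!scalerAr scalerA -natrM; congr (_ *: _).
  by rewrite !exprS exprD !mulrA.
rewrite big_split; congr (_ + _); rewrite /T1 /T2 exchange_big; apply: eq_bigr => k _ /=.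
  by rewrite -scaler_sumr -mulr_suml.
rewrite exchange_big; apply: eq_bigr => l _ /=.
by rewrite -scaler_sumr -mulr_suml.
Qed.

Definition divdiff N (i j : 'I_N) f : {mpoly K[N]} :=
  \sum_(k < n) k.+1%:R *: ((\sum_(t < k.+2) 'X_i ^+ (k.+1 - t) * 'X_j ^+ t) * res N f^`M(k)).

Lemma divdiffP N (i j : 'I_N) f (h := res N f) :
  ('X_i - 'X_j) * divdiff i j f = 'X_i * ('X_i * h^`M(i)) - 'X_j * ('X_j * h^`M(j)).
Proof.
rewrite /h !chain_rule !mulr_sumr -sumrB; apply: eq_bigr => k _.
rewrite -!scalerAr -scalerBr; congr (_ *: _).
rewrite [LHS]mulrA (_ : ('X_i - 'X_j) * (\sum_(t < _) _) = 'X_i ^+ k.+2 - 'X_j ^+ k.+2);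
  last by rewrite [RHS]subrXX.
by rewrite !exprS mulrBl !mulrA.
Qed.

Lemma psum0 N : psum N 0 = N%:R.
Proof. by rewrite /psum; under eq_bigr do rewrite expr0; rewrite sumr_const card_ord. Qed.

(** The terms t = 0 and t = k + 1 contain the power sum of exponent 0, which is N, and give the 2N;
    the subtracted multiple is the diagonal i = j. *)
Lemma sum_powers N k :
  \sum_(i < N) \sum_(j < N | i != j) \sum_(t < k.+2) 'X_i ^+ (k.+1 - t) * 'X_j ^+ t =
  \sum_(t < k) psum N (k - t) * psum N t.+1 + (N.*2)%:R * psum N k.+1
   - k.+2%:R * psum N k.+1 :> {mpoly K[N]}.
Proof.
pose Q (i j : 'I_N) : {mpoly K[N]} := \sum_(t < k.+2) 'X_i ^+ (k.+1 - t) * 'X_j ^+ t.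
have -> : \sum_(i < N) \sum_(j < N | i != j) Q i j =
          \sum_(i < N) \sum_(j < N) Q i j - \sum_(i < N) Q i i.
  rewrite -sumrB; apply: eq_bigr => i _.
  rewrite [in RHS](bigD1 i) //= addrAC subrr add0r.
  by apply: eq_bigl => j; rewrite eq_sym.
congr (_ - _); last first.
  rewrite /psum mulr_sumr; apply: eq_bigr => i _.
  rewrite /Q (eq_bigr (fun=> 'X_i ^+ k.+1)) ?sumr_const ?card_ord ?mulr_natl // => t _.
  by rewrite -exprD subnK // -ltnS.
have -> : \sum_(i < N) \sum_(j < N) Q i j = \sum_(t < k.+2) psum N (k.+1 - t) * psum N t.
  rewrite /Q; under eq_bigr => i _ do rewrite exchange_big.
  rewrite exchange_big; apply: eq_bigr => t _; rewrite /psum mulr_suml.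
  by apply: eq_bigr => i _; rewrite mulr_sumr.
rewrite big_ord_recl big_ord_recr /= subn0 /bump /= add1n subnn psum0.
under eq_bigr => t _ do rewrite subSS.
rewrite -addnn natrD; ring.
Qed.

Lemma sum_divdiff N f :
  \sum_(i < N) \sum_(j < N | i != j) divdiff i j f =
  \sum_(k < n) k.+1%:R *: ((\sum_(t < k) psum N (k - t) * psum N t.+1) * res N f^`M(k))
  + (N.*2)%:R *: wpsum N (fun k => k.+1%:R) f - wpsum N (fun k => (k.+1 * k.+2)%:R) f.
Proof.
have -> : \sum_(i < N) \sum_(j < N | i != j) divdiff i j f =
  \sum_(k < n) k.+1%:R *: ((\sum_(i < N) \sum_(j < N | i != j)
      \sum_(t < k.+2) 'X_i ^+ (k.+1 - t) * 'X_j ^+ t) * res N f^`M(k)).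
  rewrite /divdiff; under eq_bigr => i _ do rewrite exchange_big.
  rewrite exchange_big; apply: eq_bigr => k _ /=; rewrite mulr_suml scaler_sumr.
  by apply: eq_bigr => i _; rewrite mulr_suml scaler_sumr.
rewrite /wpsum scaler_sumr -big_split -sumrB; apply: eq_bigr => k _ /=.
rewrite sum_powers natrM -!mul_mpolyC mpolyCM !mpolyC_nat; ring.
Qed.

Lemma res_cut N f : res N (cut f) =
  \sum_(k < n) k.+1%:R *: ((\sum_(t < k) psum N (k - t) * psum N t.+1) * res N f^`M(k)).
Proof.
pose G (i j k : 'I_n) : {mpoly K[N]} :=
  if k == (i + j).+1 :> nat then k.+1%:R *: (psum N i.+1 * psum N j.+1 * res N f^`M(k)) else 0.
have -> : res N (cut f) = \sum_(i < n) \sum_(j < n) \sum_(k < n) G i j k.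
  rewrite /cut raddf_sum; apply: eq_bigr => i _; rewrite /= raddf_sum; apply: eq_bigr => j _ /=.
  rewrite linearZ !rmorphM /= !resX /dd raddf_sum mulr_sumr scaler_sumr big_mkcond.
  by apply: eq_bigr => k _; rewrite /G eqSS; case: eqP => // ->.
under eq_bigr => i _ do rewrite exchange_big.
rewrite exchange_big; apply: eq_bigr => k _ /=.
rewrite mulr_suml scaler_sumr
  (big_ord_widen n (fun t => k.+1%:R *: (psum N (k - t) * psum N t.+1 * res N f^`M(k)))) 1?ltnW //.
rewrite exchange_big [RHS]big_mkcond; apply: eq_bigr => j _ /=.
case: ltnP => jk; last by rewrite big1 // => i _; rewrite /G; case: eqP => //; lia.
have hi : (k - j.+1 < n)%N by rewrite (leq_ltn_trans _ (ltn_ord k)) // leq_subr.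
rewrite (bigD1 (Ordinal hi)) //= big1 ?addr0 => [|i].
  by rewrite /G /= (_ : _ == _ = true); [rewrite subnSK | apply/eqP; lia].
by rewrite -val_eqE /= /G => /eqP ij; case: eqP => //; lia.
Qed.

Lemma res_fuse N a d f : hom d f -> (d <= n)%N ->
  res N (fuse a f) = a *: \sum_(k < n) \sum_(l < n)
     (k.+1 * l.+1)%:R *: (psum N (k + l).+2 * res N f^`M(k)^`M(l)).
Proof.
move=> hf dn; rewrite /fuse raddf_sum scaler_sumr; apply: eq_bigr => i _.
rewrite /= raddf_sum scaler_sumr; apply: eq_bigr => j _ /=.
rewrite linearZ /= -scalerA; congr (_ *: (_ *: _)); rewrite rmorphM /=.
have [le|lt] := leqP (i + j).+2 n.
  by congr (_ * _); rewrite (pp_ord K (Ordinal le)) resX.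
rewrite (hom_deriv0 (hom_deriv (i := i) hf)) ?rmorph0 ?mulr0 //; lia.
Qed.

Lemma res_stay N a f : res N (stay a f) = (a - 1) *: wpsum N (fun k => (k.+1 * k)%:R) f.
Proof.
rewrite /stay raddf_sum scaler_sumr; apply: eq_bigr => i _.
by rewrite /= linearZ rmorphM /= resX scalerA.
Qed.

Lemma euler_wpsum N f :
  \sum_(i < N) 'X_i * (res N f)^`M(i) = wpsum N (fun k => k.+1%:R) f.
Proof.
rewrite euler_res raddf_sum; apply: eq_bigr => k _.
by rewrite /= linearZ rmorphM /= resX.
Qed.

(** The last Euler term cancels the N-dependence of [sum_divdiff], so the operator on power sums is
    the same for all N. The degree bound ensures that no p_k with k > n is lost. *)
Lemma res_D2 N a d f (h := res N f) : hom d f -> (d <= n)%N ->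
  res N (D2 a f) =
  a *: (\sum_(i < N) 'X_i * ('X_i * h^`M(i)^`M(i))) +
  \sum_(i < N) \sum_(j < N | i != j) divdiff i j f +
  2%:R *: (\sum_(i < N) 'X_i * h^`M(i)) - (N.*2)%:R *: (\sum_(i < N) 'X_i * h^`M(i)).
Proof.
move=> hf dn; rewrite /h deriv2_res sum_divdiff euler_wpsum /D2 !rmorphD /=.
rewrite (res_fuse _ _ hf dn) res_cut res_stay.
have -> : wpsum N (fun k => (k.+1 * k.+2)%:R) f =
  wpsum N (fun k => (k.+1 * k)%:R) f + 2%:R *: wpsum N (fun k => k.+1%:R) f.
  rewrite /wpsum scaler_sumr -big_split; apply: eq_bigr => k _ /=.
  by rewrite scalerA -scalerDl -natrM -natrD; congr (_%:R *: _); lia.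
rewrite scalerDr scalerBl scale1r.
move: (wpsum _ _ _) (wpsum _ _ _) (\sum_(k < n) _) (a *: \sum_(k < n) _) => A B C D.
rewrite -!mul_mpolyC; ring.
Qed.

Definition mseq N (s : seq nat) : 'X_{1..N} := [multinom nth 0%N s i | i < N].

(* The coefficient of x^s in the symmetric polynomial in size s variables given by f. *)
Definition cf f (s : seq nat) : K := (res (size s) f)@_(mseq (size s) s).

Lemma cfD f g s : cf (f + g) s = cf f s + cf g s.
Proof. by rewrite /cf resD mcoeffD. Qed.

Lemma cfZ c f s : cf (c *: f) s = c * cf f s.
Proof. by rewrite /cf resZ mcoeffZ. Qed.

Lemma cf0 s : cf 0 s = 0.
Proof. by rewrite /cf res0 mcoeff0. Qed.

Lemma cf_sum (I : Type) (r : seq I) (P : pred I) (F : I -> R) s :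
  cf (\sum_(x <- r | P x) F x) s = \sum_(x <- r | P x) cf (F x) s.
Proof. exact: (big_morph _ (fun f g => cfD f g s) (cf0 s)). Qed.

Lemma shift_mseq s (i j : 'I_(size s)) k : i != j ->
  shift (mseq (size s) s) i j k = mseq (size s) (spread s i j k).
Proof.
move=> ij; apply/mnmP => u; rewrite shiftE // !mnmE /spread !nth_set_nth /= !nth_set_nth /=.
by rewrite -!val_eqE /=; case: (u =P j :> nat) => [->|//]; rewrite -val_eqE eq_sym in ij; rewrite (negPf ij).
Qed.

Lemma spr_divdiff f s (i j : 'I_(size s)) : i != j -> (nth 0 s j <= nth 0 s i)%N ->
  (divdiff i j f)@_(mseq (size s) s) = (nth 0 s i)%:R * cf f s + spr (cf f) s i j.
Proof.
move=> ij hij; rewrite (mcoeff_divdiff _ ij (divdiffP i j f)) !mnmE; congr (_ + _).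
apply: eq_bigr => k _; rewrite shift_mseq // /cf size_spread ?ltn_ord //; congr (_ * _).
by rewrite natrD natrB.
Qed.

Lemma divdiffC N (i j : 'I_N) f : divdiff i j f = divdiff j i f.
Proof.
apply: eq_bigr => k _.
have -> : \sum_(t < k.+2) 'X_i ^+ (k.+1 - t) * 'X_j ^+ t =
          \sum_(t < k.+2) 'X_j ^+ (k.+1 - t) * 'X_i ^+ t :> {mpoly K[N]}.
  rewrite [LHS](reindex_inj rev_ord_inj) /=; apply: eq_bigr => t _.
  by rewrite subSS mulrC subKn // -ltnS.
by [].
Qed.

Lemma pairterm_divdiff f s (i j : 'I_(size s)) : i != j ->
  (divdiff i j f)@_(mseq (size s) s) =
  (maxn (nth 0 s i) (nth 0 s j))%:R * cf f s + pairterm (cf f) s i j.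
Proof.
move=> ij; rewrite /pairterm val_eqE (negPf ij); case: leqP => hij.
  by rewrite (spr_divdiff _ ij hij).
by rewrite divdiffC spr_divdiff ?(ltnW hij) 1?eq_sym.
Qed.

Lemma mcoeff_euler N (h : {mpoly K[N]}) m :
  (\sum_(i < N) 'X_i * h^`M(i))@_m = (mdeg m)%:R * h@_m.
Proof.
rewrite raddf_sum mdegE natr_sum mulr_suml; apply: eq_bigr => i _.
exact: mcoeff_Xderiv.
Qed.

Lemma mdeg_mseq s : mdeg (mseq (size s) s) = sumn s.
Proof.
rewrite mdegE sumnE (big_nth 0%N) big_mkord.
by apply: eq_bigr => i _; rewrite mnmE.
Qed.

Lemma cf_hom d f s : (forall k, k.+1%:R != 0 :> K) -> hom d f -> cf f s != 0 -> sumn s = d.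
Proof.
move=> ch hf; apply: contraNeq => sd.
have := euler_res (size s) f; rewrite (euler hf) resZ => /(congr1 (mcoeff (mseq (size s) s))).
rewrite mcoeff_euler mdeg_mseq mcoeffZ -/(cf f s) => /eqP.
rewrite -subr_eq0 -mulrBl mulf_eq0 => /orP[|//]; rewrite subr_eq0.
case: (ltngtP (sumn s) d) sd => // lt _ /eqP e; exfalso.
  have : (d - sumn s)%N%:R = 0 :> K by rewrite natrB ?(ltnW lt) // e subrr.
  by move: lt; rewrite -subn_gt0; case: (d - sumn s)%N => // k _; apply/eqP/ch.
have : (sumn s - d)%N%:R = 0 :> K by rewrite natrB ?(ltnW lt) // e subrr.
by move: lt; rewrite -subn_gt0; case: (sumn s - d)%N => // k _; apply/eqP/ch.
Qed.

(** From max + min = sum over ordered pairs; the separate [sumn s] supplies the diagonal missing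
    from the first sum. *)
Lemma sum_max_minsum s :
  (\sum_(i < size s) \sum_(j < size s | i != j) maxn (nth 0 s i) (nth 0 s j) +
   sumn s + minsum s = (size s).*2 * sumn s)%N.
Proof.
have hs : sumn s = (\sum_(i < size s) nth 0 s i)%N by rewrite sumnE (big_nth 0%N) big_mkord.
have -> : minsum s = (\sum_(i < size s) \sum_(j < size s) minn (nth 0 s i) (nth 0 s j))%N.
  rewrite /minsum (big_nth 0%N) big_mkord; apply: eq_bigr => i _.
  by rewrite (big_nth 0%N) big_mkord.
rewrite {1}hs -!big_split /=.
rewrite (eq_bigr (fun i : 'I_(size s) => (size s * nth 0 s i + sumn s)%N)) => [|i _].
  by rewrite big_split /= -big_distrr /= -hs sum_nat_const card_ord -mul2n; lia.
rewrite (eq_bigl (fun j => j != i)) => [|j]; last by rewrite eq_sym.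
rewrite -[X in (_ + X + _)%N]maxnn [X in (X + _)%N]addnC.
rewrite -(bigD1 i (P := xpredT) (F := fun j : 'I_(size s) => maxn (nth 0 s i) (nth 0 s j))) //.
rewrite -big_split /= (eq_bigr (fun j : 'I_(size s) => (nth 0 s i + nth 0 s j)%N)) => [|j _].
  by rewrite big_split /= -hs sum_nat_const card_ord.
by rewrite addnC addn_min_max.
Qed.

Lemma mcoeff_sum N m (I : Type) (r : seq I) (P : pred I) (F : I -> {mpoly K[N]}) :
  (\sum_(x <- r | P x) F x)@_m = \sum_(x <- r | P x) (F x)@_m.
Proof. exact: raddf_sum. Qed.

(** The diagonal weight is a (sum of squares - |s|) + (sum of maxima) + (2 - 2N)|s|, which
    [sum_max_minsum] turns into [e2 a s]. *)
Lemma cf_D2 a d f s : hom d f -> (d <= n)%N -> cf (D2 a f) s = LB a (cf f) s.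
Proof.
move=> hf dn; rewrite /cf (res_D2 _ _ hf dn) mcoeffB !mcoeffD !mcoeffZ !mcoeff_euler.
rewrite -/(cf f s) mdeg_mseq.
have -> : (\sum_(i < size s) 'X_i * ('X_i * (res (size s) f)^`M(i)^`M(i)))@_(mseq (size s) s) =
   ((\sum_(x <- s) x ^ 2)%N%:R - (sumn s)%:R) * cf f s.
  have -> : (\sum_(x <- s) x ^ 2 = \sum_(i < size s) nth 0 s i ^ 2)%N.
    by rewrite (big_nth 0%N) big_mkord.
  have -> : (sumn s = \sum_(i < size s) nth 0 s i)%N by rewrite sumnE (big_nth 0%N) big_mkord.
  rewrite mcoeff_sum !natr_sum -sumrB mulr_suml.
  apply: eq_bigr => i _; rewrite /= mcoeff_XM; case: posnP => [|si].
    by rewrite mnmE => ->; rewrite subrr mul0r.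
  rewrite mcoeff_Xderiv mcoeff_deriv submK ?lep1mP -?lt0n //.
  rewrite mnmBE mnm1E eqxx -mulr_natr; move: si; rewrite mnmE.
  case: (nth 0%N s i) => // x _; rewrite subn1 /= natrX -[x.+1%:R]natr1; ring.
have -> : (\sum_(i < size s) \sum_(j < size s | i != j) divdiff i j f)@_(mseq (size s) s) =
  (\sum_(i < size s) \sum_(j < size s | i != j) maxn (nth 0 s i) (nth 0 s j))%N%:R * cf f s +
  \sum_(i < size s) \sum_(j < size s) pairterm (cf f) s i j.
  rewrite mcoeff_sum natr_sum mulr_suml -big_split; apply: eq_bigr => i _ /=.
  rewrite mcoeff_sum natr_sum mulr_suml [X in _ + X](bigD1 i) //=.
  rewrite (_ : pairterm (cf f) s i i = 0) ?add0r; last by rewrite /pairterm eqxx.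
  rewrite [X in _ + X](eq_bigl (fun j : 'I_(size s) => i != j)) => [|j]; last by rewrite eq_sym.
  by rewrite -big_split; apply: eq_bigr => j ij; rewrite /= pairterm_divdiff.
rewrite /LB /e2.
have -> : (\sum_(i < size s) \sum_(j < size s | i != j) maxn (nth 0 s i) (nth 0 s j))%N%:R =
   (size s).*2%:R * (sumn s)%:R - (sumn s)%:R - (minsum s)%:R :> K.
  by rewrite -natrM -sum_max_minsum !natrD; ring.
rewrite -addnn natrD; ring.
Qed.

Definition allvars N : {mpoly K[N]} := 'X_[[multinom 1%N | i < N]].

Lemma res_allvars N f g :
  (forall s, size s = N -> 0%N \in s -> cf f s = 0) ->
  (forall s, size s = N -> cf f (map S s) = cf g s) ->
  res N f = allvars N * res N g.
Proof.
move=> h0 hS; apply/mpolyP => m.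
have sm : size m = N by rewrite size_tuple.
have em : m = mseq N m by apply/mnmP => i; rewrite mnmE (mnm_nth 0%N).
have [m0|m0] := boolP (0%N \in (m : seq nat)).
  have := h0 m sm m0; rewrite /cf sm -em => ->.
  symmetry; apply/eqP; rewrite mcoeff_eq0; apply/negP => /msuppM_le/allpairsP[[u v] /= [+ _ hm]].
  rewrite msuppX inE => /eqP hu; move: m0 => /(nthP 0%N)[k]; rewrite sm => kN.
  by rewrite -(mnm_nth 0%N m (Ordinal kN)) hm hu mnmDE mnmE.
have e : m = ([multinom 1%N | i < N] + mseq N (map predn m))%MM.
  apply/mnmP => i; rewrite mnmDE !mnmE (nth_map 0%N) ?sm // -(mnm_nth 0%N).
  rewrite add1n prednK // lt0n; apply: contraNneq m0 => <-.
  by rewrite (mnm_nth 0%N) mem_nth ?sm.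
rewrite [in RHS]e /allvars mulrC mcoeffMX.
have := hS (map predn m); rewrite size_map sm => /(_ erefl); rewrite /cf !size_map sm => <-.
congr (_@_ _); rewrite {1}em; apply/mnmP => i; rewrite !mnmE.
rewrite !(nth_map 0%N) ?size_map ?sm // prednK // lt0n; apply: contraNneq m0 => <-.
by rewrite mem_nth ?sm.
Qed.

Lemma cf_allvars N f g s : res N f = allvars N * res N g -> size s = N ->
  cf f (map S s) = cf g s.
Proof.
move=> e sN; rewrite /cf size_map sN e /allvars.
have -> : mseq N (map S s) = ([multinom 1%N | i < N] + mseq N s)%MM.
  by apply/mnmP => i; rewrite mnmDE !mnmE (nth_map 0%N) ?sN.
by rewrite mulrC mcoeffMX.
Qed.

Lemma eval_res N f : meval (fun=> 1) (res N f) = meval (fun=> N%:R) f.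
Proof.
rewrite /res comp_mpoly_meval; apply: meval_eq => i; rewrite tnth_mktuple.
rewrite /psum raddf_sum (eq_bigr (fun=> 1)) ?sumr_const ?card_ord // => j _.
by rewrite /= rmorphXn /= mevalXU expr1n.
Qed.

Lemma eval_allvars N : meval (fun=> 1) (allvars N) = 1.
Proof. by rewrite mevalX big1 // => i _; rewrite expr1n. Qed.

Lemma cf_deriv_head f x s :
  x.+1%:R * cf f (x.+1 :: s) =
  \sum_(k < n) if (k <= x)%N then k.+1%:R * cf f^`M(k) ((x - k)%N :: s) else 0.
Proof.
pose N := (size s).+1.
have := congr1 (mcoeff (mseq N (x :: s))) (chain_rule (@ord0 (size s)) f).
rewrite mcoeff_deriv [in RHS]mcoeff_sum mnmE => h.
rewrite mulr_natl /cf -[size (x.+1 :: s)]/N.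
have -> : mseq N (x.+1 :: s) = (mseq N (x :: s) + U_(ord0))%MM.
  by apply/mnmP => i; rewrite mnmDE !mnmE; case: (unliftP ord0 i) => [j|] -> /=; rewrite ?addn0 ?addn1.
rewrite h; apply: eq_bigr => k _; rewrite mcoeffZ -[size (_ :: s)]/N.
case: ifP => kx.
  congr (_ * _); rewrite mpolyXn mulrC.
  have -> : mseq N (x :: s) = (U_(ord0) *+ k + mseq N ((x - k)%N :: s))%MM.
    apply/mnmP => i; rewrite mnmDE mulmnE !mnmE.
    case: (unliftP ord0 i) => [j|] -> /=; rewrite ?mul0n ?mul1n //.
    by rewrite subnKC.
  by rewrite mcoeffMX.
apply/eqP; rewrite mulf_eq0 mcoeff_eq0; apply/orP; right; apply/negP.
move=> /msuppM_le/allpairsP[[u v] /= [+ _ /(congr1 (fun m : 'X_{1..N} => m ord0))]].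
rewrite mpolyXn msuppX inE => /eqP ->; rewrite mnmDE mulmnE !mnmE /=.
by move: kx; lia.
Qed.

(** * The Cauchy kernel *)

Section Cauchy.
Variables (a X : K).
Hypothesis ga : generic a.

Lemma generic_neq0 : a != 0.
Proof.
by apply/eqP => a0; have [] := ga (x := 0) (y := 1); rewrite ?a0 ?mulr0 ?addr0.
Qed.

Lemma zz_neq0 (m : 'X_{1..n}) : zz a m != 0.
Proof.
rewrite prodf_seq_neq0; apply/allP => i _ /=.
rewrite mulf_neq0 ?expf_neq0 ?mulf_neq0 ?(generic_char0 ga) ?generic_neq0 //.
by have := fact_gt0 (m i); case: (_`!) => // k _; apply: (generic_char0 ga).
Qed.

(* The degree d part of exp (\sum_k X p_k / (a k)). *)
Definition kernel d : R :=
  \sum_(m : 'X_{1..n < d.+1} | mnmwgt m == d) (X ^+ mdeg m / zz a m) *: 'X_[m].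

Lemma mdeg_wgt (m : 'X_{1..n}) : (mdeg m <= mnmwgt m)%N.
Proof. by rewrite mdegE; apply: leq_sum => i _; rewrite leq_pmulr. Qed.

Lemma mcoeff_kernel d m : (kernel d)@_m = if mnmwgt m == d then X ^+ mdeg m / zz a m else 0.
Proof.
rewrite /kernel raddf_sum /=; under eq_bigr => k _ do rewrite mcoeffZ mcoeffX.
case: eqP => [wm|wm]; last first.
  rewrite big1 // => k /eqP wk; case: eqP => [km|]; rewrite ?mulr0 //.
  by rewrite -km wk in wm.
have lt : (mdeg m < d.+1)%N by rewrite ltnS -wm mdeg_wgt.
rewrite (bigD1 (BMultinom lt)) /= ?wm // eqxx mulr1 big1 ?addr0 // => k /andP[_ nk].
by rewrite bmeqP /= in nk; rewrite (negPf nk) mulr0.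
Qed.

Lemma hom_kernel d : hom d (kernel d).
Proof. by move=> m; rewrite mcoeff_kernel; case: (_ =P d) => [//|_]; rewrite eqxx. Qed.

(** Reproducing property: the weight [zz] cancels the denominators of the kernel. *)
Lemma form_kernel d f : hom d f -> form a f (kernel d) = meval (fun=> X) f.
Proof.
move=> hf; rewrite /form mevalE; apply: eq_big_seq => m; rewrite mcoeff_msupp => /hf wm.
rewrite mcoeff_kernel wm eqxx -mulrA divfK ?zz_neq0 //; congr (_ * _).
by rewrite mdegE -prodrXr.
Qed.

Lemma deriv_kernel d (k : 'I_n) :
  k.+1%:R *: (kernel d)^`M(k) = if (k < d)%N then (X / a) *: kernel (d - k.+1) else 0.
Proof.
apply/mpolyP => m; rewrite mcoeffZ mcoeff_deriv mcoeff_kernel mnmwgtD mnmwgt1.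
case: ltnP => kd; last first.
  by rewrite mcoeff0; case: eqP => [|_]; [lia | rewrite mul0rn mulr0].
rewrite mcoeffZ mcoeff_kernel.
have -> : (mnmwgt m + k.+1 == d) = (mnmwgt m == d - k.+1)%N by lia.
case: eqP => _; last by rewrite mul0rn !mulr0.
rewrite [(m + _)%MM]addmC zzS mdegD mdeg1 exprS -mulr_natr.
have := zz_neq0 m; have := generic_neq0; have := generic_char0 ga k; have := generic_char0 ga (m k).
by move=> h1 h2 h3 h4; field; rewrite !nat1r h1 h2 h3 h4.
Qed.

(** The alternating partial sums of a binomial row collapse to one binomial of the previous row, and
    absorption concludes. This is the recursion that the coefficients of (1 - x)^M satisfy. *)
Lemma sign_bin_sum M x :
  x.+1%:R * ((-1) ^+ x.+1 * ('C(M, x.+1))%:R) =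
  - M%:R * \sum_(j < x.+1) (-1) ^+ j * ('C(M, j))%:R :> K.
Proof.
case: M => [|M]; first by rewrite bin0n mulr0 mulr0 oppr0 mul0r.
have -> : \sum_(j < x.+1) (-1) ^+ j * ('C(M.+1, j))%:R = (-1) ^+ x * ('C(M, x))%:R :> K.
  elim: x => [|x IH]; first by rewrite big_ord_recl big_ord0 !bin0 addr0.
  by rewrite big_ord_recr /= IH binS natrD exprS; ring.
have := mul_bin_diag M.+1 x => /(congr1 (fun k => k%:R : K)); rewrite !natrM /= => h.
rewrite exprS mulrCA -h; ring.
Qed.

(* At X = - a M the kernel is \prod_i (1 - x_i)^M. *)
Lemma cf_kernel_head M d x s : X = - (a * M%:R) -> (d <= n)%N -> (x <= d)%N ->
  cf (kernel d) (x :: s) = (-1) ^+ x * ('C(M, x))%:R * cf (kernel (d - x)) (0%N :: s).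
Proof.
move=> hX; elim/ltn_ind: x d => -[|x] IH d dn xd; first by rewrite bin0 !mul1r subn0.
apply: (mulfI (generic_char0 ga x)); rewrite cf_deriv_head mulrA sign_bin_sum.
have hz : X / a = - M%:R by rewrite hX mulNr mulrAC divff ?generic_neq0 // mul1r.
rewrite -mulrA mulr_suml [X in _ * X](reindex_inj rev_ord_inj) /= mulr_sumr.
rewrite (big_ord_widen n (fun j => - M%:R * ((-1) ^+ (x.+1 - j.+1) * ('C(M, x.+1 - j.+1))%:R *
   cf (kernel (d - x.+1)) (0%N :: s)))) ?(leq_trans xd) // [RHS]big_mkcond.
apply: eq_bigr => k _; rewrite ltnS; case: leqP => // kx.
rewrite -cfZ deriv_kernel (leq_ltn_trans kx) // cfZ hz subSS IH; try lia.
by congr (_ * (_ * cf (kernel _) _)); lia.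
Qed.
End Cauchy.
End Restriction.

(** * Partitions as sequences *)

Lemma sorted_filter_pos (s : seq nat) : sorted geq s -> s = pos s ++ nseq (size s - size (pos s)) 0%N.
Proof.
elim: s => // x s IH hs; rewrite /pos /=; case: ltnP => x0.
  by rewrite /= -[in RHS]/(pos s) subSS -IH //; apply: path_sorted hs.
have s0 : all (pred1 0%N) s.
  move: hs; rewrite /= path_sortedE; last exact: geq_trans.
  by case/andP=> + _; apply: sub_all => y /= yx; rewrite -leqn0 (leq_trans yx).
have -> : x = 0%N by apply/eqP; rewrite -leqn0.
move: (s0) => /all_pred1P s0'.
rewrite s0' size_nseq (_ : [seq _ <- _ | _] = [::]) ?subn0 //.
by elim: (size s).
Qed.

Section Partitions.
Variable n : nat.
Implicit Types la mu : intpart n.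

Lemma intpart_sorted la : sorted geq [seq val i | i <- la].
Proof. by have /andP[] := intpart_valP la. Qed.

Lemma intpart_sumn la : sumn [seq val i | i <- la] = n.
Proof. by have /andP[_ /eqP] := intpart_valP la. Qed.

Lemma partsE la : parts la = pos [seq val i | i <- la].
Proof. by []. Qed.

Lemma sumn_parts la : sumn (parts la) = n.
Proof. by rewrite partsE sumn_pos intpart_sumn. Qed.

Lemma is_part_parts la : is_part (parts la).
Proof.
rewrite /is_part filter_all andbT.
by apply: sorted_filter (intpart_sorted la); apply: geq_trans.
Qed.

Lemma map_val_parts la : [seq val i | i <- la] = parts la ++ nseq (n - size (parts la)) 0%N.
Proof. by rewrite {1}(sorted_filter_pos (intpart_sorted la)) size_map size_tuple. Qed.

Lemma parts_inj : injective (@parts n).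
Proof.
move=> la mu e; apply/val_inj/val_inj/(inj_map val_inj).
by rewrite /= !map_val_parts e.
Qed.

Lemma part_parts la i : part la i = nth 0%N (parts la) i.
Proof.
rewrite /part map_val_parts nth_cat; case: ltnP => // h.
by rewrite nth_nseq if_same nth_default.
Qed.

Lemma size_part_sumn t : all (fun x => 0 < x)%N t -> (size t <= sumn t)%N.
Proof. by elim: t => //= x t IH /andP[x0 /IH]; lia. Qed.

Lemma parts_surj t : is_part t -> sumn t = n -> exists la, parts la = t.
Proof.
case/andP=> st pt tn.
pose s := t ++ nseq (n - size t) 0%N.
have sn : size s = n by rewrite size_cat size_nseq subnKC // -tn size_part_sumn.
have xs x : x \in s -> (x < n.+1)%N.
  rewrite mem_cat => /orP[xt|/nseqP[-> //]].
  by rewrite ltnS -tn; elim: (t) xt => //= y u IH; rewrite inE => /orP[/eqP->|/IH]; lia.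
pose s' : seq 'I_n.+1 := [seq inord x | x <- s].
have s'n : size s' == n by rewrite size_map sn.
have es : [seq val i | i <- s'] = s.
  rewrite -map_comp -[RHS]map_id; apply/eq_in_map => x /xs hx.
  by rewrite /= inordK.
have ok : sorted geq [seq val i | i <- Tuple s'n] && (sumn [seq val i | i <- Tuple s'n] == n).
  rewrite /= es sumn_cat sumn_nseq mul0n addn0 tn eqxx andbT.
  rewrite sorted_pairwise ?pairwise_cat -?sorted_pairwise //; try exact: geq_trans.
  rewrite st /=; apply/andP; split; first by apply/allrelP => x y _ /nseqP[->].
  by elim: (n - size t)%N => //= -[|k].
exists (IntPart ok); rewrite partsE /= es /pos filter_cat.
rewrite (_ : [seq x <- nseq _ 0%N | _] = [::]) ?cats0; last by elim: (n - _)%N.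
exact/all_filterP.
Qed.

End Partitions.

Definition ptn d : seq (seq nat) := [seq parts la | la : intpart d].

Lemma mem_ptn d t : (t \in ptn d) = is_part t && (sumn t == d).
Proof.
apply/mapP/andP => [[la _ ->]|[pt /eqP st]]; first by rewrite is_part_parts sumn_parts.
by have [la <-] := parts_surj pt st; exists la; rewrite ?mem_enum.
Qed.

Lemma uniq_ptn d : uniq (ptn d).
Proof. by rewrite map_inj_uniq ?enum_uniq //; apply: parts_inj. Qed.

Lemma big_ptn (V : nmodType) d (F : seq nat -> V) :
  \sum_(t <- ptn d) F t = \sum_(la : intpart d) F (parts la).
Proof. by rewrite big_image. Qed.

Lemma part_perm_eq s t : is_part s -> is_part t -> perm_eq s t -> s = t.
Proof.
case/andP=> ss _ /andP[st _].
have anti : antisymmetric geq by move=> x y /andP[h1 h2]; apply: anti_leq; apply/andP.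
exact: sorted_eq geq_trans anti _ _ ss st.
Qed.

Lemma pos_id t : is_part t -> pos t = t.
Proof. by case/andP=> _ /all_filterP. Qed.

(** * Triangular orthogonal families *)

Definition remcol (t : seq nat) : seq nat := pos (map predn t).

Lemma all_pred_pos t : all (fun x => 0 < x)%N t -> map S (map predn t) = t.
Proof. by elim: t => //= x t IH /andP[x0 /IH ->]; rewrite prednK. Qed.

Lemma sumn_mapS s : sumn (map S s) = (sumn s + size s)%N.
Proof. by elim: s => //= x s ->; lia. Qed.

Lemma sumn_remcol t : all (fun x => 0 < x)%N t -> (sumn (remcol t) + size t = sumn t)%N.
Proof.
move=> pt; rewrite sumn_pos -{3}(all_pred_pos pt) sumn_mapS size_map //.
Qed.

Lemma sorted_predn t : sorted geq t -> sorted geq (map predn t).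
Proof. by apply: homo_sorted => x y /=; lia. Qed.

Lemma is_part_remcol t : is_part t -> is_part (remcol t).
Proof.
case/andP=> st _; rewrite /is_part filter_all andbT.
by apply: sorted_filter (sorted_predn st); apply: geq_trans.
Qed.

Lemma size_remcol t : (size (remcol t) <= size t)%N.
Proof. by rewrite -(size_map predn t) size_filter count_size. Qed.

Lemma remcolK t : is_part t ->
  t = map S (remcol t ++ nseq (size t - size (remcol t)) 0%N).
Proof.
case/andP=> st pt; rewrite -{1}(all_pred_pos pt).
by rewrite {1}(sorted_filter_pos (sorted_predn st)) size_map.
Qed.

Lemma perm_pos s t : perm_eq s t -> perm_eq (pos s) (pos t).
Proof. exact: perm_filter. Qed.

Lemma perm_pos_size s t : size s = size t -> perm_eq (pos s) (pos t) -> perm_eq s t.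
Proof.
have h (u : seq nat) : perm_eq u (pos u ++ nseq (size u - size (pos u)) 0%N).
  have e0 : perm_eq u (sort geq u) by rewrite perm_sym perm_sort.
  apply: perm_trans e0 _.
  have ss : sorted geq (sort geq u) by apply: sort_sorted => x y; apply: leq_total.
  have e : perm_eq (pos (sort geq u)) (pos u) by apply: perm_filter; rewrite perm_sort.
  by rewrite {1}(sorted_filter_pos ss) size_sort (perm_size e) perm_cat2r.
move=> st e; apply: perm_trans (h s) _; rewrite perm_sym; apply: perm_trans (h t) _.
by rewrite perm_sym st (perm_size e) perm_cat2r.
Qed.

Lemma is_part_cons M t : is_part (M :: t) ->
  [/\ (0 < M)%N, all (fun x => x <= M)%N t & is_part t].
Proof.
rewrite /is_part sorted_geqE /= => /andP[/andP[h1 h2] /andP[h3 h4]].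
by split => //; rewrite h2.
Qed.

(* What is needed of the functions J_t / h_t with |t| <= n; minsum decreases strictly along the
   dominance order, which makes the triangularity scalar. *)
Record monic_jack (K : fieldType) (a : K) n' (P : seq nat -> {mpoly K[n'.+1]}) : Prop := {
  mj_hom : forall t, is_part t -> (sumn t <= n'.+1)%N -> hom (sumn t) (P t);
  mj_lead : forall t s, is_part t -> (sumn t <= n'.+1)%N -> perm_eq (pos s) t -> cf (P t) s = 1;
  mj_low : forall t s, is_part t -> (sumn t <= n'.+1)%N -> cf (P t) s != 0 ->
    perm_eq (pos s) t \/ (minsum t < minsum s)%N;
  mj_size : forall t s, is_part t -> (sumn t <= n'.+1)%N -> cf (P t) s != 0 ->
    (size t <= size (pos s))%N;
  mj_max : forall t s, is_part t -> (sumn t <= n'.+1)%N -> cf (P t) s != 0 ->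
    all (fun x => x <= head 0 t)%N s;
  mj_stab : forall t s, is_part t -> (sumn t <= n'.+1)%N -> cf (P t) (0%N :: s) = cf (P t) s;
  mj_orth : forall s t, is_part s -> is_part t -> sumn s = sumn t -> (sumn t <= n'.+1)%N ->
    s != t -> form a (P s) (P t) = 0;
  mj_basis : forall d (f : {mpoly K[n'.+1]}), (d <= n'.+1)%N -> hom d f ->
    exists c, f = \sum_(t <- ptn d) c t *: P t
}.

Section EigenBasis.
Variables (K : fieldType) (a : K) (n' : nat).
Local Notation n := n'.+1.
Local Notation R := {mpoly K[n]}.
Variable P : seq nat -> R.
Hypotheses (ga : generic a) (hP : monic_jack a P).
Implicit Types (f g : R) (t u la mu : seq nat) (d N : nat).

Definition jcoef t f : K := form a f (P t) / form a (P t) (P t).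

Lemma coD t f g : jcoef t (f + g) = jcoef t f + jcoef t g.
Proof. by rewrite /jcoef formDl mulrDl. Qed.
Lemma coZ t c f : jcoef t (c *: f) = c * jcoef t f.
Proof. by rewrite /jcoef formZl mulrA. Qed.
Lemma coB t f g : jcoef t (f - g) = jcoef t f - jcoef t g.
Proof. by rewrite coD -scaleN1r coZ mulN1r. Qed.
Lemma co_sum t (I : Type) (r : seq I) (Q : pred I) (F : I -> R) :
  jcoef t (\sum_(x <- r | Q x) F x) = \sum_(x <- r | Q x) jcoef t (F x).
Proof. by rewrite /jcoef form_suml mulr_suml. Qed.

Lemma ptnP d t : t \in ptn d -> is_part t /\ sumn t = d.
Proof. by rewrite mem_ptn => /andP[h /eqP]. Qed.

Lemma orth_ptn d t u : (d <= n)%N -> t \in ptn d -> u \in ptn d -> t != u ->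
  form a (P t) (P u) = 0.
Proof. by move=> dn /ptnP[ht st] /ptnP[hu su] tu; apply: (mj_orth hP); rewrite ?su. Qed.

Lemma norm_neq0 t : is_part t -> (sumn t <= n)%N -> form a (P t) (P t) != 0.
Proof.
move=> pt tn; apply/eqP => nz.
have h f : hom (sumn t) f -> form a f (P t) = 0.
  case/(mj_basis hP tn) => c ->; rewrite form_suml big_seq big1 // => u hu.
  have ht : t \in ptn (sumn t) by rewrite mem_ptn pt /=.
  rewrite formZl; have [->|ut] := eqVneq u t; first by rewrite nz mulr0.
  by rewrite (orth_ptn tn) ?mulr0.
have P0 : P t = 0.
  apply/mpolyP => m; rewrite mcoeff0; have [//|hm] := eqVneq (P t)@_m 0.
  have := h 'X_[m]; rewrite form_Xm -(mj_hom hP pt tn hm) => /(_ (@homXm _ _ _)) /eqP.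
  by rewrite mulf_eq0 (negPf (zz_neq0 ga m)) orbF => /eqP.
have := mj_lead hP (s := t) pt tn; rewrite pos_id // P0 cf0 => /(_ (perm_refl _)) /esym /eqP.
by rewrite oner_eq0.
Qed.

Lemma co_P d t u : (d <= n)%N -> t \in ptn d -> u \in ptn d -> jcoef t (P u) = (u == t)%:R.
Proof.
move=> dn ht hu; rewrite /jcoef; case: eqVneq => [->|ut].
  by have [pt st] := ptnP ht; rewrite divff // norm_neq0 // st.
by rewrite (orth_ptn dn) // mul0r.
Qed.

Lemma expand d f : (d <= n)%N -> hom d f -> f = \sum_(t <- ptn d) jcoef t f *: P t.
Proof.
move=> dn hf; have [c e] := mj_basis hP dn hf.
rewrite {1}e big_seq [RHS]big_seq; apply: eq_bigr => t ht; congr (_ *: _).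
rewrite e co_sum (bigD1_seq t) ?uniq_ptn //= coZ (co_P dn) // eqxx mulr1.
rewrite big_seq_cond big1 ?addr0 // => u /andP[hu ut].
by rewrite coZ (co_P dn) // (negPf ut) mulr0.
Qed.

Lemma cf_stab d f s : (d <= n)%N -> hom d f -> cf f (0%N :: s) = cf f s.
Proof.
move=> dn hf; rewrite (expand dn hf) !cf_sum big_seq [RHS]big_seq; apply: eq_bigr => t /ptnP[pt st].
by rewrite !cfZ (mj_stab hP) // st.
Qed.

(** Induction on [minsum t], reading the coefficient at [t] padded to length N. Any other [u]
    contributing there has smaller [minsum] and, by [mj_size], at most [size t] parts, so its
    coefficient is already known to be 0. *)
Lemma triangular d f N b : (d <= n)%N -> hom d f ->
  (forall s, size s = N -> (minsum s <= b)%N -> cf f s = 0) ->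
  forall t, t \in ptn d -> (size t <= N)%N -> (minsum t <= b)%N -> jcoef t f = 0.
Proof.
move=> dn hf h0 t; have [m] := ubnP (minsum t); elim: m t => // m IH t tm ht tN tb.
have [pt st] := ptnP ht.
pose s := t ++ nseq (N - size t) 0%N.
have ps : pos s = t.
  rewrite /pos filter_cat -/(pos t) pos_id // (_ : [seq x <- nseq _ 0%N | _] = [::]) ?cats0 //.
  by elim: (N - size t)%N.
have ms : minsum s = minsum t by rewrite -minsum_pos ps.
have := h0 s _ _; rewrite size_cat size_nseq subnKC // ms => /(_ erefl tb).
rewrite (expand dn hf) cf_sum (bigD1_seq t) ?uniq_ptn //= cfZ (mj_lead hP) ?ps ?st // mulr1.
rewrite big_seq_cond big1 ?addr0 // => [<-|u /andP[hu ut]].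
  by rewrite -(expand dn hf).
have [pu su] := ptnP hu.
rewrite cfZ; have [->|cu] := eqVneq (cf (P u) s) 0; first by rewrite mulr0.
have un : (sumn u <= n)%N by rewrite su.
case: (mj_low hP pu un cu) => [|lt].
  by rewrite ps => /(part_perm_eq pt pu) e; rewrite e eqxx in ut.
rewrite ms in lt; rewrite (IH u) ?mul0r //; try lia.
by have := mj_size hP pu un cu; rewrite ps => h; apply: leq_trans tN.
Qed.

Lemma LB_P t s : is_part t -> (sumn t <= n)%N -> (minsum s <= minsum t)%N ->
  LB a (cf (P t)) s = e2 a t * cf (P t) s.
Proof.
move=> pt tn st; rewrite LB_top; last first.
  move=> s' _ _ lt; apply: contraTeq isT => /(mj_low hP pt tn)[/minsum_perm|]; rewrite ?minsum_pos; lia.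
have [->|cs] := eqVneq (cf (P t) s) 0; first by rewrite !mulr0.
case: (mj_low hP pt tn cs) => [|lt]; last by lia.
by move=> /(e2_perm a); rewrite e2_pos => ->.
Qed.

(** Triangularity handles the components with [minsum] at most that of [t]; self-adjointness
    transfers this to the remaining ones. *)
Lemma D2_P t : is_part t -> (sumn t <= n)%N -> D2 a (P t) = e2 a t *: P t.
Proof.
have low t' u' : is_part t' -> (sumn t' <= n)%N -> u' \in ptn (sumn t') -> (minsum u' <= minsum t')%N ->
    jcoef u' (D2 a (P t') - e2 a t' *: P t') = 0.
  move=> pt tn hu ut; have hP' := mj_hom hP pt tn.
  have hf : hom (sumn t') (D2 a (P t') - e2 a t' *: P t').
    by rewrite -scaleNr; apply: homD; [apply: hom_D2 | apply: homZ].
  apply: (triangular (N := n) (b := minsum t') tn hf) => //.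
    move=> s _ st; rewrite cfD -scaleNr cfZ (cf_D2 a s hP' tn) LB_P //; ring.
  have [pu su] := ptnP hu; apply: leq_trans (size_part_sumn _) _; last by rewrite su.
  by case/andP: pu.
move=> pt tn; apply/eqP; rewrite -subr_eq0; apply/eqP.
have hPt := mj_hom hP pt tn; have ht : t \in ptn (sumn t) by rewrite mem_ptn pt /=.
have hf : hom (sumn t) (D2 a (P t) - e2 a t *: P t).
  by rewrite -scaleNr; apply: homD; [apply: hom_D2 | apply: homZ].
rewrite (expand tn hf) big_seq big1 // => u hu; have [pu su] := ptnP hu.
have un : (sumn u <= n)%N by rewrite su.
case: (leqP (minsum u) (minsum t)) => [ut|tu]; first by rewrite low // scale0r.
have ut : u != t by apply: contraTneq tu => ->; rewrite ltnn.
(* With the roles of [t] and [u] exchanged, [t] is the one of smaller [minsum]. *)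
have : jcoef t (D2 a (P u) - e2 a u *: P u) = 0 by rewrite low ?su // ltnW.
rewrite /jcoef => /eqP; rewrite mulf_eq0 invr_eq0 (negPf (norm_neq0 pt tn)) orbF => /eqP.
rewrite formDl -!scaleNr !formZl (orth_ptn tn hu ht ut) mulr0 addr0 D2_selfadj => e.
rewrite formDl formZl [form a (D2 _ _) _]formC e add0r.
by rewrite (orth_ptn tn ht hu) 1?eq_sym // mulr0 mul0r scale0r.
Qed.

Lemma eigen_P t N : is_part t -> (sumn t <= n)%N -> eigen a N (cf (P t)) t.
Proof.
move=> pt tn s _ _; rewrite -(cf_D2 a s (mj_hom hP pt tn) tn) D2_P // cfZ //.
Qed.

Lemma cf_eq0_low t s : is_part t -> (sumn t <= n)%N -> (minsum s <= minsum t)%N ->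
  cf (P t) s = (perm_eq (pos s) t)%:R.
Proof.
move=> pt tn st; case: (boolP (perm_eq _ _)) => [h|h]; first by rewrite (mj_lead hP).
apply: contraNeq h => /(mj_low hP pt tn)[//|]; lia.
Qed.

Lemma cf_hom0 t s : is_part t -> (sumn t <= n)%N -> sumn s != sumn t -> cf (P t) s = 0.
Proof.
move=> pt tn; apply: contraNeq => h; apply/eqP.
exact: (cf_hom (generic_char0 ga) (mj_hom hP pt tn)).
Qed.

(** In [size t] variables every monomial of [P t] involves all of them. After division by their
    product, both sides are eigenfunctions for [map predn t], whose zeros keep the number of
    variables, and their low coefficients agree. *)
Lemma column_removal t : is_part t -> (sumn t <= n)%N ->
  res (size t) (P t) = allvars K (size t) * res (size t) (P (remcol t)).
Proof.
move=> pt tn; have [st pt0] := andP pt.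
have pr := is_part_remcol pt; have sr := sumn_remcol pt0.
have rn : (sumn (remcol t) <= n)%N by lia.
apply: res_allvars => s sN.
  move=> s0; apply: contraTeq s0 => /(mj_size hP pt tn); rewrite -sN size_filter => le.
  have /eqP : count (fun x => 0 < x)%N s = size s by apply/eqP; rewrite eqn_leq count_size.
  by rewrite -all_count => /allP h; apply/negP => /h.
have er : sumn (map predn t) = sumn (remcol t) by rewrite sumn_pos.
have [es|/eqP es] := eqVneq (sumn s) (sumn (map predn t)); last first.
  have h1 : sumn s != sumn (remcol t) by rewrite -er; apply/eqP.
  by rewrite !cf_hom0 // sumn_mapS sN -(sumn_remcol pt0) eqn_add2r.
apply: (eigen_uniq ga (N := size t) (t := map predn t)
  (h1 := fun s => cf (P t) (map S s)) (h2 := cf (P (remcol t)))) => //.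
- apply: eigen_col; rewrite ?size_map ?all_pred_pos //; first exact: eigen_P.
  move=> s' sN' s0; apply: contraTeq s0 => /(mj_size hP pt tn); rewrite -sN' size_filter => le.
  have /eqP : count (fun x => 0 < x)%N s' = size s' by apply/eqP; rewrite eqn_leq count_size.
  by rewrite -all_count => /allP h; apply/negP => /h.
- move=> s' sN' se; rewrite (@eigen_P _ (size t) pr rn) //; last by rewrite se er.
  by rewrite /remcol e2_pos.
move=> s' sN' se hm; rewrite !cf_eq0_low // ?minsum_pos //; last first.
  by rewrite -(all_pred_pos pt0) !minsum_mapS size_map sN' leq_add2r.
congr (nat_of_bool _)%:R.
have -> : pos (map S s') = map S s' by apply/all_filterP; rewrite all_map; apply/allP.
apply/idP/idP => [h|].
  by apply: perm_pos; rewrite -(mapK succnK s'); apply: perm_map.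
move/perm_pos_size; rewrite size_map => /(_ sN') h.
by rewrite -(all_pred_pos pt0); apply: perm_map.
Qed.

(** By [mj_max], M is the largest exponent occurring, so [eigen_row] applies; the low coefficients
    of both sides then agree. *)
Lemma row_removal M t s : is_part (M :: t) -> (sumn (M :: t) <= n)%N ->
  cf (P (M :: t)) (M :: s) = cf (P t) s.
Proof.
move=> pMt Mtn; have [M0 tM pt] := is_part_cons pMt.
have tn : (sumn t <= n)%N by move: Mtn => /=; lia.
have [es|/eqP es] := eqVneq (sumn s) (sumn t); last first.
  by rewrite !cf_hom0 //=; [apply/eqP | rewrite eqn_add2l; apply/eqP].
have hM s' : has (fun x => M < x)%N s' -> cf (P (M :: t)) s' = 0.
  move=> hs; apply: contraTeq hs => /(mj_max hP pMt Mtn) /= h.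
  by rewrite -all_predC; apply: sub_all h => x /=; rewrite -leqNgt.
apply: (eigen_uniq ga (N := size s) (t := t)
  (h1 := fun s => cf (P (M :: t)) (M :: s)) (h2 := cf (P t))) => //.
- apply: eigen_row => //; first exact: eigen_P.
  by move=> s' _; apply: hM.
- exact: eigen_P.
move=> s' sN' se hm; rewrite [RHS]cf_eq0_low //.
case hs: (has (fun x => M < x)%N s').
  rewrite hM /= ?hs ?orbT //; case: (boolP (perm_eq _ _)) => // /perm_mem h.
  case/hasP: hs => x xs Mx; have : x \in pos s' by rewrite mem_filter xs (leq_trans _ Mx).
  by rewrite h => /(allP tM); rewrite leqNgt Mx.
have sM : all (fun x => x <= M)%N s'.
  by apply/allP => x xs; rewrite leqNgt; apply: contraFN hs => ?; apply/hasP; exists x.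
rewrite cf_eq0_low //; first by rewrite /pos /= M0 perm_cons.
by rewrite !minsum_cons_max // se leq_add2l.
Qed.

End EigenBasis.

(** * The Pieri rule *)

Lemma incr_remcol la mu i : is_part la -> is_part mu -> size mu = size la ->
  remcol la = incr_nth (remcol mu) i -> la = incr_nth mu i.
Proof.
move=> pl pm e h; have hi : (i < size la)%N.
  have := size_remcol la; rewrite h size_incr_nth; case: ltnP => // hi le.
  by rewrite -e (leq_trans hi) // size_remcol.
apply: (@eq_from_nth _ 0%N); first by rewrite size_incr_nth e hi.
move=> j jl; rewrite nth_incr_nth {1}(remcolK pl) {1}(remcolK pm).
have sz u : (size u <= size la)%N -> size (u ++ nseq (size la - size u) 0%N) = size la.
  by move=> ul; rewrite size_cat size_nseq subnKC.
have nz u : nth 0%N (u ++ nseq (size la - size u) 0%N) j = nth 0%N u j.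
  rewrite nth_cat; case: ltnP => // uj; by rewrite nth_nseq if_same nth_default.
rewrite e !(nth_map 0%N) ?sz ?size_remcol // ?nz; last by rewrite -e size_remcol.
by rewrite h nth_incr_nth addnS.
Qed.

Section Pieri.
Variables (K : fieldType) (a : K) (n' : nat).
Local Notation n := n'.+1.
Local Notation R := {mpoly K[n]}.
Variable P : seq nat -> R.
Hypotheses (ga : generic a) (hP : monic_jack a P).
Implicit Types (f g : R) (t u la mu nu : seq nat) (d N : nat).
Local Notation co := (jcoef a P).

Lemma res_ext N f g : (forall s, size s = N -> cf f s = cf g s) -> res N f = res N g.
Proof.
move=> h; apply/mpolyP => m; have sm : size m = N by rewrite size_tuple.
have := h m sm; rewrite /cf sm (_ : mseq N m = m) //.
by apply/mnmP => i; rewrite mnmE (mnm_nth 0%N).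
Qed.

Lemma resM N f g : res N (f * g) = res N f * res N g.
Proof. exact: rmorphM. Qed.

Lemma res_short N t : is_part t -> (sumn t <= n)%N -> (N < size t)%N -> res N (P t) = 0.
Proof.
move=> pt tn Nt; rewrite -(res0 K n' N); apply: res_ext => s sN; rewrite cf0.
apply: contraTeq Nt => /(mj_size hP pt tn); rewrite -leqNgt => h.
by apply: leq_trans h _; rewrite -sN size_filter count_size.
Qed.

(** In [size la] variables [P mu] is already zero. *)
Lemma coX_short mu la : is_part mu -> is_part la -> (sumn la <= n)%N ->
  sumn la = (sumn mu).+1 -> (size la < size mu)%N -> co la ('X_ord0 * P mu) = 0.
Proof.
move=> pm pl ln e lm; have mn : (sumn mu <= n)%N by lia.
apply: (triangular (N := size la) (b := minsum la) ga hP ln _) => //.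
- by rewrite e -add1n; apply: homMX; apply: (mj_hom hP).
- by move=> s sN _; rewrite /cf sN resM res_short // mulr0 mcoeff0.
by rewrite mem_ptn pl /=.
Qed.

(** By adjointness, multiplication by p_1 and d/dp_1 have the same support; each case of the Pieri
    rule uses whichever is convenient. *)
Lemma coX_deriv mu la : is_part mu -> is_part la -> (sumn la <= n)%N ->
  sumn la = (sumn mu).+1 -> (co la ('X_ord0 * P mu) == 0) = (co mu (P la)^`M(ord0) == 0).
Proof.
move=> pm pl ln e; have mn : (sumn mu <= n)%N by lia.
rewrite /jcoef form_XMl !mulf_eq0 !invr_eq0 !(negPf (norm_neq0 ga hP _ _)) //.
by rewrite (negPf (generic_neq0 ga)) !orbF oner_eq0 /= formC.
Qed.

Lemma cf_deriv0 d f s : (d <= n)%N -> hom d f -> cf f^`M(ord0) s = cf f (1%N :: s).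
Proof.
move=> dn hf; rewrite -(cf_stab ga hP (d := d - 1)); first last.
- exact: (hom_deriv (i := ord0) hf).
- lia.
have := cf_deriv_head f 0 s; rewrite mul1r => ->.
rewrite big_ord_recl big1 ?addr0 => [|i _ //].
by rewrite /= mul1r.
Qed.

(** The coefficient of the derivative at [s] is that of [P la] at [1 :: s]. Since [mu] is shorter
    than [la], it is visible with one variable fewer than [la] has parts; there column removal
    leaves two cases for the last part. *)
Lemma pieri_short la mu : is_part la -> (sumn la <= n)%N -> is_part mu ->
  sumn la = (sumn mu).+1 -> (size mu < size la)%N ->
  co mu (P la)^`M(ord0) != 0 -> la = rcons mu 1%N.
Proof.
move=> pl ln pm e lt.
have [st pt0] := andP pl; have mn : (sumn mu <= n)%N by lia.
have hg : hom (sumn mu) (P la)^`M(ord0).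
  by have := hom_deriv (i := ord0) (mj_hom hP pl ln); rewrite e subn1.
have hmu : mu \in ptn (sumn mu) by rewrite mem_ptn pm /=.
have cg s : cf (P la)^`M(ord0) s = cf (P la) (1%N :: s) by apply: cf_deriv0 (mj_hom hP pl ln).
case/lastP: la pl ln e lt st pt0 hg cg => // l0 x pl ln e lt st pt0 hg cg.
rewrite size_rcons ltnS in lt.
have c0 s : size s = size l0 -> 0%N \in s -> cf (P (rcons l0 x)) (1%N :: s) = 0.
  move=> sN s0; apply: contraTeq s0 => /(mj_size hP pl ln) /=.
  rewrite size_rcons ltnS size_filter -sN => le.
  have /eqP : count (fun x => 0 < x)%N s = size s by apply/eqP; rewrite eqn_leq count_size.
  by rewrite -all_count => /allP h; apply/negP => /h.
have colrem s : size s = size l0 ->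
    cf (P (rcons l0 x)) (1%N :: map S s) = cf (P (remcol (rcons l0 x))) (0%N :: s).
  move=> sN; have := column_removal ga hP pl ln => /cf_allvars h.
  by rewrite -(h (0%N :: s)) //= size_rcons sN.
have pr := is_part_remcol pl; have sr := sumn_remcol pt0.
have [p0 lx pl0] : [/\ (0 < x)%N, all (fun y => x <= y)%N l0 & is_part l0].
  move: pl; rewrite /is_part all_rcons => /andP[h1 /andP[h2 h3]].
  move: h1; rewrite -cats1 sorted_pairwise ?pairwise_cat; last exact: geq_trans.
  rewrite -sorted_pairwise; last exact: geq_trans.
  by case/and3P; rewrite allrel1r => h4 h5 _; split=> //; rewrite h5.
have rn : (sumn (remcol (rcons l0 x)) <= n)%N by lia.
have posS s : 0%N \notin s -> exists s', s = map S s'.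
  move=> s0; exists (map predn s); rewrite all_pred_pos //; apply/allP => y ys.
  by rewrite lt0n; apply: contraNneq s0 => <-.
have smu : (size mu <= size l0)%N by [].
case: (ltnP 1 x) => x1 cne.
  (* All parts exceed 1, so the partition without its first column has as many parts as before, too
     many for the exponents [0 :: s']: the derivative restricts to zero. *)
  exfalso; move/negP: cne; apply; apply/eqP.
  apply: (triangular (N := size l0) (b := minsum mu) ga hP mn hg) => // s sN _.
  rewrite cg; have [s0|/posS[s' es]] := boolP (0%N \in s); first exact: c0.
  rewrite es size_map in sN *; rewrite colrem //.
  have [//|/(mj_size hP pr rn)] := eqVneq (cf (P (remcol (rcons l0 x))) (0%N :: s')) 0.
  have -> : remcol (rcons l0 x) = map predn (rcons l0 x).
    apply/all_filterP; rewrite all_map all_rcons /= -ltnS prednK // x1 /=.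
    by apply: sub_all lx => y /= xy; rewrite -ltnS prednK; lia.
  rewrite size_map size_rcons size_filter /= add0n => h.
  by have := count_size (fun y => 0 < y)%N s'; rewrite sN leqNgt h.
have ex : x = 1%N by lia.
have l0n : (sumn l0 <= n)%N by move: ln; rewrite sumn_rcons; lia.
have er : remcol (rcons l0 x) = remcol l0.
  by rewrite /remcol map_rcons ex /pos filter_rcons.
have hl0 : l0 \in ptn (sumn mu).
  by rewrite mem_ptn pl0; apply/eqP; move: e; rewrite sumn_rcons ex; lia.
(* Without their first columns, [la] and [l0] are the same partition; the derivative and [P l0]
   agree in [size l0] variables, which forces [mu] to be [l0]. *)
have h0 : co mu ((P (rcons l0 x))^`M(ord0) - P l0) = 0.
  apply: (triangular (N := size l0) (b := minsum mu) ga hP mn) => // [|s sN _].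
    rewrite -scaleN1r; apply: homD => //; apply: homZ; rewrite -(ptnP hl0).2.
    exact: (mj_hom hP).
  rewrite cfD -scaleN1r cfZ cg mulN1r.
  have [s0|/posS[s' es]] := boolP (0%N \in s).
    rewrite c0 // add0r; apply: oppr_inj; rewrite opprK oppr0; apply: contraTeq s0.
    move/(mj_size hP pl0 l0n); rewrite size_filter -sN => le.
    have /eqP : count (fun x => 0 < x)%N s = size s by apply/eqP; rewrite eqn_leq count_size.
    by rewrite -all_count => /allP h; apply/negP => /h.
  rewrite es size_map in sN *; rewrite colrem // er.
  rewrite (cf_allvars (column_removal ga hP pl0 l0n) sN).
  have sr0 := sumn_remcol (proj2 (andP pl0)).
  rewrite (mj_stab hP) ?subrr ?is_part_remcol //; lia.
move: cne; rewrite -[(P _)^`M(_)](subrK (P l0)) coD h0 add0r (co_P ga hP mn) // ex.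
by case: (eqVneq l0 mu) => [-> //|_]; rewrite eqxx.
Qed.

(** If [la] and [mu] have equal length, both lose their first column and induction applies; unequal
    lengths are [pieri_short] and [coX_short]. *)
Theorem pieri la mu : is_part la -> (sumn la <= n)%N -> is_part mu ->
  sumn la = (sumn mu).+1 -> co mu (P la)^`M(ord0) != 0 -> exists i, la = incr_nth mu i.
Proof.
have [b] := ubnP (sumn la); elim: b la mu => // b IH la mu lb pl ln pm e cne.
have [lt|gt|eq] := ltngtP (size mu) (size la).
- rewrite (pieri_short pl ln pm e lt cne); exists (size mu).
  by elim: (mu) => //= x u ->.
- by move: cne; rewrite -coX_deriv // coX_short ?eqxx.
have [st pt0] := andP pl; have [_ pm0] := andP pm; have mn : (sumn mu <= n)%N by lia.
have pr := is_part_remcol pl; have pr' := is_part_remcol pm.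
have sr := sumn_remcol pt0; have sr' := sumn_remcol pm0.
have lpos : (0 < size la)%N by case: (la) e.
suff [i h] : exists i, remcol la = incr_nth (remcol mu) i.
  by exists i; apply: incr_remcol.
have er : sumn (remcol la) = (sumn (remcol mu)).+1 by lia.
have rn : (sumn (remcol la) <= n)%N by lia.
have rn' : (sumn (remcol mu) <= n)%N by lia.
apply: IH => //; first by lia.
rewrite -coX_deriv //.
move: cne; rewrite -coX_deriv //; apply: contraNN => /eqP h.
pose f := 'X_ord0 * P mu.
(* Dividing the expansion of [f] by the product of [size la] variables expands
   ['X_ord0 * P (remcol mu)]: shorter [nu] have coefficient 0 and longer ones restrict to 0. Hence
   [g] restricts to 0. *)
pose g := 'X_ord0 * P (remcol mu) -
  \sum_(nu <- ptn (sumn la) | size nu == size la) co nu f *: P (remcol nu).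
have hf : hom (sumn la) f by rewrite e -add1n; apply: homMX; apply: (mj_hom hP).
have hnu (nu : seq nat) : (nu \in ptn (sumn la)) -> size nu = size la ->
    [/\ is_part nu, sumn nu = sumn la, is_part (remcol nu) & sumn (remcol nu) = sumn (remcol la)].
  move=> /ptnP[pn sn] szn; have [_ pn0] := andP pn; split => //; first exact: is_part_remcol.
  by apply/(@addIn (size nu)); rewrite sumn_remcol // sn -sr szn.
have hg : hom (sumn (remcol la)) g.
  rewrite /g -scaleN1r; apply: homD.
    by rewrite er -add1n; apply: homMX; apply: (mj_hom hP).
  apply: homZ; rewrite big_seq_cond; apply: hom_sum => nu /andP[hn /eqP szn]; apply: homZ.
  by have [_ _ p1 s1] := hnu nu hn szn; rewrite -s1; apply: (mj_hom hP) => //; rewrite s1.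
have g0 : co (remcol la) g = 0.
  apply: (triangular (N := size la) (b := minsum (remcol la)) ga hP _ hg) => //; first last.
  - exact: size_remcol.
  - by rewrite mem_ptn pr /=.
  move=> s sN _.
  have -> : cf g s = cf ('X_ord0 * P (remcol mu)) s - cf f (map S s).
    rewrite {1}/g cfD -scaleN1r cfZ mulN1r; congr (_ - _).
    rewrite [in RHS](expand ga hP ln hf) !cf_sum big_mkcond big_seq [RHS]big_seq.
    apply: eq_bigr => nu hn; have [pn sn] := ptnP hn; rewrite !cfZ; case: eqP => szn.
      by congr (_ * _); rewrite -(cf_allvars (column_removal ga hP pn _)) ?sn // szn.
    have [lt|gt|//] := ltngtP (size nu) (size la).
      by rewrite coX_short ?mul0r ?sn // eq.
    rewrite /cf size_map res_short ?mcoeff0 ?mulr0 ?sn // sN //.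
  rewrite (cf_allvars (N := size la) (g := 'X_ord0 * P (remcol mu))) ?subrr //.
  by rewrite !resM -eq (column_removal ga hP) // mulrCA.
move: g0; rewrite /g coB h sub0r co_sum => /eqP; rewrite oppr_eq0.
rewrite big_mkcond (bigD1_seq la) ?uniq_ptn ?mem_ptn ?pl ?eqxx //=.
rewrite big_seq_cond big1 => [|nu /andP[hn nul]].
  by rewrite addr0 coZ (co_P ga hP (d := sumn (remcol la))) ?mem_ptn ?pr ?eqxx ?mulr1.
case: (size nu =P size la) => // szn; have [p1 s1 p2 s2] := hnu nu hn szn.
rewrite coZ (co_P ga hP (d := sumn (remcol la))) ?mem_ptn ?p2 ?s2 ?pr ?eqxx //.
case: eqP => [e'|]; rewrite ?mulr0 //.
by move: nul; rewrite (remcolK p1) (remcolK pl) e' szn eqxx.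
Qed.

End Pieri.

(** * Evaluations and norms *)

Section Evaluation.
Variables (K : fieldType) (a : K) (n' : nat).
Local Notation n := n'.+1.
Local Notation R := {mpoly K[n]}.
Variable P : seq nat -> R.
Hypotheses (ga : generic a) (hP : monic_jack a P).
Implicit Types (f g : R) (t u la mu nu : seq nat) (d N : nat).
Local Notation co := (jcoef a P).

Lemma hom0_const f : hom 0 f -> f = (f@_0%MM)%:MP.
Proof.
move=> hf; apply/mpolyP => m; rewrite mcoeffC.
have [->|m0] := eqVneq m 0%MM; first by rewrite mulr1.
rewrite mulr0; have [//|/hf wm] := eqVneq f@_m 0.
have := mdeg_wgt m; rewrite wm leqn0 => /eqP md.
by rewrite -mdeg_eq0 md in m0.
Qed.

Lemma is_part0 t : is_part t -> sumn t = 0%N -> t = [::].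
Proof. by case: t => //= x t /andP[_ /= /andP[x0 _]] ; lia. Qed.

Lemma is_part_nil : is_part [::].
Proof. by []. Qed.

Lemma P_nil : P [::] = 1.
Proof.
have h := hom0_const (mj_hom hP is_part_nil (leq0n n)).
have := mj_lead hP (s := [::]) is_part_nil (leq0n n) isT.
rewrite /cf h /res comp_mpolyC mcoeffC (_ : mseq _ _ = 0%MM) ?eqxx ?mulr1 => [->|]; first exact: mpolyC1.
by apply/mnmP => -[].
Qed.

Lemma hom_deriv0P la d : is_part la -> (sumn la <= n)%N -> sumn la = d.+1 ->
  hom d (P la)^`M(ord0).
Proof.
by move=> pl ln e; have := hom_deriv (i := ord0) (mj_hom hP pl ln); rewrite e subn1.
Qed.

Lemma lower_P la d : is_part la -> (sumn la <= n)%N -> sumn la = d.+1 ->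
  lower (P la) *+ 2 = \sum_(mu <- ptn d) (co mu (P la)^`M(ord0) * (e2 a la - e2 a mu)) *: P mu.
Proof.
move=> pl ln e; have dn : (d <= n)%N by lia.
have hg := hom_deriv0P pl ln e; set g := _^`M(_) in hg *.
have := deriv_D2 a (P la); rewrite (D2_P ga hP) // linearZ -/g /= => /esym /(canRL (addKr _)) ->.
rewrite [in RHS](eq_bigr (fun mu => e2 a la *: (co mu g *: P mu) - co mu g *: (e2 a mu *: P mu))); last first.
  by move=> mu _; rewrite mulrBr scalerBl !scalerA [e2 a la * _]mulrC.
rewrite sumrB -scaler_sumr -(expand ga hP dn hg) addrC; congr (_ - _).
rewrite {1}(expand ga hP dn hg) raddf_sum big_seq [RHS]big_seq; apply: eq_bigr => mu /ptnP[pm sm].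
by rewrite /= linearZ /= (D2_P ga hP) // sm.
Qed.

Lemma char2 : (2%:R : K) != 0.
Proof. exact: (generic_char0 ga 1). Qed.

(** Apply Euler's relation at p_k = X. By the Pieri rule only [mu] with one box less contribute, and
    X plus half the eigenvalue difference is the factor of that box in [cprod]. The constants follow
    the same recursion by [tau_euler]. *)
Theorem eval_cprod X la : is_part la -> (sumn la <= n)%N ->
  meval (fun=> X) (P la) = tau (P la) * cprod a X la.
Proof.
have [b] := ubnP (sumn la); elim: b la => // b IH la lb pl ln.
case e : (sumn la) => [|d]; first by rewrite (is_part0 pl e) P_nil /tau !meval1 mulr1.
have dn : (d <= n)%N by lia.
have hl := mj_hom hP pl ln; rewrite e in hl.
have hg := hom_deriv0P pl ln e.
apply: (mulfI (generic_char0 ga d)); rewrite -(eval_euler X hl) mulrA -(tau_euler hl).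
apply: (mulfI char2); rewrite mevalD mevalZ mulrDr.
have -> : 2%:R * meval (fun=> X) (lower (P la)) = meval (fun=> X) (lower (P la) *+ 2).
  by rewrite mevalMn mulr_natl.
rewrite (lower_P pl ln e) {1}(expand ga hP dn hg) {3}(expand ga hP dn hg).
rewrite /tau !meval_sum mulr_suml !mulr_sumr -big_split big_seq [RHS]big_seq.
apply: eq_bigr => mu hmu; have [pm sm] := ptnP hmu; rewrite /= !mevalZ.
have [->|c0] := eqVneq (co mu (P la)^`M(ord0)) 0; first by rewrite !mul0r !mulr0 addr0.
have els : sumn la = (sumn mu).+1 by rewrite e sm.
have [i hi] := pieri ga hP pl ln pm els c0.
have [smu _] := andP pm; have [sla _] := andP pl.
have he : e2 a la = e2 a mu + (a * (nth 0%N mu i)%:R - i%:R) *+ 2.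
  by rewrite hi; apply: e2_incr; rewrite -?hi.
have hc : cprod a X la = (X + a * (nth 0%N mu i)%:R - i%:R) * cprod a X mu.
  by rewrite [in LHS]hi cprod_incr.
rewrite he hc (IH mu) //; [|lia|lia]; rewrite /tau -mulr_natl; ring.
Qed.

(** Setting all variables to 1 in column removal compares two evaluations at X = [size la]; the
    quotient of the content products is the first-column part of h. *)
Theorem tau_hookp la : is_part la -> (sumn la <= n)%N -> tau (P la) * hookp a la = 1.
Proof.
have [b] := ubnP (sumn la); elim: b la => // b IH la lb pl ln.
case: (posnP (size la)) => [/size0nil ->|l0]; first by rewrite P_nil /tau meval1 mulr1.
have [sl pl0] := andP pl; have pr := is_part_remcol pl; have sr := sumn_remcol pl0.
have rn : (sumn (remcol la) <= n)%N by lia.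
have := congr1 (meval (fun=> 1)) (column_removal ga hP pl ln).
rewrite mevalM eval_allvars mul1r !eval_res !eval_cprod //.
rewrite cprod_col // /remcol cprod_pos ?sorted_predn // -/(remcol la) => h.
have c0 : cprod a (size la)%:R (map predn la) != 0.
  by apply: cprod_size_neq0; rewrite ?size_map.
have e : tau (P la) * hookcol a la = tau (P (remcol la)).
  by apply: (mulIf c0); rewrite -h; ring.
rewrite hookp_col // -hookp_pos -/(remcol la) mulrCA mulrC e.
by apply: IH => //; lia.
Qed.

Lemma co_kernel X d t : t \in ptn d -> (d <= n)%N ->
  co t (kernel n' a X d) = tau (P t) * cprod a X t / form a (P t) (P t).
Proof.
move=> /ptnP[pt st] dn; rewrite /jcoef formC form_kernel ?eval_cprod ?st //.
by rewrite -st; apply: (mj_hom hP); rewrite ?st.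
Qed.

(** Induction on rows: equating the kernel coefficients at [M :: ka] and [ka], for X = - a M,
    relates the two norms, and [cprod_width_cons] supplies the h'-factors of the first row. *)
Theorem norm_hookp' la : is_part la -> (sumn la <= n)%N ->
  form a (P la) (P la) = tau (P la) * hookp' a la.
Proof.
elim: la => [|M ka IH] pl ln.
  rewrite P_nil /tau meval1 mulr1 -mpolyX0 form_Xm mcoeffX eqxx mul1r.
  by rewrite /zz big1 // => i _; rewrite mnm0E expr0 mul1r.
have [M0 kM pk] := is_part_cons pl.
have [slk _] := andP pl.
have kn : (sumn ka <= n)%N by move: ln => /=; lia.
pose X := - (a * M%:R); set d := sumn ka; pose D := (M + d)%N.
have Dn : (D <= n)%N by [].
(* The coefficient of x_1^M in the kernel of degree D, computed by [cf_kernel_head] and from the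
   expansion in the [P t]; [g] is the difference. *)
pose g := (-1) ^+ M *: kernel n' a X d -
  \sum_(t <- ptn D | head 0%N t == M) co t (kernel n' a X D) *: P (behead t).
have ht t : t \in ptn D -> head 0%N t = M ->
    [/\ t = M :: behead t, is_part t, is_part (behead t) & sumn (behead t) = d].
  case: t => [|x t] /ptnP[p s] /= hM; first by rewrite -hM in M0.
  rewrite -hM in s *; have [_ _ pt] := is_part_cons p; split=> //.
  by move: s => /=; rewrite /D hM => /addnI.
have hkd : hom d (kernel n' a X d) by apply: hom_kernel.
have hk : hom D (kernel n' a X D) by apply: hom_kernel.
have hg : hom d g.
  rewrite /g -scaleN1r; apply: homD; first by apply: homZ; apply: hom_kernel.
  apply: homZ; rewrite big_seq_cond; apply: hom_sum => t /andP[tD /eqP hM]; apply: homZ.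
  by have [_ _ p s1] := ht t tD hM; rewrite -s1; apply: (mj_hom hP) => //; rewrite s1.
have cg s : cf g s = 0.
  rewrite /g cfD -scaleN1r !cfZ mulN1r; apply/eqP; rewrite subr_eq0; apply/eqP.
  have := @cf_kernel_head _ n' a X ga M D M s erefl Dn (leq_addr _ _).
  rewrite binn mulr1 addKn (cf_stab ga hP _ kn hkd).
  rewrite {1}(expand ga hP Dn hk) !cf_sum => <-.
  rewrite [RHS]big_mkcond big_seq [RHS]big_seq; apply: eq_bigr => t tD; rewrite !cfZ.
  have [p st] := ptnP tD.
  (* A first part below M excludes the exponent M, one above M makes the evaluation vanish, and
     equality is row removal. *)
  case: (ltngtP (head 0%N t) M) => hM.
  - rewrite (_ : cf (P t) _ = 0) ?mulr0 //; apply: contraTeq hM => /(mj_max hP p).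
    by rewrite st => /(_ Dn) /= /andP[]; rewrite -leqNgt.
  - rewrite co_kernel // (_ : cprod _ _ t = 0) ?mulr0 ?mul0r //.
    by case: (t) hM => // x t' /= hM; apply: cprod_width_eq0.
  have [e _ _ sb] := ht t tD hM; congr (_ * _).
  by rewrite [in LHS]e (row_removal ga hP) -?e ?st.
have : co ka g = 0.
  apply: (triangular (N := size ka) (b := minsum ka) ga hP kn hg) => //.
  by rewrite mem_ptn pk /=.
have kD : ka \in ptn d by rewrite mem_ptn pk /=.
have lD : M :: ka \in ptn D by rewrite mem_ptn pl /=.
rewrite /g coB coZ [in X in _ - X]co_sum big_mkcond (bigD1_seq (M :: ka)) ?uniq_ptn //= eqxx.
rewrite [in X in _ - X]coZ (co_P ga hP kn kD kD) eqxx mulr1.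
rewrite big_seq_cond big1 ?addr0 => [|t /andP[tD tl]]; last first.
  case: (head 0%N t =P M) => // hM; have [e _ p s] := ht t tD hM.
  rewrite coZ (co_P ga hP kn kD) ?mem_ptn ?p ?s //=.
  by case: eqP => [e'|]; rewrite ?mulr0 //; move: tl; rewrite e e' eqxx.
rewrite !co_kernel // cprod_width_cons // => /eqP; rewrite subr_eq0 => /eqP.
have n0 := norm_neq0 ga hP pk kn; have n1 := norm_neq0 ga hP pl ln.
have h0 := cprod_width_neq0 ga 0 kM; rewrite subr0 in h0.
have t0 : tau (P ka) != 0.
  by apply/eqP => z; have := tau_hookp pk kn; rewrite z mul0r => /esym/eqP; rewrite oner_eq0.
have q0 := hookp'_neq0 ga ka; have s0 : (-1) ^+ M != 0 :> K by rewrite signr_eq0.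
rewrite {1}IH //= -/X.
move: (form a (P (M :: ka)) _) (tau (P ka)) (cprod a X ka) ((-1) ^+ M) (tau (P (M :: ka))) (hookp' a ka)
  (hookrow' a M ka) n1 t0 h0 s0 q0 => F T c s t q r n1 t0 h0 s0 q0 /(congr1 (fun z => z * (F * q))).
have -> : s * (T * c / (T * q)) * (F * q) = s * c * F by field; rewrite t0 q0.
have -> : t * (s * r * c) / F * (F * q) = s * c * (t * (r * q)) by field.
by apply: mulfI; rewrite mulf_neq0.
Qed.

Lemma form_XOn k f : form a ('X_ord0 ^+ k) f = a ^+ k * (k`!)%:R * f@_(U_(ord0) *+ k).
Proof.
rewrite mpolyXn form_Xm mulrC; congr (_ * _).
rewrite /zz (bigD1 ord0) //= big1 ?mulr1 => [|i i0].
  by rewrite mulmnE mnm1E eqxx mul1n mul1r.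
by rewrite mulmnE mnm1E eq_sym (negPf i0) mul0n expr0 mul1r.
Qed.

Lemma tau_coeff d f : hom d f -> tau f = f@_(U_(ord0) *+ d).
Proof.
move=> hf; rewrite /tau mevalE.
have e (m : 'X_{1..n}) : f@_m * (\prod_(i < n) (i == ord0)%:R ^+ m i) =
    if m == (U_(ord0) *+ d)%MM then f@_(U_(ord0) *+ d) else 0.
  have [fm|m0] := eqVneq f@_m 0.
    by rewrite fm mul0r; case: (m =P _) => // <-.
  case: eqP => [->|md].
    rewrite big1 ?mulr1 // => i _; rewrite mulmnE mnm1E.
    by case: (eqVneq i ord0) => _; rewrite ?expr1n // mul0n expr0.
  have [i i0 mi] : exists2 i, i != ord0 & m i != 0%N.
    case: (boolP [exists i, (i != ord0) && (m i != 0%N)]) => [/existsP[i /andP[]]|]; first by exists i.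
    rewrite negb_exists => /forallP h; case: md; apply/mnmP => i.
    have h0 j : j != ord0 -> m j = 0%N by move=> j0; have := h j; rewrite j0 /= negbK => /eqP.
    rewrite mulmnE mnm1E; case: (eqVneq ord0 i) => [<-|i0]; last by rewrite mul0n h0 // eq_sym.
    rewrite mul1n -(hf m m0) /mnmwgt (bigD1 ord0) //= big1 ?addn0 ?muln1 // => j /h0 ->.
    by rewrite mul0n.
  by rewrite (bigD1 i) //= (negPf i0) expr0n (negPf mi) mul0r mulr0.
rewrite (eq_bigr _ (fun m _ => e m)).
case: (boolP ((U_(ord0) *+ d)%MM \in msupp f)) => [h|h].
  by rewrite (bigD1_seq _ h (msupp_uniq f)) /= eqxx big1 ?addr0 // => m /negPf->.
rewrite (memN_msupp_eq0 h) big_seq big1 // => m hm.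
by case: eqP => // _; rewrite (memN_msupp_eq0 h).
Qed.

(** Pairing with p_1^d gives [tau (P t)] up to a^d d!, and this factor cancels against the one in
    the norm. *)
Theorem X0n_expand d : (d <= n)%N ->
  ('X_ord0 : R) ^+ d = (a ^+ d * (d`!)%:R) *: \sum_(t <- ptn d) (hookp' a t)^-1 *: P t.
Proof.
move=> dn; have hd : hom d (('X_ord0 : R) ^+ d).
  rewrite mpolyXn; have := @homXm K n' (U_(ord0) *+ d)%MM; congr (hom _ _).
  rewrite /mnmwgt (bigD1 ord0) //= big1 ?addn0 ?muln1 => [|i i0].
    by rewrite mulmnE mnm1E eqxx mul1n.
  by rewrite mulmnE mnm1E eq_sym (negPf i0) mul0n.
rewrite {1}(expand ga hP dn hd) scaler_sumr big_seq [RHS]big_seq; apply: eq_bigr => t ht.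
have [pt st] := ptnP ht; rewrite scalerA; congr (_ *: _).
have tn : (sumn t <= n)%N by rewrite st.
have hPt := mj_hom hP pt tn; rewrite st in hPt.
rewrite /jcoef form_XOn -(tau_coeff hPt) (norm_hookp' pt tn) invfM -!mulrA; do 2!congr (_ * _).
rewrite mulrA divff ?mul1r //.
by apply/eqP => z; have := tau_hookp pt tn; rewrite z mul0r => /esym/eqP; rewrite oner_eq0.
Qed.

End Evaluation.

(** * Integrality and symmetry of the coefficients *)

Section Palindromic.
Variables (K : fieldType) (a : K).
Implicit Types (z x : K) (d r k : nat).

(** The condition is x^d q(1/x) = (-1)^d q(x), where d need not be the exact degree: it fixes both
    the centre of symmetry and the sign. Multiplication by [a] moves the centre and raises d by 2;
    [a - 1] raises it by 1 and flips the sign. *)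
Definition palindromic d z : Prop := exists q : {poly int},
  [/\ (size q <= d.+1)%N, forall i, (i <= d)%N -> q`_i = (-1) ^+ d * q`_(d - i) &
      z = (map_poly intr q).[a]].

Lemma palindromic0 d : palindromic d 0.
Proof.
exists 0; split; rewrite ?size_poly0 ?rmorph0 ?horner0 // => i _.
by rewrite !coef0 mulr0.
Qed.

Lemma palindromicD d z x : palindromic d z -> palindromic d x -> palindromic d (z + x).
Proof.
case=> p [sp hp ->] [q [sq hq ->]]; exists (p + q); split.
- by rewrite (leq_trans (size_polyD _ _)) // geq_max sp.
- by move=> i id; rewrite !coefD hp // hq // mulrDr.
- by rewrite rmorphD hornerD.
Qed.

Lemma palindromicZ d z (c : int) : palindromic d z -> palindromic d (c%:~R * z).
Proof.
case=> p [sp hp ->]; exists (c *: p); split.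
- exact: leq_trans (size_scale_leq _ _) sp.
- by move=> i id; rewrite !coefZ hp // mulrCA.
- by rewrite map_polyZ hornerZ.
Qed.

Lemma palindromicX d z : palindromic d z -> palindromic d.+2 (a * z).
Proof.
case=> p [sp hp ->]; exists ('X * p); split.
- have [->|p0] := eqVneq p 0; first by rewrite mulr0 size_poly0.
  by rewrite mulrC size_mulX // (leq_ltn_trans sp).
- move=> i id; rewrite !coefXM !exprS mulrA mulN1r opprK mul1r.
  have hd k : (d < k)%N -> p`_k = 0 by move=> dk; rewrite nth_default // (leq_trans sp).
  case: i id => [|i] /= id; first by rewrite hd ?mulr0 //.
  rewrite subn_eq0; case: (leqP d.+2 i.+1) => h.
    by rewrite mulr0 hd //; lia.
  by rewrite hp //; congr (_ * p`_ _); lia.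
- by rewrite rmorphM /= map_polyX hornerM hornerX.
Qed.

Lemma palindromicXB1 d z : palindromic d z -> palindromic d.+1 ((a - 1) * z).
Proof.
case=> p [sp hp ->]; exists (('X - 1) * p); split.
- have [->|p0] := eqVneq p 0; first by rewrite mulr0 size_poly0.
  by rewrite mulrC -polyC1 size_Mmonic ?monicXsubC // size_XsubC addn2 /=.
- move=> i id; rewrite !mulrBl !mul1r !coefB !coefXM exprS mulN1r.
  have hd k : (d < k)%N -> p`_k = 0 by move=> dk; rewrite nth_default // (leq_trans sp).
  case: i id => [|i] /= id.
    by rewrite subn0 (hd d.+1) // subr0 (hp 0%N) // subn0 /= sub0r mulNr.
  rewrite subSS subn_eq0; case: (leqP d i) => h.
    have -> : i = d by lia.
    by rewrite (hd d.+1) // subr0 subnn (hp d) // subnn mulNr sub0r mulrN opprK.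
  rewrite (hp i) // 1?(hp i.+1) //; try lia.
  have -> : (d - i).-1 = (d - i.+1)%N by lia.
  ring.
- by rewrite rmorphM rmorphB /= map_polyX rmorph1 !hornerE.
Qed.

Definition graded r k x : Prop :=
  if (k <= r)%N then exists2 z, palindromic (r - k) z & x = a ^+ k * z else x = 0.

Lemma graded0 r k : graded r k 0.
Proof. by rewrite /graded; case: ifP => // _; exists 0; rewrite ?mulr0 //; apply: palindromic0. Qed.

Lemma gradedD r k x z : graded r k x -> graded r k z -> graded r k (x + z).
Proof.
rewrite /graded; case: ifP => [_ [u hu ->] [v hv ->]|_ -> ->]; last by rewrite addr0.
by exists (u + v); rewrite ?mulrDr //; apply: palindromicD.
Qed.

Lemma gradedZ r k x c : graded r k x -> graded r k (c%:R * x).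
Proof.
rewrite /graded; case: ifP => [_ [u hu ->]|_ ->]; last by rewrite mulr0.
by exists (c%:Z%:~R * u); [apply: palindromicZ | rewrite mulrCA -pmulrn].
Qed.

Lemma graded_fuse r k x : graded r k x -> graded r.+1 k.+1 (a * x).
Proof.
rewrite /graded ltnS subSS; case: ifP => [_ [u hu ->]|_ ->]; last by rewrite mulr0.
by exists u; rewrite // mulrA exprS.
Qed.

Lemma graded_stay r k x : graded r k x -> graded r.+1 k ((a - 1) * x).
Proof.
rewrite {1}/graded; case: leqP => [kr [u hu ->]|_ ->]; last by rewrite mulr0; apply: graded0.
rewrite /graded (leq_trans kr) // subSn //.
by exists ((a - 1) * u); [apply: palindromicXB1 | rewrite mulrCA].
Qed.

(** The rank drops, so one factor [a] passes from the power into the polynomial, whose nominal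
    degree rises by 2 as [palindromicX] allows. *)
Lemma graded_cut r k x : graded r k.+1 x -> graded r.+1 k x.
Proof.
rewrite {1}/graded; case: ltnP => [kr [u hu ->]|_ ->]; last exact: graded0.
rewrite /graded (leq_trans (ltnW kr)) //; exists (a * u); last by rewrite exprSr mulrA.
rewrite (_ : (r.+1 - k)%N = (r - k.+1).+2); [exact: palindromicX | lia].
Qed.

End Palindromic.

Lemma sum_symmetric (V : nmodType) m (F : 'I_m -> 'I_m -> V) :
  (forall i j, F i j = F j i) ->
  \sum_(i < m) \sum_(j < m) F i j =
  (\sum_(i < m) \sum_(j < m | (i < j)%N) F i j) *+ 2 + \sum_(i < m) F i i.
Proof.
move=> hF.
have -> : \sum_(i < m) \sum_(j < m) F i j = \sum_(i < m) (\sum_(j < m | (i < j)%N) F i j +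
   (\sum_(j < m | (j < i)%N) F i j + F i i)).
  apply: eq_bigr => i _; rewrite (bigID (fun j : 'I_m => (i < j)%N)) /=; congr (_ + _).
  rewrite (bigD1 i) ?ltnn //= addrC; congr (_ + _); apply: eq_bigl => j.
  by rewrite -val_eqE /=; lia.
rewrite !big_split /= addrA; congr (_ + _); rewrite mulr2n; congr (_ + _).
rewrite (exchange_big_dep xpredT) //=; apply: eq_bigr => i _; apply: eq_bigr => j _; exact: hF.
Qed.

Section Integrality.
Variables (K : fieldType) (a : K) (n' : nat).
Local Notation n := n'.+1.
Local Notation R := {mpoly K[n]}.
Hypothesis ga : generic a.
Implicit Types (f g : R) (i j : 'I_n) (r c : nat) (m : 'X_{1..n}).

(* The rank of the partition with m i parts equal to i + 1. *)
Definition rk m : nat := \sum_(i < n) m i * i.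

Lemma rkD m m' : rk (m + m') = (rk m + rk m')%N.
Proof. by rewrite /rk -big_split; apply: eq_bigr => i _; rewrite mnmDE mulnDl. Qed.

Lemma rk1 i : rk U_(i)%MM = i.
Proof.
rewrite /rk (bigD1 i) //= big1 => [|j ji]; first by rewrite mnm1E eqxx mul1n addn0.
by rewrite mnm1E eq_sym (negPf ji).
Qed.

Definition integral r f : Prop := forall m, graded a r (rk m) f@_m.

Lemma integralD r f g : integral r f -> integral r g -> integral r (f + g).
Proof. by move=> hf hg m; rewrite mcoeffD; apply: gradedD. Qed.

Lemma integralZ r f c : integral r f -> integral r (c%:R *: f).
Proof. by move=> hf m; rewrite mcoeffZ; apply: gradedZ. Qed.

Lemma integral0 r : integral r 0.
Proof. by move=> m; rewrite mcoeff0; apply: graded0. Qed.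

Lemma integral_sum r (I : Type) (s : seq I) (Q : pred I) (F : I -> R) :
  (forall x, Q x -> integral r (F x)) -> integral r (\sum_(x <- s | Q x) F x).
Proof. by move=> hF; apply: big_ind => //; [apply: integral0 | apply: integralD]. Qed.

Lemma integral_fuse r f i j : integral r f ->
  integral r.+1 (a *: (pp K n' (i + j).+2 * f^`M(i)^`M(j))).
Proof.
move=> hf m; have [le|lt] := leqP (i + j).+2 n; last first.
  by rewrite pp_out // mul0r scaler0 mcoeff0; apply: graded0.
rewrite (pp_ord K (Ordinal le)) mcoeffZ mcoeff_XM; case: posnP => [_|mk].
  by rewrite mulr0; apply: graded0.
set m' := (m - _)%MM; rewrite !mcoeff_deriv.
have -> : rk m = (rk (m' + U_(j) + U_(i))).+1.
  have {1}-> : m = (m' + U_(Ordinal le))%MM by rewrite submK // lep1mP -lt0n.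
  by rewrite !rkD !rk1 /=; lia.
apply: graded_fuse; rewrite -mulrnA -mulr_natl; exact: gradedZ.
Qed.

(** The number of ordered pairs among equal parts is twice a binomial coefficient, which absorbs the
    half. *)
Lemma integral_fuse2 r f i : integral r f ->
  integral r.+1 ((2%:R^-1 * a) *: (pp K n' (i + i).+2 * f^`M(i)^`M(i))).
Proof.
move=> hf m; have [le|lt] := leqP (i + i).+2 n; last first.
  by rewrite pp_out // mul0r scaler0 mcoeff0; apply: graded0.
rewrite (pp_ord K (Ordinal le)) mcoeffZ mcoeff_XM; case: posnP => [_|mk].
  by rewrite mulr0; apply: graded0.
set m' := (m - _)%MM; rewrite !mcoeff_deriv.
have -> : rk m = (rk (m' + U_(i) + U_(i))).+1.
  have {1}-> : m = (m' + U_(Ordinal le))%MM by rewrite submK // lep1mP -lt0n.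
  by rewrite !rkD !rk1 /=; lia.
rewrite -mulrnA mnmDE mnm1E eqxx addn1.
have -> : ((m' i).+2 * (m' i).+1 = 2 * 'C((m' i).+2, 2))%N by rewrite -mul_bin_diag bin1.
rewrite -[f@__ *+ _]mulr_natl natrM -[2%:R * _ * _]mulrA mulrAC mulKf ?(generic_char0 ga 1) //.
by rewrite mulrC; apply: graded_fuse; apply: gradedZ.
Qed.

Lemma integral_cut r f i j : integral r f ->
  integral r.+1 ('X_i * 'X_j * dd (i + j).+2 f).
Proof.
move=> hf m; have [le|lt] := leqP (i + j).+2 n; last first.
  by rewrite dd_out // mulr0 mcoeff0; apply: graded0.
rewrite (dd_ord (Ordinal le)) -mulrA mcoeff_XM; case: posnP => [_|mi]; first exact: graded0.
rewrite mcoeff_XM; case: posnP => [_|mj]; first exact: graded0.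
set m1 := (m - _)%MM in mj *; set m2 := (m1 - _)%MM; rewrite mcoeff_deriv.
apply: graded_cut; rewrite -mulr_natl; apply: gradedZ.
have -> : (rk m).+1 = rk (m2 + U_(Ordinal le)); last exact: hf.
have -> : m = (m1 + U_(i))%MM by rewrite submK // lep1mP -lt0n.
have -> : m1 = (m2 + U_(j))%MM by rewrite submK // lep1mP -lt0n.
by rewrite !rkD !rk1 /=; lia.
Qed.

Lemma integral_stay r f i : integral r f -> integral r.+1 ((a - 1) *: ('X_i * f^`M(i))).
Proof.
by move=> hf m; rewrite mcoeffZ mcoeff_Xderiv; apply: graded_stay; apply: gradedZ.
Qed.

(** Off the diagonal the two orders of a pair absorb the half. On the diagonal, [integral_fuse2]
    serves for joins, the coefficient 2(i + 1) for cuts; in [stay], i(i + 1) is even. *)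
Lemma integral_D2 r f : integral r f -> integral r.+1 (2%:R^-1 *: D2 a f).
Proof.
move=> hf; have h2 : 2%:R != 0 :> K by exact: (generic_char0 ga 1).
have half (g : R) : 2%:R^-1 *: (g *+ 2) = g by rewrite -scaler_nat scalerA mulVf ?scale1r.
rewrite /D2 !scalerDr; apply: integralD; first apply: integralD.
- rewrite /fuse sum_symmetric => [|i j]; last first.
    by rewrite addnC mulnC mderiv_comm.
  rewrite scalerDr half; apply: integralD.
    apply: integral_sum => i _; apply: integral_sum => j _.
    by rewrite mulrC -scalerA; apply: integralZ; apply: integral_fuse.
  rewrite scaler_sumr; apply: integral_sum => i _.
  by rewrite scalerA mulrA mulrC -scalerA; apply: integralZ; apply: integral_fuse2.
- rewrite /cut sum_symmetric => [|i j]; last by rewrite addnC ['X_i * _]mulrC.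
  rewrite scalerDr half; apply: integralD.
    apply: integral_sum => i _; apply: integral_sum => j _.
    by apply: integralZ; apply: integral_cut.
  rewrite scaler_sumr; apply: integral_sum => i _.
  rewrite scalerA (_ : _ * _ = i.+1%:R); first by apply: integralZ; apply: integral_cut.
  by rewrite (_ : (i + i).+2 = 2 * i.+1)%N ?natrM ?mulKf //; lia.
rewrite /stay scaler_sumr; apply: integral_sum => i _.
rewrite scalerA (_ : 2%:R^-1 * _ = ('C(i.+1, 2))%:R * (a - 1)); last first.
  have -> : (i.+1 * i = 2 * 'C(i.+1, 2))%N by rewrite -mul_bin_diag bin1.
  by rewrite natrM [(a - 1) * _]mulrC -mulrA mulKf.
by rewrite -scalerA; apply: integralZ; apply: integral_stay.
Qed.

Lemma integral_XOn k : integral 0 ('X_ord0 ^+ k : R).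
Proof.
move=> m; rewrite mpolyXn mcoeffX; case: eqP => [<-|_]; last exact: graded0.
have -> : rk (U_(ord0) *+ k)%MM = 0%N.
  by elim: k => [|k IH]; rewrite ?mulmS ?rkD ?IH ?rk1 //= /rk big1 // => i _; rewrite mnm0E.
exists 1; last by rewrite mul1r.
exists 1; split; rewrite ?size_poly1 ?rmorph1 ?hornerE // => -[] // _.
by rewrite subnn mul1r.
Qed.

End Integrality.

(** * Jack symmetric functions *)

Lemma generic_alpha : generic alpha.
Proof.
move=> x y h; pose p : {poly rat} := (x%:~R)%:P + (y%:~R)%:P * 'X.
have p0 : p = 0.
  apply/eqP; rewrite -(tofrac_eq0 p) /p rmorphD rmorphM /= -/alpha.
  by rewrite !rmorph_int h.
split.
  have := congr1 (fun q : {poly rat} => q`_0) p0.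
  by rewrite /p coefD coefC coefMX coef0 addr0 => /eqP; rewrite intr_eq0 => /eqP.
have := congr1 (fun q : {poly rat} => q`_1) p0.
by rewrite /p coefD coefC coefMX coefC coef0 add0r => /eqP; rewrite intr_eq0 => /eqP.
Qed.

Lemma sum_geq n i : (\sum_(k < n) (i <= k) = n - i)%N.
Proof.
elim: n => [|m IH]; rewrite ?big_ord0 // big_ord_recr /= IH; case: leqP => /= h; lia.
Qed.

(** * Consequences of the dominance order *)

Section Dominance.
Variable n : nat.
Implicit Types la mu : intpart n.

Local Notation rows la := [seq val i | i <- intpart_val la].

Lemma size_rows la : size (rows la) = n.
Proof. by rewrite size_map size_tuple. Qed.

Lemma sum_part la : (\sum_(i < n) part la i = n)%N.
Proof. by rewrite -[RHS](intpart_sumn la) sumnE (big_nth 0%N) big_mkord size_rows. Qed.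

Lemma minsum_sorted s : sorted geq s -> minsum s = (\sum_(i < size s) i.*2.+1 * nth 0 s i)%N.
Proof.
elim: s => [|x s IH]; first by rewrite /minsum big_nil big_ord0.
rewrite sorted_geqE => /andP[h1 h2]; rewrite minsum_cons_max // big_ord_recl /= IH // mul1n.
rewrite [sumn s]sumnE (big_nth 0%N) big_mkord -addnA; congr (_ + _)%N.
rewrite -muln2 big_distrl -big_split; apply: eq_bigr => i _ /=.
by rewrite mulnC -mulnDl /bump; congr (_ * _)%N; lia.
Qed.

(** Row i has weight 2i + 1 in [minsum] and occurs in n - i partial sums, and (2i + 1) + 2(n - i) is
    constant. Larger partial sums thus mean smaller [minsum]. *)
Lemma minsum_part la :
  (minsum (parts la) + (\sum_(k < n) \sum_(i < k.+1) part la i).*2 = n + (n * n).*2)%N.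
Proof.
rewrite partsE minsum_pos minsum_sorted ?intpart_sorted // size_rows.
have -> : (\sum_(k < n) \sum_(i < k.+1) part la i = \sum_(i < n) (n - i) * part la i)%N.
  rewrite (eq_bigr (fun k : 'I_n => \sum_(i < n) (i <= k) * part la i)%N) => [|k _]; last first.
    rewrite (big_ord_widen n (part la)) // big_mkcond; apply: eq_bigr => i _ /=.
    by rewrite ltnS; case: leqP; rewrite ?mul1n ?mul0n.
  rewrite exchange_big; apply: eq_bigr => i _ /=; rewrite -big_distrl /=; congr (_ * _)%N.
  exact: sum_geq.
rewrite -muln2 big_distrl -big_split /=.
rewrite (eq_bigr (fun i : 'I_n => (n.*2.+1 * part la i)%N)) => [|i _]; last first.
  by rewrite mulnAC -mulnDl; congr (_ * _)%N; have := ltn_ord i; lia.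
rewrite -big_distrr /= sum_part; lia.
Qed.

Lemma dom_lt_minsum mu la : dom_lt mu la -> (minsum (parts la) < minsum (parts mu))%N.
Proof.
case/andP=> ml /forallP dom.
have le (k : 'I_n) : (\sum_(i < k.+1) part mu i <= \sum_(i < k.+1) part la i)%N.
  have kn : (k.+1 < n.+1)%N by rewrite ltnS ltn_ord.
  exact: (dom (Ordinal kn)).
have := minsum_part mu; have := minsum_part la.
have : (\sum_(k < n) \sum_(i < k.+1) part mu i < \sum_(k < n) \sum_(i < k.+1) part la i)%N; last lia.
rewrite ltn_neqAle; apply/andP; split; last by apply: leq_sum => k _; apply: le.
apply: contraNneq ml => e; apply/eqP/parts_inj.
have eqS (k : 'I_n) : (\sum_(i < k.+1) part mu i = \sum_(i < k.+1) part la i)%N.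
  apply/eqP; rewrite eqn_leq le /= leqNgt; apply/negP => lt.
  have : (\sum_(k < n) \sum_(i < k.+1) part mu i < \sum_(k < n) \sum_(i < k.+1) part la i)%N.
    rewrite (bigD1 k) //= [X in (_ < X)%N](bigD1 k) //= -addSn leq_add //.
    by apply: leq_sum => i _; apply: le.
  by rewrite e ltnn.
have eqp i : (i < n)%N -> part mu i = part la i.
  move=> hi; have := eqS (Ordinal hi); rewrite /= !big_ord_recr /=.
  case: i hi => [|i] hi; first by rewrite !big_ord0.
  by rewrite (eqS (Ordinal (ltnW hi))) => /addnI.
rewrite !partsE; congr pos; apply: (@eq_from_nth _ 0%N); rewrite !size_rows //.
Qed.

(** At k = [size (parts mu)] the partial sum of [mu] has reached n, whereas that of a longer [la]
    has not. *)
Lemma dom_lt_size mu la : dom_lt mu la -> (size (parts la) <= size (parts mu))%N.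
Proof.
case/andP=> _ /forallP dom; rewrite leqNgt; apply/negP => lt.
have sn : (size (parts mu) < n.+1)%N.
  rewrite ltnS; apply: leq_trans (ltnW lt) _.
  by have /andP[_ /size_part_sumn] := is_part_parts la; rewrite sumn_parts.
have := dom (Ordinal sn) => /=; apply/negP; rewrite -ltnNge.
have sumE (nu : intpart n) k : (size (parts nu) <= k)%N -> (\sum_(i < k) part nu i = n)%N.
  move=> h; rewrite -[RHS](sumn_parts nu) sumnE (big_nth 0%N) big_mkord.
  rewrite (big_ord_widen k (fun i => nth 0 (parts nu) i)%N) // [RHS]big_mkcond.
  by apply: eq_bigr => i _; rewrite part_parts; case: ltnP => // hi; rewrite nth_default.
have h1 := sumE mu _ (leqnn _); have := sumE la _ (leqnn _); rewrite h1.
rewrite -(big_mkord xpredT (part la)) (big_cat_nat (n := size (parts mu))) ?(ltnW lt) //=.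
rewrite big_mkord (big_ltn lt) part_parts.
have /andP[_ /allP hp] := is_part_parts la.
have := hp _ (mem_nth 0%N lt).
move: (\sum_(i < _) part la i)%N (nth _ _ _) (\sum_(_ <= i < _) _)%N => A B C; lia.
Qed.

Lemma dom_lt_max mu la : dom_lt mu la ->
  all (fun x => x <= head 0 (parts la))%N (parts mu).
Proof.
case/andP=> _ /forallP dom; apply/allP => x xm.
have n0 : (0 < n)%N.
  rewrite -(sumn_parts mu) lt0n; apply: contraTneq xm => e.
  have /andP[_ hp] := is_part_parts mu; have := size_part_sumn hp.
  by rewrite e leqn0 => /nilP ->.
have := dom (Ordinal (n0 : (1 < n.+1)%N)); rewrite /= !big_ord_recl !big_ord0 !addn0 /=.
rewrite !part_parts -!nth0; apply: leq_trans.
case e : (parts mu) xm => [//|y s]; rewrite /= inE => /orP[/eqP-> //|xs].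
have /andP[] := is_part_parts mu; rewrite e sorted_geqE => /andP[/allP h _] _.
exact: h.
Qed.

End Dominance.

Lemma hookp_rows (K : fieldType) (a : K) s :
  hookp a s = \prod_(i < size s) \prod_(j < nth 0%N s i)
    (a * (nth 0 s i - j.+1)%N%:R + (count (fun y => j < y)%N (drop i.+1 s))%:R + 1).
Proof.
elim: s => [|x s IH]; first by rewrite big_ord0.
by rewrite big_ord_recl /= drop0 IH.
Qed.

Lemma hookp'_rows (K : fieldType) (a : K) s :
  hookp' a s = \prod_(i < size s) \prod_(j < nth 0%N s i)
    (a * (1 + (nth 0 s i - j.+1)%N%:R) + (count (fun y => j < y)%N (drop i.+1 s))%:R).
Proof.
elim: s => [|x s IH]; first by rewrite big_ord0.
by rewrite big_ord_recl /= drop0 IH.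
Qed.

Lemma hookp'_pos (K : fieldType) (a : K) s : hookp' a (pos s) = hookp' a s.
Proof.
elim: s => //= x s IH; case: ltnP => x0 /=; rewrite IH.
  congr (_ * _); apply: eq_bigr => j _; rewrite count_filter.
  congr (_ + _%:R); apply: eq_count => y /=; case: (ltnP j y) => //= h; by rewrite (leq_ltn_trans _ h).
by move: x0; rewrite leqn0 => /eqP->; rewrite /hookrow' big_ord0 mul1r.
Qed.

Section HookProducts.
Variable n : nat.
Implicit Types la : intpart n.
Local Notation rows la := [seq val i | i <- intpart_val la].

Lemma legE la (i : 'I_n) j :
  leg la i j = count (fun y => j < y)%N (drop i.+1 (rows la)).
Proof.
rewrite /leg cardsE -sum1_card big_mkcond -sum1_count.
have -> : drop i.+1 (rows la) = [seq part la k | k <- iota i.+1 (n - i.+1)].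
  apply: (@eq_from_nth _ 0%N); rewrite size_drop size_rows ?size_map ?size_iota //.
  move=> k hk; rewrite nth_drop (nth_map 0%N) ?size_iota // nth_iota //.
rewrite big_map [RHS]big_mkcond -/(index_iota i.+1 n).
rewrite (eq_bigr (fun k : 'I_n => (if (i < k)%N && (j < part la k)%N then 1 else 0)%N)) //.
rewrite -(big_mkord xpredT (fun k => (if (i < k)%N && (j < part la k)%N then 1 else 0)%N)).
rewrite (big_cat_nat (n := i.+1)) //= big_nat big1 ?add0n => [|k /andP[_ ki]]; last first.
  by rewrite ltnNge -ltnS ki.
by apply: eq_big_nat => k /andP[ik _]; rewrite ik.
Qed.

Lemma hookE la : hook la = hookp alpha (parts la).
Proof.
rewrite partsE hookp_pos hookp_rows size_rows; apply: eq_bigr => i _.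
by apply: eq_bigr => j _; rewrite legE.
Qed.

Lemma hook'E la : hook' la = hookp' alpha (parts la).
Proof.
rewrite partsE hookp'_pos hookp'_rows size_rows; apply: eq_bigr => i _.
by apply: eq_bigr => j _; rewrite legE.
Qed.

End HookProducts.

(** * From coordinates on power sums to polynomials *)

Section Embedding.
Variables (n' : nat).
Local Notation n := n'.+1.
Local Notation R := {mpoly Qalpha[n]}.
Implicit Types (f g : R) (t : seq nat).

Definition expo t : 'X_{1..n} := [multinom count_mem i.+1 t | i < n].

Lemma expo_cons k t (kn : (k < n)%N) : expo (k.+1 :: t) = (U_(Ordinal kn) + expo t)%MM.
Proof. by apply/mnmP => i; rewrite mnmDE !mnmE /= eqSS. Qed.

Lemma expo_nil : expo [::] = 0%MM.
Proof. by apply/mnmP => i; rewrite !mnmE. Qed.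

Lemma expo_prod t : all (fun k => 0 < k <= n)%N t -> 'X_[expo t] = \prod_(k <- t) pp Qalpha n' k.
Proof.
elim: t => [|[|k] t IH] //=; first by rewrite big_nil expo_nil mpolyX0.
by case/andP => kn /IH e; rewrite big_cons -e (expo_cons _ kn) mpolyXD (pp_ord _ (Ordinal kn)).
Qed.

Lemma wgt_expo t : all (fun k => 0 < k <= n)%N t -> mnmwgt (expo t) = sumn t.
Proof.
elim: t => [|[|k] t IH] //=; first by rewrite expo_nil mnmwgt0.
by case/andP => kn /IH e; rewrite (expo_cons _ kn) mnmwgtD mnmwgt1 e.
Qed.

Lemma deg_expo t : all (fun k => 0 < k <= n)%N t -> mdeg (expo t) = size t.
Proof.
elim: t => [|[|k] t IH] //=; first by rewrite expo_nil mdeg0.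
by case/andP => kn /IH e; rewrite (expo_cons _ kn) mdegD mdeg1 e.
Qed.

Lemma expo_inj s t : all (fun k => 0 < k <= n)%N s -> all (fun k => 0 < k <= n)%N t ->
  expo s = expo t -> perm_eq s t.
Proof.
move=> hs ht e; apply/allP => k; rewrite mem_cat => /orP hk.
have : (0 < k <= n)%N by case: hk => [/(allP hs)|/(allP ht)].
case: k {hk} => // k kn; apply/eqP.
have := congr1 (fun m : 'X_{1..n} => m (Ordinal kn)) e; by rewrite !mnmE.
Qed.

Lemma parts_bound d (la : intpart d) : (d <= n)%N -> all (fun k => 0 < k <= n)%N (parts la).
Proof.
move=> dn; have /andP[_ /allP h] := is_part_parts la; apply/allP => k kla.
rewrite h //= (leq_trans _ dn) // -[X in (_ <= X)%N](sumn_parts la).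
by elim: (parts la) kla => //= y s IH; rewrite inE => /orP[/eqP->|/IH]; lia.
Qed.

Lemma expo_surj d (m : 'X_{1..n}) : mnmwgt m = d -> exists la : intpart d, expo (parts la) = m.
Proof.
move=> wm; pose t0 := flatten [seq nseq (m i) i.+1 | i : 'I_n].
have cm (i : 'I_n) : count_mem i.+1 t0 = m i.
  rewrite count_flatten -map_comp sumnE big_map big_enum (bigD1 i) //= big1 => [|j ji].
    by rewrite count_nseq /= eqxx mul1n addn0.
  by rewrite count_nseq /= eqSS; case: eqP => // e; case/eqP: ji; apply/val_inj.
have pt0 : all (fun x => 0 < x)%N t0.
  by apply/allP => x /flattenP[s /mapP[i _ ->]] /nseqP[->].
have st : sumn t0 = d.
  rewrite -wm sumnE big_flatten big_map big_enum; apply: eq_bigr => i _.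
  by rewrite big_nseq iter_addn_0 mulnC.
have pe : perm_eq (sort geq t0) t0 by rewrite perm_sort.
have pt : is_part (sort geq t0).
  rewrite /is_part (perm_all _ pe) pt0 andbT.
  by apply: sort_sorted => x y; apply: leq_total.
have [|la e] := @parts_surj d _ pt; first by rewrite (perm_sumn pe).
exists la; apply/mnmP => i; rewrite mnmE e -cm.
exact/permP.
Qed.

Lemma expo_parts_inj d (la mu : intpart d) : (d <= n)%N ->
  (expo (parts la) == expo (parts mu)) = (la == mu).
Proof.
move=> dn; apply/eqP/eqP => [|-> //] /expo_inj h; apply/parts_inj.
by apply: part_perm_eq; rewrite ?is_part_parts // h ?parts_bound.
Qed.

Definition emb d (F : symfun d) : R := \sum_la F la *: 'X_[expo (parts la)].

Lemma mcoeff_emb d (F : symfun d) la : (d <= n)%N -> (emb F)@_(expo (parts la)) = F la.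
Proof.
move=> dn; rewrite /emb mcoeff_sum (bigD1 la) //= big1 => [|mu ml].
  by rewrite mcoeffZ mcoeffX eqxx mulr1 addr0.
by rewrite mcoeffZ mcoeffX expo_parts_inj // (negPf ml) mulr0.
Qed.

Lemma hom_emb d (F : symfun d) : (d <= n)%N -> hom d (emb F).
Proof.
move=> dn; apply: hom_sum => la _; apply: homZ.
by have := @homXm Qalpha n' (expo (parts la)); rewrite wgt_expo ?parts_bound // sumn_parts.
Qed.

Lemma emb_surj d f : (d <= n)%N -> hom d f -> exists F : symfun d, f = emb F.
Proof.
move=> dn hf; exists [ffun la => f@_(expo (parts la))]; apply/mpolyP => m.
have [wm|wm] := eqVneq (mnmwgt m) d.
  by have [la <-] := expo_surj wm; rewrite mcoeff_emb // ffunE.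
have h0 g : hom d g -> g@_m = 0.
  by move=> hg; apply: contraNeq wm => /hg ->.
by rewrite (h0 _ hf) (h0 _ (hom_emb dn)).
Qed.

Lemma res_emb N d (F : symfun d) : (d <= n)%N -> res N (emb F) = restr N F.
Proof.
move=> dn; rewrite /emb /restr raddf_sum; apply: eq_bigr => la _.
rewrite /= resZ expo_prod ?parts_bound // rmorph_prod; congr (_ *: _).
rewrite /powersum_part !big_seq; apply: eq_bigr => k kla.
have /allP/(_ k kla) := parts_bound la dn; case: k {kla} => // k kn.
by rewrite (pp_ord _ (Ordinal kn)) /= resX.
Qed.

Lemma zz_expo d (la : intpart d) : (d <= n)%N ->
  zz alpha (expo (parts la)) = alpha ^+ ell la * (zee la)%:R.
Proof.
move=> dn; rewrite -[ell la](deg_expo (parts_bound la dn)) mdegE /zee -prodrXr.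
rewrite natr_prod /zz; pose F k : Qalpha := ((k ^ mult la k) * (mult la k)`!)%N%:R.
have -> : \prod_(1 <= k < d.+1) F k = \prod_(i < n) F i.+1.
  rewrite -(big_mkord xpredT (fun i => F i.+1)) big_add1 /=.
  rewrite [RHS](big_cat_nat (n := d)) //= [X in _ * X]big_nat [X in _ * X]big1 ?mulr1 // => k /andP[dk _].
  rewrite /F (_ : mult la k.+1 = 0%N) //; apply/count_memPn/negP => kla.
  have : (k.+1 <= sumn (parts la))%N.
    by elim: (parts la) kla => //= y s IH; rewrite inE => /orP[/eqP->|/IH]; lia.
  by rewrite sumn_parts ltnNge dk.
rewrite -big_split; apply: eq_bigr => i _ /=; rewrite mnmE /F /mult exprMn natrM natrX; ring.
Qed.

Lemma form_emb d (F G : symfun d) : (d <= n)%N -> form alpha (emb F) (emb G) = sprod F G.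
Proof.
move=> dn; rewrite {1}/emb form_suml; apply: eq_bigr => la _.
by rewrite formZl form_Xm mcoeff_emb // zz_expo //; apply: mulrA.
Qed.

Lemma emb_linear_sum d (I : finType) (c : I -> Qalpha) (F : I -> symfun d) (G : symfun d) :
  (forall la, G la = \sum_x c x * F x la) -> emb G = \sum_x c x *: emb (F x).
Proof.
move=> h; rewrite /emb; under [RHS]eq_bigr => x _ do rewrite scaler_sumr.
rewrite exchange_big; apply: eq_bigr => la _ /=; rewrite h scaler_suml.
by apply: eq_bigr => x _; rewrite scalerA.
Qed.

Lemma mcoeff_monomial_part N d (mu : intpart d) (m : 'X_{1..N}) :
  (monomial_part N mu)@_m = (perm_eq (pos m) (parts mu))%:R.
Proof.
rewrite /monomial_part mcoeff_sum; under eq_bigr => k _ do rewrite mcoeffX.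
case: (boolP (perm_eq _ _)) => [h|h]; last first.
  by rewrite big1 // => k hk; case: eqP => // km; case/negP: h; rewrite -km.
have lt : (mdeg m < d.+1)%N.
  rewrite /mdeg -sumnE -sumn_pos (perm_sumn h) sumn_parts //.
rewrite (bigD1 (BMultinom lt)) //= eqxx big1 ?addr0 // => k /andP[_ nk].
by rewrite bmeqP /= in nk; rewrite (negPf nk).
Qed.

(** * A Jack family yields a [monic_jack] family *)

Section FromJack.
Variable J : forall d, intpart d -> symfun d.
Hypothesis hJ : is_jack J.

Lemma seq_mseq N (s : seq nat) : size s = N -> (mseq N s : seq nat) = s.
Proof.
move=> sN; apply: (@eq_from_nth _ 0%N); rewrite size_tuple // => i iN.
by rewrite -(mnm_nth 0%N _ (Ordinal iN)) mnmE.
Qed.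

Lemma cf_jack d (la : intpart d) : (d <= n)%N -> exists u : intpart d -> Qalpha,
  forall s, cf (emb (J la)) s = hook la * (perm_eq (pos s) (parts la))%:R +
    \sum_(mu | dom_lt mu la) u mu * (perm_eq (pos s) (parts mu))%:R.
Proof.
move=> dn; have [u hu] := hJ.2 d la; exists u => s.
rewrite /cf res_emb // hu mcoeffD mcoeffZ mcoeff_monomial_part seq_mseq // mcoeff_sum.
congr (_ + _); apply: eq_bigr => mu _; by rewrite mcoeffZ mcoeff_monomial_part seq_mseq.
Qed.

(** At most one term, as [parts] is injective: the sum converts a family indexed by [intpart d] into
    one indexed by plain sequences. *)
Definition monicJ_deg d t : R :=
  \sum_(la : intpart d | parts la == t) (hook la)^-1 *: emb (J la).

Definition monicJ t : R := monicJ_deg (sumn t) t.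

Lemma monicJ_parts d (la : intpart d) : monicJ (parts la) = (hook la)^-1 *: emb (J la).
Proof.
rewrite /monicJ sumn_parts /monicJ_deg (big_pred1 la) // => mu.
by apply/eqP/eqP => [/parts_inj|->].
Qed.

Lemma hook_neq0 d (la : intpart d) : hook la != 0.
Proof. by rewrite hookE; apply: hookp_neq0 generic_alpha _. Qed.

Lemma part_ind (Q : seq nat -> Prop) :
  (forall d (la : intpart d), (d <= n)%N -> Q (parts la)) ->
  forall t, is_part t -> (sumn t <= n)%N -> Q t.
Proof. by move=> h t pt tn; have [la <-] := parts_surj pt erefl; apply: h. Qed.

Lemma cf_monicJ d (la : intpart d) : (d <= n)%N -> exists u : intpart d -> Qalpha,
  forall s, cf (monicJ (parts la)) s = (perm_eq (pos s) (parts la))%:R +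
    \sum_(mu | dom_lt mu la) u mu * (perm_eq (pos s) (parts mu))%:R.
Proof.
move=> dn; have [u hu] := cf_jack la dn; exists (fun mu => (hook la)^-1 * u mu) => s.
rewrite monicJ_parts cfZ hu mulrDr mulKf ?hook_neq0 // mulr_sumr; congr (_ + _).
by apply: eq_bigr => mu _; rewrite mulrA.
Qed.

Lemma cf_monicJ_supp d (la : intpart d) s : (d <= n)%N -> cf (monicJ (parts la)) s != 0 ->
  perm_eq (pos s) (parts la) \/ exists2 mu, dom_lt mu la & perm_eq (pos s) (parts mu).
Proof.
move=> dn; have [u ->] := cf_monicJ la dn; case: (boolP (perm_eq _ _)) => h; first by left.
rewrite add0r => hs; right.
case: (boolP [exists mu : intpart d, dom_lt mu la && perm_eq (pos s) (parts mu)]) => [/existsP[mu /andP[]]|].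
  by exists mu.
rewrite negb_exists => /forallP hn; case/eqP: hs; apply: big1 => mu hmu.
by have := hn mu; rewrite hmu /= => /negPf->; rewrite mulr0.
Qed.

Lemma cf_monicJ_lead d (la : intpart d) s : (d <= n)%N -> perm_eq (pos s) (parts la) ->
  cf (monicJ (parts la)) s = 1.
Proof.
move=> dn hs; have [u ->] := cf_monicJ la dn; rewrite hs big1 ?addr0 // => mu /andP[ml _].
rewrite (_ : perm_eq _ _ = false) ?mulr0 //; apply: contraNF ml => h.
apply/eqP/parts_inj/part_perm_eq; rewrite ?is_part_parts //.
by rewrite perm_sym; apply: perm_trans h; rewrite perm_sym.
Qed.

(** An extra variable with exponent 0 changes nothing because the [u] of [is_jack] is common to all
    numbers of variables. *)
Lemma cf_monicJ_stab d (la : intpart d) s : (d <= n)%N ->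
  cf (monicJ (parts la)) (0%N :: s) = cf (monicJ (parts la)) s.
Proof. by move=> dn; have [u hu] := cf_monicJ la dn; rewrite !hu. Qed.

Lemma orth_monicJ d (la mu : intpart d) : (d <= n)%N -> la != mu ->
  form alpha (monicJ (parts la)) (monicJ (parts mu)) = 0.
Proof.
move=> dn lm; rewrite !monicJ_parts formZl formZr form_emb // (hJ.1 _ _ _ lm).
by rewrite !mulr0.
Qed.

Lemma monicJ_free d (c : intpart d -> Qalpha) : (d <= n)%N ->
  \sum_la c la *: monicJ (parts la) = 0 -> forall la, c la = 0.
Proof.
move=> dn e la; have [b] := ubnP (minsum (parts la)); elim: b la => // b IH la lb.
have := congr1 (fun f => cf f (parts la)) e; rewrite cf_sum cf0 (bigD1 la) //= big1 => [|mu ml].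
  by rewrite cfZ cf_monicJ_lead // ?pos_id ?is_part_parts // mulr1 addr0.
rewrite cfZ; have [->|h] := eqVneq (cf (monicJ (parts mu)) (parts la)) 0; first by rewrite mulr0.
have := cf_monicJ_supp dn h; rewrite pos_id ?is_part_parts // => -[hp|[nu hnu hp]].
  by case/eqP: ml; apply/parts_inj/part_perm_eq; rewrite ?is_part_parts // perm_sym.
rewrite ltnS in lb; rewrite IH ?mul0r //; apply: leq_trans lb.
by rewrite (minsum_perm hp); apply: dom_lt_minsum.
Qed.

(** The coordinates on power sums form a square matrix indexed by the partitions of d; [monicJ_free]
    makes it invertible. *)
Lemma monicJ_basis d f : (d <= n)%N -> hom d f ->
  exists c, f = \sum_(t <- ptn d) c t *: monicJ t.
Proof.
move=> dn hf; have [F ->] := emb_surj dn hf.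
pose m := #|{: intpart d}|.
pose A : 'M[Qalpha]_m := \matrix_(i, j) ((hook (enum_val i))^-1 * J (enum_val i) (enum_val j)).
have lin (v : 'rV[Qalpha]_m) (G : symfun d) : (forall la, G la = (v *m A) 0 (enum_rank la)) ->
    emb G = \sum_(la : intpart d) v 0 (enum_rank la) *: monicJ (parts la).
  move=> hG; under eq_bigr => la _ do rewrite monicJ_parts scalerA.
  apply: emb_linear_sum => la; rewrite hG mxE (reindex _ (onW_bij _ (@enum_rank_bij _))) /=.
  by apply: eq_bigr => mu _; rewrite mxE !enum_rankK mulrA.
have Afree : row_free A.
  apply: inj_row_free => v vA.
  pose G0 : symfun d := [ffun=> 0].
  have e0 : emb G0 = 0 by rewrite /emb; apply: big1 => la _; rewrite ffunE scale0r.
  have hG0 la : G0 la = (v *m A) 0 (enum_rank la) by rewrite vA ffunE mxE.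
  have h := lin v G0 hG0; rewrite e0 in h.
  apply/rowP => j; rewrite [RHS]mxE -[j]enum_valK.
  exact: (monicJ_free (c := fun la => v 0 (enum_rank la)) dn (esym h)).
pose w : 'rV[Qalpha]_m := \row_j F (enum_val j).
exists (fun t => \sum_(la | parts la == t) (w *m invmx A) 0 (enum_rank la)).
rewrite (lin (w *m invmx A) F) => [|la]; last first.
  by rewrite mulmxKV ?row_free_unit -?row_free_unit // mxE enum_rankK.
rewrite big_ptn; apply: eq_bigr => la _; congr (_ *: _).
by rewrite (big_pred1 la) // => mu; apply/eqP/eqP => [/parts_inj|->].
Qed.

Theorem monicJ_monic : monic_jack alpha monicJ.
Proof.
split.
- apply: part_ind => d la dn; rewrite sumn_parts monicJ_parts => m.
  by apply: homZ; apply: hom_emb.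
- move=> t s pt tn; move: t pt tn; apply: part_ind => d la dn; exact: cf_monicJ_lead.
- move=> t s pt tn; move: t pt tn; apply: part_ind => d la dn /(cf_monicJ_supp dn)[|[mu hmu hp]].
    by left.
  by right; rewrite -(minsum_pos s) (minsum_perm hp); apply: dom_lt_minsum.
- move=> t s pt tn; move: t pt tn; apply: part_ind => d la dn /(cf_monicJ_supp dn)[hp|[mu hmu hp]].
    by rewrite (perm_size hp).
  by rewrite (perm_size hp); apply: dom_lt_size.
- move=> t s pt tn; move: t pt tn; apply: part_ind => d la dn /(cf_monicJ_supp dn) h.
  suff : all (fun x => x <= head 0 (parts la))%N (pos s).
    by rewrite all_filter; apply: sub_all => -[].
  case: h => [hp|[mu hmu hp]]; rewrite (perm_all _ hp); last exact: dom_lt_max.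
  apply/allP => x; have /andP[] := is_part_parts la.
  case: (parts la) => //= y u; rewrite -/(sorted geq (y :: u)) sorted_geqE => /andP[/allP h _] _.
  by rewrite inE => /orP[/eqP->|/h].
- move=> t s pt tn; move: t pt tn; apply: part_ind => d la dn; exact: cf_monicJ_stab.
- move=> s t ps pt st; have [la <-] := parts_surj pt erefl; have [mu <-] := parts_surj ps st.
  rewrite sumn_parts => dn h; apply: orth_monicJ => //; by apply: contraNneq h => ->.
exact: monicJ_basis.
Qed.

End FromJack.
End Embedding.

(** * Jack characters and the coefficients a^r *)

Section Characters.
Variable J : forall d, intpart d -> symfun d.
Hypothesis hJ : is_jack J.
Variable n' : nat.
Local Notation n := n'.+1.
Local Notation R := {mpoly Qalpha[n]}.
Implicit Types (la be : intpart n).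

Let hP := @monicJ_monic n' J hJ.

Lemma emb_jack be : emb n' (J be) = hook be *: monicJ n' J (parts be).
Proof. by rewrite monicJ_parts scalerA divff ?scale1r ?hook_neq0. Qed.

Lemma parts_le be : is_part (parts be) /\ (sumn (parts be) <= n)%N.
Proof. by rewrite is_part_parts sumn_parts. Qed.

Lemma tau_jack be : tau (emb n' (J be)) = 1.
Proof.
have [pb sb] := parts_le be.
by rewrite emb_jack /tau mevalZ mulrC hookE; apply: (tau_hookp generic_alpha hP).
Qed.

Lemma D2_jack be : D2 alpha (emb n' (J be)) = e2 alpha (parts be) *: emb n' (J be).
Proof.
have [pb sb] := parts_le be.
by rewrite emb_jack linearZ /= (D2_P generic_alpha hP) // scalerA mulrC scalerA.
Qed.

Lemma jack_char_rho be : jack_char_seq J be (rho n) = 2%:R^-1 * e2 alpha (parts be).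
Proof.
have h2 : 2%:R != 0 :> Qalpha by apply: (generic_char0 generic_alpha 1).
have h := tau_D2 alpha (emb n' (J be)).
rewrite D2_jack {1}/tau mevalZ -/(tau _) tau_jack mulr1 in h.
rewrite h -[tau _ *+ 2]mulr_natl mulKf // /jack_char_seq; case: pickP => [mu /eqP hmu|hno].
  have n1 : (1 < n)%N by rewrite -(sumn_parts mu) hmu.
  rewrite (dd_ord (Ordinal n1)).
  have hf := hom_deriv (i := Ordinal n1) (hom_emb (F := J be) (leqnn n)).
  rewrite (tau_coeff hf) mcoeff_deriv /jack_char -(@mcoeff_emb n' _ (J be) mu (leqnn n)) hmu.
  rewrite mulmnE mnm1E mulr1n; congr (_ @_ _); apply/mnmP => i.
  rewrite mnmDE mulmnE !mnm1E mnmE /= count_nseq -!val_eqE /= !eqSS.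
  by rewrite addnC.
have : (n < 2)%N.
  rewrite ltnNge; apply/negP => n2; have [||mu hmu] := @parts_surj n (rho n).
  - by rewrite /is_part /rho /= all_nseq orbT andbT; case: (n - 2)%N => //= m; elim: m.
  - by rewrite /rho /= sumn_nseq mul1n subnKC.
  by have := hno mu; rewrite hmu eqxx.
(* For n = 1 there is no p_2: the derivative and the character are both 0 by convention. *)
by move=> n1; rewrite dd_out // /tau meval0.
Qed.

Definition halfD2 (f : R) : R := 2%:R^-1 *: D2 alpha f.

Lemma iter_jack r be :
  iter r halfD2 (emb n' (J be)) = jack_char_seq J be (rho n) ^+ r *: emb n' (J be).
Proof.
elim: r => [|r IH]; first by rewrite expr0 scale1r.
by rewrite iterS IH /halfD2 linearZ /= D2_jack !scalerA exprSr jack_char_rho -mulrA mulrCA.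
Qed.

Lemma iter_sum r (I : finType) (c : I -> Qalpha) (F : I -> R) :
  iter r halfD2 (\sum_i c i *: F i) = \sum_i c i *: iter r halfD2 (F i).
Proof.
elim: r => // r IH; rewrite iterS IH /halfD2 linear_sum scaler_sumr.
by apply: eq_bigr => i _; rewrite linearZ /= scalerA mulrC -scalerA.
Qed.

Lemma jack_expand :
  \sum_(be : intpart n) (hook be * hook' be)^-1 *: emb n' (J be) =
    (alpha ^+ n * n`!%:R)^-1 *: 'X_ord0 ^+ n.
Proof.
have nz : alpha ^+ n * n`!%:R != 0.
  apply: mulf_neq0; first exact: expf_neq0 (generic_neq0 generic_alpha).
  by rewrite -(prednK (fact_gt0 n)); apply: generic_char0 generic_alpha _.
rewrite (X0n_expand generic_alpha hP (leqnn n)) scalerA mulVf // scale1r big_ptn.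
apply: eq_bigr => be _; rewrite emb_jack scalerA invfM -mulrA mulrCA mulVf ?hook_neq0 //.
by rewrite mulr1 hook'E.
Qed.

Lemma rk_expo la : rk (expo n' (parts la)) = rank la.
Proof.
have pb := parts_bound la (leqnn n); set m := expo _ _.
have w : mnmwgt m = n by rewrite wgt_expo ?sumn_parts.
rewrite /rank (_ : ell la = mdeg m); last by rewrite deg_expo.
suff e : mnmwgt m = (mdeg m + rk m)%N by rewrite -[X in (X - _)%N]w e addKn.
by rewrite mdegE -big_split; apply: eq_bigr => i _; rewrite mulnS.
Qed.

Lemma ell_le la : (ell la <= n)%N.
Proof.
have := parts_le la => -[/andP[_ h] s]; apply: leq_trans s; rewrite /ell.
by elim: (parts la) h => //= x t IH /andP[x0 /IH]; lia.
Qed.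

Lemma acoef_integral la r : (rank la <= r)%N ->
  exists2 z, palindromic alpha (r - rank la) z &
    acoef J la r = (n`!%:R)^-1 * (alpha ^- ell la * z).
Proof.
move=> hr; have hi : integral alpha r (iter r halfD2 ('X_ord0 ^+ n : R)).
  by elim: (r) => [|k IH]; [apply: integral_XOn | rewrite iterS; apply: integral_D2 IH; apply: generic_alpha].
have := hi (expo n' (parts la)); rewrite /graded rk_expo hr => -[z hz e]; exists z => //.
have a0 := generic_neq0 generic_alpha.
have -> : acoef J la r = (alpha ^+ n * n`!%:R)^-1 * (iter r halfD2 ('X_ord0 ^+ n))@_(expo n' (parts la)).
  have iterZ c (f : R) : iter r halfD2 (c *: f) = c *: iter r halfD2 f.
    by have := @iter_sum r 'I_1 (fun=> c) (fun=> f); rewrite !big_ord1.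
  rewrite -mcoeffZ -iterZ -jack_expand iter_sum mcoeff_sum; apply: eq_bigr => be _.
  by rewrite iter_jack !mcoeffZ mcoeff_emb // /jack_char -mulrA [_ * J _ _]mulrC.
have key : alpha ^- n * alpha ^+ rank la = alpha ^- ell la.
  by rewrite -{1}(subnK (ell_le la)) exprD invfM mulrAC mulVf ?mul1r ?expf_neq0.
by rewrite e -key invfM [alpha ^- n * n`!%:R^-1]mulrC -!mulrA.
Qed.

End Characters.

Theorem theorem2 (J : forall n : nat, intpart n -> symfun n) (hJ : is_jack J)
    (n : nat) (hn : (1 <= n)%N) (la : intpart n)
    (r : nat) (hr : (rank la <= r)%N) :
  exists g : nat -> int,
    acoef J la r =
      (n`!%:R)^-1 *
        \sum_(0 <= i < (r - rank la).+1)
          (g i)%:~R * alpha ^ (i%:Z - (ell la)%:Z)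
    /\ (forall i : nat, (i <= r - rank la)%N ->
          g i = (-1) ^+ (r - rank la) * g (r - rank la - i)%N).
Proof.
case: n hn la hr => // n' _ la hr.
have [z [q [sq hq ->]] ->] := acoef_integral hJ hr.
exists (fun i => q`_i); split=> //; congr (_ * _).
rewrite (horner_coef_wide _ (leq_trans (size_poly _ _) sq)) mulr_sumr big_mkord.
apply: eq_bigr => i _; rewrite coef_map mulrCA exprzDr ?unitfE ?(generic_neq0 generic_alpha) //.
by rewrite exprnN [alpha ^ _ * _]mulrC.
Qed.
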